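(* Let $\Gamma$ be a rhombic lattice in $\mathbb{R}^2$. Then there exists a fundamental domain $F$ for $\Gamma$ such that $P(\Gamma)$ is a subgroup of $\operatorname{Sym}(F)$ with $[\operatorname{Sym}(F):P(\Gamma)]=2$; in particular, $\operatorname{Sym}(F)$ is isomorphic to the dihedral group $D_4$ of order $8$.
   Context: A lattice $\Gamma\subseteq\mathbb{R}^2$ is the $\mathbb{Z}$-span of two linearly independent vectors. A rhombic lattice is a planar lattice having a basis of two vectors of equal length whose angle is not $\frac{\pi}{2}$, $\frac{\pi}{3}$ or $\frac{2\pi}{3}$ (i.e. it is neither a square nor a hexagonal lattice). The point group $P(\Gamma)$ is the group of Euclidean isometries of $\mathbb{R}^2$ fixing the origin and mapping $\Gamma$ onto itself; for a rhombic lattice it is isomorphic to the dihedral group $D_2$ of order $4$. For $X\subseteq\mathbb{R}^2$, $\operatorname{Sym}(X)$ denotes the group of Euclidean isometries of $\mathbb{R}^2$ leaving $X$ invariant. A fundamental domain for $\Gamma$ is a compact set $F\subseteq\mathbb{R}^2$ such that (i) $F+\Gamma=\{p+v: p\in F, v\in\Gamma\}=\mathbb{R}^2$ and (ii) for every nonzero $v\in\Gamma$, $\operatorname{int}(F)\cap\operatorname{int}(F+v)=\varnothing$. *)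

(* Defs.v *)
(* the plane is R * R for an arbitrary R : realType,
   with its product (= Euclidean) topology. *)
From HB Require Import structures.
From mathcomp Require Import all_boot all_order all_algebra.
From mathcomp Require Import all_classical all_reals all_analysis.
Set Implicit Arguments. Unset Strict Implicit. Unset Printing Implicit Defensive.
Import Order.TTheory GRing.Theory Num.Theory.
Import numFieldNormedType.Exports.
Local Open Scope classical_set_scope.
Local Open Scope ring_scope.

Notation pt R := (R * R)%type.

Section Plane.
Variable R : realType.

Local Notation pt := (R * R)%type.

Definition padd (p q : pt) : pt := (p.1 + q.1, p.2 + q.2).
Definition psub (p q : pt) : pt := (p.1 - q.1, p.2 - q.2).
Definition pscale (a : R) (p : pt) : pt := (a * p.1, a * p.2).
Definition origin : pt := (0, 0).

Definition dotp (p q : pt) : R := p.1 * q.1 + p.2 * q.2.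
Definition enorm (p : pt) : R := Num.sqrt (dotp p p).
Definition edist (p q : pt) : R := enorm (psub p q).

Definition isometry (f : pt -> pt) : Prop :=
  forall p q, edist (f p) (f q) = edist p q.

Definition lin_indep (u v : pt) : Prop :=
  forall a b : R, padd (pscale a u) (pscale b v) = origin -> a = 0 /\ b = 0.

Definition zspan (u v : pt) : set pt :=
  [set p | exists a b : int, p = padd (pscale a%:~R u) (pscale b%:~R v)].

Definition is_basis (G : set pt) (u v : pt) : Prop :=
  lin_indep u v /\ G = zspan u v.

Definition lattice (G : set pt) : Prop := exists u v, is_basis G u v.

(* rhombic lattice: a basis of two vectors of equal length whose angle is not
   pi/2, pi/3, 2pi/3.  For |u| = |v| = l > 0 the angle theta satisfies
   cos theta = <u,v> / l^2, so these angles correspond to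
   <u,v> = 0, <u,v> = l^2/2, <u,v> = - l^2/2 respectively. *)
Definition rhombic (G : set pt) : Prop :=
  exists u v, is_basis G u v /\ enorm u = enorm v /\
    dotp u v != 0 /\ dotp u v != dotp u u / 2 /\ dotp u v != - (dotp u u / 2).

Definition point_group (G : set pt) : set (pt -> pt) :=
  [set f | isometry f /\ f origin = origin /\ f @` G = G].

Definition Sym (X : set pt) : set (pt -> pt) :=
  [set f | isometry f /\ f @` X = X].

Definition translate (F : set pt) (v : pt) : set pt := [set padd p v | p in F].

Definition fundamental_domain (G : set pt) (F : set pt) : Prop :=
  compact F /\
  [set padd p v | p in F & v in G] = setT /\
  (forall v, G v -> v != origin -> interior F `&` interior (translate F v) = set0).

Definition index2 (K H : set (pt -> pt)) : Prop :=
  H `<=` K /\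
  exists g, K g /\ ~ H g /\ K = H `|` [set g \o h | h in H].

(* K is isomorphic to the dihedral group D4 of order 8, written via the
   presentation <r, s | r^4 = s^2 = 1, s r s = r^-1>, with the 8 words
   r^k s^e (k < 4, e < 2) distinct and exhausting K. *)
Definition isomorphic_D4 (K : set (pt -> pt)) : Prop :=
  exists r s, K r /\ K s /\
    iter 4 (comp r) id = id /\ s \o s = id /\ s \o r \o s = iter 3 (comp r) id /\
    let w := fun (k : 'I_4) (e : bool) => iter k (comp r) id \o (if e then s else id) in
    (forall k e k' e', w k e = w k' e' -> k = k' /\ e = e') /\
    K = [set w k e | k in [set: 'I_4] & e in [set: bool]].

End Plane.

(* Main.v *)
(* After a rotation, G = {(a (i + j), b (i - j))} with a, b > 0; its point group is generated by
   the two axis reflections, and together with the swap s of the coordinates it generates D4.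
   It suffices to find a bounded open D4-invariant U whose G-translates are disjoint and have
   dense union: then closure U is a fundamental domain, and adding the four far points (N, 0),
   (-N, 0), (0, N), (0, -N) cuts Sym down to D4.

   U is a union of countably many D4-orbits of small boxes, the translates of each new one
   meeting the next box of a countable base.  Such a U is disjoint both from its G- and
   from its s(G)-translates.  If G and s(G) meet only in 0, the points of a coset of
   G + s(G) lying in U form a partial injection between G and s(G) of bounded displacement,
   in fact a matching in the graph of all pairs of bounded displacement.  The invariant is
   Hall's condition for the part of the graph compatible with U, on every coset.  An
   alternating-set argument yields a new pair that keeps Hall's condition on its own coset,
   hence, U being locally constant near generic points, locally on all nearby cosets; Hall's
   condition for all finite sets follows since new pairs are very sparse while finite
   planar sets have large boundary.  If G and s(G) share a nonzero vector, then G + s(G) is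
   a lattice, and translating one box by g + s(g), for g running over representatives of G
   modulo s(G), fills a whole coset at once. *)
Require Import Defs.
From mathcomp Require Import all_boot all_order all_algebra zify ring lra finmap.
From mathcomp Require Import all_classical all_reals all_analysis.
Set Implicit Arguments. Unset Strict Implicit. Unset Printing Implicit Defensive.
Local Open Scope fset_scope.
Local Open Scope nat_scope.

(** * Hall's condition *)

(** The obstacle is that a box cannot be placed for one pair alone. If G and s(G) meet only in 0,
    the group G + s(G) has rank 4 and is not discrete in the plane, so a box adds infinitely many
    pairs to the coset of its centre, and pairs to uncountably many other cosets, while the exchange
    argument controls a single pair. The condition is therefore secured first for sets of bounded
    diameter, which see at most one new pair once the box is small. This bound has to be known
    before the box is chosen: it depends on the number of stages, not on the stages themselves. For
    larger sets the loss is paid for by the boundary: a pair of stage i is isolated enough to be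
    surrounded by 2 ^ (i + 1) disjoint annuli, and the weights 1 / 2 ^ (i + 1) have a sum below 1.
    Isoperimetry needs both lattices on the same integer grid, which is what a bijection of bounded
    displacement between them provides; the same bijection proves the invariant for the empty
    set. *)

Section Hall.
Variables (L M : choiceType).
Implicit Types (n : L -> {fset M}) (S : {fset L}).

Definition nbh n S : {fset M} := \bigcup_(g <- S) n g.

Lemma nbhP n S h : reflect (exists2 g, g \in S & h \in n g) (h \in nbh n S).
Proof.
apply: (iffP (bigfcupP _ _ _ _)) => [[g /andP[gS _] hg]|[g gS hg]].
  by exists g.
by exists g => //; rewrite gS.
Qed.

Lemma nbhU n S S' : nbh n (S `|` S') = nbh n S `|` nbh n S'.
Proof.
apply/fsetP => h; rewrite inE; apply/nbhP/orP.
  by move=> [g]; rewrite inE => /orP[] gS hg; [left|right]; apply/nbhP; exists g.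
by case=> /nbhP[g gS hg]; exists g; rewrite // inE gS ?orbT.
Qed.

Lemma nbhS n S S' : S `<=` S' -> nbh n S `<=` nbh n S'.
Proof.
move=> sS; apply/fsubsetP => h /nbhP[g gS hg].
by apply/nbhP; exists g => //; apply: (fsubsetP sS).
Qed.

Lemma nbhI n S S' : nbh n (S `&` S') `<=` nbh n S `&` nbh n S'.
Proof. by rewrite fsubsetI !nbhS ?fsubsetIl ?fsubsetIr. Qed.

Definition hall n := forall S, #|` S| <= #|` nbh n S|.
Definition tight n S := #|` nbh n S| = #|` S|.

(** The size of the neighbourhood is submodular and that of the set is modular, so two tight sets
    leave no slack in Hall's condition for their union and intersection. *)
Lemma tightUI n S S' : hall n -> tight n S -> tight n S' ->
  tight n (S `|` S') /\ tight n (S `&` S') /\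
  nbh n (S `&` S') = nbh n S `&` nbh n S'.
Proof.
move=> H tS tS'; have HU := H (S `|` S'); have HI := H (S `&` S').
have sI := nbhI n S S'; have lI := fsubset_leq_card sI.
have e1 := cardfsUI S S'; have e2 := cardfsUI (nbh n S) (nbh n S').
rewrite -nbhU in e2; rewrite /tight in tS tS' *.
have eI : #|` nbh n (S `&` S')| = #|` nbh n S `&` nbh n S'| by lia.
by split; [lia|split; [lia|exact/fsetP/(fsubset_cardP eI)]].
Qed.

End Hall.

(** * Fixing one edge without losing Hall's condition *)

Section Exchange.
Variables (L M : choiceType) (n : L -> {fset M}) (m : M -> {fset L}).
Hypothesis dual : forall g h, (h \in n g) = (g \in m h).
Hypotheses (hn : hall n) (hm : hall m).

(** The graph left over for matchings that contain the pair [(x, y)]. *)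
Definition force (A B : choiceType) (f : A -> {fset B}) x y g :=
  if g == x then [fset y] else f g `\ y.

Lemma force_bad (A B : choiceType) (f : A -> {fset B}) x y :
  y \in f x -> hall f -> ~ hall (force f x y) ->
  exists S, [/\ tight f S, x \notin S & y \in nbh f S].
Proof.
move=> xy hf /existsNP[S /negP bad].
have key T : x \notin T -> nbh (force f x y) T = nbh f T `\ y.
  move=> xT; apply/fsetP => h; rewrite !inE; apply/nbhP/andP.
    move=> [g gT]; rewrite /force; case: eqP => [eg|_].
      by move: xT; rewrite -eg gT.
    by rewrite !inE => /andP[-> hg]; split => //; apply/nbhP; exists g.
  move=> [hy /nbhP[g gT hg]]; exists g => //; rewrite /force; case: eqP => [eg|_].
    by move: xT; rewrite -eg gT.
  by rewrite !inE hy.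
have [xS|xS] := boolP (x \in S); last first.
  exists S; split => //; move: bad; rewrite key //; have := hf S;
    have := cardfsD1 y (nbh f S); rewrite /tight; case: (y \in nbh f S) => /=; lia.
pose T := S `\ x; have xT : x \notin T by rewrite !inE eqxx.
exists T; split => //; move: bad.
all: have -> : nbh (force f x y) S = y |` nbh (force f x y) T
  by rewrite -{1}(fsetD1K xS) nbhU /nbh big_seq_fset1 /force eqxx.
all: rewrite key // cardfsU1 !inE eqxx /= (cardfsD1 x S) xS -/T.
all: have := hf T; have := cardfsD1 y (nbh f T); rewrite /tight.
all: case: (y \in nbh f T) => //=; lia.
Qed.

(* If every neighbour y of x were obstructed, it would lie in the neighbourhood of a tight set
   avoiding x, on one side or the other; tight sets being closed under unions and
   intersections, one such set S and one such T would account for all y, and counting the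
   neighbours of S minus those of T, and conversely, gives a contradiction. *)
Lemma exchange x : exists y, [/\ y \in n x, hall (force n x y) & hall (force m y x)].
Proof.
apply: contrapT => /forallNP bad.
(* Obstructions on the left are merged by union, those on the right by intersection. [None] is the
   empty intersection, which would be all of [M] and need not be finite. *)
pose sep (S : {fset L}) (t : option {fset M}) y :=
  y \in nbh n S \/ (if t is Some T then y \notin T : Prop else False).
pose okt (t : option {fset M}) := if t is Some T then tight m T /\ x \in nbh m T else True.
have [S [t [tS xS ot st]]] : exists S t, [/\ tight n S, x \notin S, okt t &
    {in n x, forall y, sep S t y}].
  suff gen (s : seq M) : {subset s <= n x} -> exists S t,
      [/\ tight n S, x \notin S, okt t & {in s, forall y, sep S t y}].
    by have [//|S [t [? ? ? st]]] := gen (n x); exists S, t.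
  elim: s => [_|y s IH sub].
    exists fset0, None; split => //.
    by rewrite /tight /nbh big_seq_fset0.
  have [|S [t [tS xS ot st]]] := IH; first by move=> z zs; apply: sub; rewrite inE zs orbT.
  have xy : y \in n x by apply: sub; rewrite inE eqxx.
  have yx : x \in m y by rewrite -dual.
  have [hL|/(force_bad xy hn)[S' [tS' xS' yS']]] := pselect (hall (force n x y)); last first.
    have [tU _] := tightUI hn tS tS'.
    exists (S `|` S'), t; split => //; first by rewrite inE negb_or xS.
    move=> z; rewrite inE => /orP[/eqP->|/st[zS|zt]]; last by right.
      by left; rewrite nbhU inE yS' orbT.
    by left; rewrite nbhU inE zS.
  have [hM|/(force_bad yx hm)[T' [tT' yT' xT']]] := pselect (hall (force m y x)).
    by case: (bad y).
  case: t ot st => [T [tT xT] st|_ st].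
    have [_ [tI eI]] := tightUI hm tT tT'.
    exists S, (Some (T `&` T')); split => //; first by split => //; rewrite eI inE xT.
    move=> z; rewrite inE => /orP[/eqP->|/st[zS|zt]].
    - by right; rewrite inE negb_and yT' orbT.
    - by left.
    - by right; rewrite inE negb_and zt.
  exists S, (Some T'); split => //.
  by move=> z; rewrite inE => /orP[/eqP->|/st[zS|//]]; [right|left].
case: t ot st => [T [tT xT] st|_ st]; last first.
  have := hn (x |` S); rewrite cardfsU1 xS nbhU /= [nbh n [fset x]]big_seq_fset1.
  have /fsetUidPr -> : n x `<=` nbh n S by apply/fsubsetP => y /st [].
  by rewrite tS; lia.
(* Hall's condition for [S0] bounds the part of [T] in [nbh n S] by the part of [S] in [nbh m T].
   For [T0] it gives the strict opposite: [x] lies in [nbh m T] but is not reached from [T0], its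
   neighbours in [T] being neighbours of [S]. *)
pose T0 := T `\` nbh n S.
pose S0 := S `\` nbh m T.
have sub1 : nbh n S0 `<=` nbh n S `\` T.
  apply/fsubsetP => y /nbhP[g]; rewrite !inE => /andP[gT gS] yg; apply/andP; split.
    by apply: contra gT => yT; apply/nbhP; exists y; rewrite // -dual.
  by apply/nbhP; exists g.
have sub2 : nbh m T0 `<=` (nbh m T `\` S) `\ x.
  apply/fsubsetP => g /nbhP[y]; rewrite !inE => /andP[yS yT] gy; apply/and3P; split.
  - apply/eqP => gx; have := st y; rewrite dual -gx => /(_ gy)[]; first exact/negP.
    by rewrite yT.
  - by apply: contra yS => gS; apply/nbhP; exists g; rewrite // dual.
  - by apply/nbhP; exists y.
have := hn S0; have := hm T0.
have := fsubset_leq_card sub1; have := fsubset_leq_card sub2.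
have := cardfsID (nbh m T) S; have := cardfsID (nbh n S) T; rewrite -/S0 -/T0.
have := cardfsID T (nbh n S); have := cardfsID S (nbh m T).
have := cardfsD1 x (nbh m T `\` S); rewrite inE xT xS /=.
rewrite tS tT [nbh n S `&` T]fsetIC [nbh m T `&` S]fsetIC; lia.
Qed.

End Exchange.

(** * Hall's condition and isoperimetry in the plane *)

Notation Z2 := (int * int)%type.

Definition near k (u v : Z2) :=
  (absz (u.1 - v.1)%R <= k) && (absz (u.2 - v.2)%R <= k).

Lemma nearC k u v : near k u v = near k v u.
Proof. by rewrite /near; lia. Qed.

Lemma near_refl k u : near k u u.
Proof. by rewrite /near; lia. Qed.

Lemma near_le k l u v : k <= l -> near k u v -> near l u v.
Proof. by rewrite /near; lia. Qed.

Lemma near_trans k l u v w : near k u v -> near l v w -> near (k + l) u w.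
Proof. by rewrite /near; lia. Qed.

Definition ball k (x : Z2) : {fset Z2} :=
  [fset ((x.1 + (Posz i - Posz k))%R, (x.2 + (Posz j - Posz k))%R) |
     i in iota 0 k.*2.+1, j in iota 0 k.*2.+1].

Lemma in_ball k x v : (v \in ball k x) = near k v x.
Proof.
have io i : (i \in iota 0 k.*2.+1) = (i <= k.*2) by rewrite mem_iota; lia.
apply/imfset2P/idP => [[i Hi [j Hj ->]]|].
  by move: (Hi : i \in iota 0 k.*2.+1) (Hj : j \in iota 0 k.*2.+1);
    rewrite !io /near /=; lia.
case: v => v1 v2; rewrite /near /= => H.
exists (absz (v1 - x.1 + Posz k)%R).
  by rewrite [_ \in _]io; lia.
exists (absz (v2 - x.2 + Posz k)%R); first by rewrite [_ \in _]io; lia.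
by congr pair; lia.
Qed.

Definition nb q (e : rel Z2) g : {fset Z2} := [fset h in ball q g | e g h].

Lemma in_nb q (e : rel Z2) g h : (forall g h, e g h -> near q g h) ->
  (h \in nb q e g) = e g h.
Proof.
move=> loc; rewrite !inE /= in_ball nearC.
by case E: (e g h); rewrite ?andbF // (loc _ _ E).
Qed.

Lemma line_ind (P : int -> Prop) (lo hi : int) :
  (forall t, (lo <= t < hi)%R -> P t <-> P (t + 1)%R) ->
  forall t t', (lo <= t <= hi)%R -> (lo <= t' <= hi)%R -> P t -> P t'.
Proof.
move=> H t t' t1 t2.
have up k : forall s, (lo <= s)%R -> (s + Posz k <= hi)%R -> P s <-> P (s + Posz k)%R.
  elim: k => [|k IH] s s1 s2; first by rewrite GRing.addr0.
  have -> : (s + Posz k.+1 = (s + Posz k) + 1)%R by lia.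
  rewrite (IH s) //; last lia.
  by apply: H; lia.
case: (Order.TotalTheory.leP t t') => tt'.
  have -> : (t' = t + Posz (absz (t' - t)))%R by lia.
  by rewrite -up //; lia.
have {1}-> : (t = t' + Posz (absz (t - t')))%R by lia.
by rewrite -up //; lia.
Qed.

(** * Square annuli are connected *)

Section Annulus.
Variables (x : Z2) (m w : nat).
Hypothesis w0 : 0 < w.
Definition annulus v := near (m + w) v x && ~~ near m v x.

(** Rows and columns at distance more than [m] from the centre cross the square inside the annulus;
    at most two of them join any point to the corner [c], so a predicate constant along unit steps
    would be constant. *)
Lemma annulus_boundary (P : pred Z2) s t :
  annulus s -> annulus t -> P s -> ~~ P t ->
  exists v v', [/\ annulus v', near 1 v v', P v & ~~ P v'].
Proof.
move=> As At Ps Pt; apply: contrapT => noex.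
have step v v' : annulus v -> annulus v' -> near 1 v v' -> P v <-> P v'.
  move=> Av Av' vv'; split => H; apply: contrapT => /negP H'; apply: noex.
    by exists v, v'.
  by exists v', v; rewrite nearC.
pose c : Z2 := ((x.1 + Posz m.+1)%R, (x.2 + Posz m.+1)%R).
have hor a b b' : (m < absz (a - x.1)%R <= m + w) -> absz (b - x.2)%R <= m + w ->
    absz (b' - x.2)%R <= m + w -> P (a, b) -> P (a, b').
  move=> ha hb hb'; apply: (@line_ind (fun y => P (a, y)) (x.2 - Posz (m + w))%R
     (x.2 + Posz (m + w))%R) => [y hy| |]; try lia.
  by apply: step; rewrite /annulus /near /=; lia.
have ver a b b' : (m < absz (a - x.2)%R <= m + w) -> absz (b - x.1)%R <= m + w ->
    absz (b' - x.1)%R <= m + w -> P (b, a) -> P (b', a).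
  move=> ha hb hb'; apply: (@line_ind (fun y => P (y, a)) (x.1 - Posz (m + w))%R
     (x.1 + Posz (m + w))%R) => [y hy| |]; try lia.
  by apply: step; rewrite /annulus /near /=; lia.
have toc v : annulus v -> P v <-> P c.
  case: v => a b Av; have : annulus (a, b) := Av.
  rewrite /annulus /near /= => H.
  have [ha|ha] := leqP (absz (a - x.1)%R) m.
    split=> H'.
      apply: (hor _ b); [lia..|]; apply: (ver _ a) => //; lia.
    apply: (ver _ c.1); [rewrite /=; lia..|]; apply: (hor _ c.2) => //=; rewrite /=; lia.
  split=> H'.
    apply: (ver _ a); [lia..|]; apply: (hor _ b) => //; lia.
  apply: (hor _ c.2); [rewrite /=; lia..|]; apply: (ver _ c.1) => //=; rewrite /=; lia.
by move/negP: Pt; apply; apply/(toc t At)/(toc s As).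
Qed.

End Annulus.

Lemma leq_card_inj2 (D H : {fset Z2}) (k : nat) (b : Z2 -> nat -> Z2) :
  (forall y r, y \in H -> r < k -> b y r \in D) ->
  (forall y r y' r', y \in H -> r < k -> y' \in H -> r' < k ->
     b y r = b y' r' -> y = y' /\ r = r') ->
  #|` H| * k <= #|` D|.
Proof.
move=> bD binj; rewrite -[k in X in X <= _](size_iota 0) -(size_allpairs b).
apply: uniq_leq_size.
  apply: allpairs_uniq; [exact: fset_uniq|exact: iota_uniq|].
  move=> [y r] [y' r'] /= /allpairsP[[? ?] /= [yH rk [-> ->]]].
  move=> /allpairsP[[? ?] /= [yH' rk' [-> ->]]] /binj E.
  by move: rk rk'; rewrite !mem_iota !add0n /= => rk rk'; have [-> ->] := E yH rk yH' rk'.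
move=> _ /allpairsP[[y r] /= [yH rk ->]]; apply: bD => //.
by move: rk; rewrite mem_iota.
Qed.

(** Outer radius of the last of [2 ^ i.+1] consecutive annuli of width [q.*2], the first of which
    has inner radius [q.*2]. *)
Definition radius q i := (2 ^ i.+1).+1 * q.*2.

Lemma radius_le q i j : i <= j -> radius q i <= radius q j.
Proof. by move=> ij; rewrite /radius leq_mul2r ltnS leq_exp2l // ltnS ij orbT. Qed.

(** * From Hall's condition on small sets to all finite sets *)

Section PlanarHall.
Variables (q n : nat) (e : rel Z2) (us : nat -> rel Z2).
Hypothesis q0 : 0 < q.
Hypothesis eq : forall g h, e g h -> near q g h.
Hypothesis e1 : forall g h, near 1 g h -> e g h.
Hypothesis ue : forall i g h, i < n -> us i g h -> e g h.
Hypothesis sep : forall i g h g' h', i < n -> us i g h -> us i g' h' ->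
  near (radius q i).*2 g g' -> g = g' /\ h = h'.

Definition matched k g h := exists2 i, i < k & us i g h.

Hypothesis uniL : forall g h g', matched n g h -> matched n g' h -> g = g'.
Hypothesis uniM : forall g h h', matched n g h -> matched n g h' -> h = h'.

(** Only [h] is protected here: a matched [g] may still use an unmatched [h]. This one-sided form is
    enough, see [sat_both]. *)
Definition okL g h := e g h && `[< forall g', matched n g' h -> g' = g >].
Definition okM h g := e g h && `[< forall h', matched n g h' -> h' = h >].

Definition small_hall (r : rel Z2) := forall c (S : {fset Z2}),
  (forall v, v \in S -> near (radius q n) v c) -> #|` S| <= #|` nbh (nb q r) S|.

Hypothesis smallL : small_hall okL.
Hypothesis smallM : small_hall okM.

Let N (S : {fset Z2}) := nbh (nb q e) S.
Let NL (S : {fset Z2}) := nbh (nb q okL) S.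
Let NM (S : {fset Z2}) := nbh (nb q okM) S.
(** For [k = n], the only neighbours that passing from [e] to [okL] can take away from [S]. *)
Let hits k (S : {fset Z2}) : {fset Z2} :=
  [fset h in N S | `[< exists2 g, g \notin S & matched k g h >]].

Let inN S h : reflect (exists2 g, g \in S & e g h) (h \in N S).
Proof. by apply: (iffP (nbhP _ _ _)) => -[g gS gh]; exists g; move: gh; rewrite // in_nb. Qed.

Let inNL S h : reflect (exists2 g, g \in S & okL g h) (h \in NL S).
Proof.
have loc g' h' : okL g' h' -> near q g' h' by move=> /andP[/eq].
by apply: (iffP (nbhP _ _ _)) => -[g gS gh]; exists g; move: gh; rewrite // (in_nb _ _ loc).
Qed.

Let inNM S g : reflect (exists2 h, h \in S & okM h g) (g \in NM S).
Proof.
have loc g' h' : okM g' h' -> near q g' h' by move=> /andP[/eq]; rewrite nearC.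
by apply: (iffP (nbhP _ _ _)) => -[h hS gh]; exists h; move: gh; rewrite // (in_nb _ _ loc).
Qed.

Let inhits k S h : reflect (h \in N S /\ exists2 g, g \notin S & matched k g h) (h \in hits k S).
Proof.
rewrite !inE /=; apply: (iffP andP) => -[hS]; first by move/asboolP.
by move=> H; split => //; apply/asboolP.
Qed.

Let NLN S : NL S `<=` N S.
Proof. by apply/fsubsetP => h /inNL[g gS /andP[gh _]]; apply/inN; exists g. Qed.

Let N_hits S : N S `\` hits n S `<=` NL S.
Proof.
apply/fsubsetP => h; rewrite inE => /andP[/inhits nhit hN]; apply/inNL.
have [[g gh]|nm] := pselect (exists g, matched n g h); last first.
  have /inN[g gS gh] := hN; exists g => //; rewrite /okL gh.
  by apply/asboolP => g' g'h; case: nm; exists g'.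
exists g; first by apply: contrapT => /negP gS; apply: nhit; split => //; exists g.
have [i ni ui] := gh; rewrite /okL (ue ni ui).
by apply/asboolP => g' g'h; apply: uniL gh.
Qed.

Let grow S := nbh (nb 1 (near 1)) S.
Let ingrow S h : reflect (exists2 g, g \in S & near 1 g h) (h \in grow S).
Proof. by apply: (iffP (nbhP _ _ _)) => -[g gS gh]; exists g; move: gh; rewrite // in_nb. Qed.
Let bd S := grow S `\` S.

Let sub_grow S : S `<=` grow S.
Proof. by apply/fsubsetP => g gS; apply/ingrow; exists g; rewrite ?near_refl. Qed.

Let growN S : grow S `<=` N S.
Proof. by apply/fsubsetP => h /ingrow[g gS gh]; apply/inN; exists g; rewrite ?e1. Qed.

Let w := q.*2.
Let ann r x := annulus x (r.+1 * w) w.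

Let crossing S := forall i g h r, i < n -> us i g h -> g \notin S -> h \in N S ->
  r < 2 ^ i.+1 -> (exists2 s, s \in S & ann r g s) /\ (exists2 t, t \notin S & ann r g t).

(* Around a pair of stage [i] there are [2 ^ i.+1] disjoint annuli, each containing a boundary
   point of [S]; pairs of the same stage being far apart, they have disjoint annuli. *)
Let crossing_hits S : crossing S -> #|` hits n S| <= #|` bd S|.
Proof.
move=> cr.
(* Stage [i] contributes at most the fraction [1 / 2 ^ i.+1] of the boundary; the first [k]
   fractions add up to [1 - 1 / 2 ^ k]. *)
have P k : k <= n -> #|` hits k S| * 2 ^ k <= #|` bd S| * (2 ^ k - 1).
  elim: k => [_|k IH kn].
    rewrite expn0 subnn muln0 muln1 leqn0 cardfs_eq0; apply/eqP/fsetP => h.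
    by rewrite [in RHS]inE; apply/inhits => -[_ [g _ []]].
  pose H := [fset h in hits k.+1 S | `[< exists2 g, g \notin S & us k g h >]].
  have HP h : h \in H -> h \in N S /\ exists2 g, g \notin S & us k g h.
    by rewrite !inE => /andP[/andP[? _] /asboolP].
  have sub : hits k.+1 S `<=` hits k S `|` H.
    apply/fsubsetP => h hk; have /inhits[hN [g gS [i ik ui]]] := hk.
    rewrite inE; move: ik; rewrite ltnS leq_eqVlt => /orP[/eqP ik|ik].
      apply/orP; right; rewrite inE; apply/andP; split => //.
      by apply/asboolP; exists g; rewrite // -ik.
    by apply/orP; left; apply/inhits; split => //; exists g => //; exists i.
  have cH : #|` H| * 2 ^ k.+1 <= #|` bd S|.
    have [x hx] : exists x, forall h, h \in H -> x h \notin S /\ us k (x h) h.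
      suff /choice[x hx] : forall h, exists g, h \in H -> g \notin S /\ us k g h by exists x.
      move=> h; case: (boolP (h \in H)) => [/HP[_ [g gS uk]]|_]; first by exists g.
      by exists h.
    have [b hb] : exists b : Z2 -> nat -> Z2, forall h r, h \in H -> r < 2 ^ k.+1 ->
        b h r \in bd S /\ ann r (x h) (b h r).
      suff /choice[b hb] : forall hr : Z2 * nat, exists v, hr.1 \in H ->
          hr.2 < 2 ^ k.+1 -> v \in bd S /\ ann hr.2 (x hr.1) v.
        by exists (fun h r => b (h, r)) => h r; exact: (hb (h, r)).
      move=> [h r] /=; case: (boolP (h \in H)) => [hH|_]; last by exists h.
      case: (ltnP r (2 ^ k.+1)) => [rk|_]; last by exists h.
      have [xS ux] := hx _ hH; have [hN _] := HP _ hH.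
      have [[s sS As] [t tS At]] := cr _ _ _ _ kn ux xS hN rk.
      have w0 : 0 < w by rewrite double_gt0.
      have [v [v' [Av' vv' vS v'S]]] := annulus_boundary w0 As At sS tS.
      exists v' => _ _; split => //; rewrite inE v'S; apply/ingrow.
      by exists v.
    apply: (leq_card_inj2 (b := b)) => [h r hH rk|h r h' r' hH rk hH' rk' E].
      by have [] := hb _ _ hH rk.
    have [_ /andP[A1 A2]] := hb _ _ hH rk.
    have [_ /andP[A1' A2']] := hb _ _ hH' rk'.
    have out s : s < 2 ^ k.+1 -> s.+1 * w + w <= radius q k.
      by move=> sk; rewrite -mulSnr /radius leq_mul2r ltnS sk orbT.
    have nr1 := near_le (out _ rk) A1.
    have := near_le (out _ rk') A1'; rewrite -E nearC => nr2.
    have := near_trans nr2 nr1; rewrite addnn => nr3.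
    have [[_ ux] [_ ux']] := (hx _ hH, hx _ hH').
    have [ex ->] := sep kn ux' ux nr3; split => //.
    move: A1 A2 A1' A2'; rewrite -E ex => A1 A2 A1' A2'.
    have le s s' : near (s.+1 * w + w) (b h r) (x h) -> ~~ near (s'.+1 * w) (b h r) (x h) ->
        s' <= s.
      move=> n1 n2; rewrite leqNgt; apply: contra n2 => ss.
      by apply: near_le n1; rewrite -mulSnr leq_mul2r ltnS ss orbT.
    by apply/eqP; rewrite eqn_leq !le.
  have := fsubset_leq_card sub; have := leq_card_fsetU (hits k S) H => -[U _].
  move=> U'; have := IH (ltnW kn); have := leq_trans U' U.
  have := expn_gt0 2 k; rewrite expnS in cH *.
  move: #|` hits k S| #|` hits k.+1 S| #|` H| #|` bd S| (2 ^ k) cH => a b c d p.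
  move=> cH /= p0 hb ha; have b2 : b * p <= (a + c) * p by rewrite leq_mul2r hb orbT.
  have -> : d * (2 * p - 1) = 2 * (d * p) - d by rewrite mulnBr muln1; lia.
  rewrite mulnBr muln1 in ha; have : d <= d * p by rewrite leq_pmulr.
  rewrite mulnDl in b2; lia.
have := P n (leqnn n); have := expn_gt0 2 n => /= p0 H.
rewrite -(leq_pmul2r p0); apply: leq_trans H _.
by rewrite leq_mul2l leq_subr orbT.
Qed.

(** The neighbourhood contains [S] and its unit boundary, and at most as many points as the boundary
    has are lost. *)
Let crossing_hall S : crossing S -> #|` S| <= #|` NL S|.
Proof.
move=> /crossing_hits ch.
have := fsubset_leq_card (N_hits S); have := fsubset_leq_card (growN S).
have sub : hits n S `<=` N S by apply/fsubsetP => h /inhits[].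
have := cardfsDS sub; have := fsubset_leq_card sub.
have := cardfsDS (sub_grow S); have := fsubset_leq_card (sub_grow S).
rewrite /bd in ch *; lia.
Qed.

(* Induction on the number of pairs used by the complement of [S], then on [S]: if some annulus
   around such a pair misses [S], it splits [S] into two independent parts; if it lies in [S],
   the hole it surrounds can be filled. *)
Theorem planar_hall : hall (nb q okL).
Proof.
move=> S; rewrite -/(NL S); move: {2}#|` hits n S| (leqnn #|` hits n S|) => k.
elim/ltn_ind: k S => k IHk S; move: {2}#|` S| (leqnn #|` S|) => c.
elim/ltn_ind: c S => c IHc S Sc Sk.
have [//|/existsNP[i /existsNP[x /existsNP[y /existsNP[r]]]]] := pselect (crossing S).
  exact: crossing_hall.
move=> /not_implyP[ni] /not_implyP[ui] /not_implyP[xS] /not_implyP[yN] /not_implyP[ri].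
have mxy : matched n x y by exists i.
have rad : (r.+1 * w) + w <= radius q i by rewrite -mulSnr /radius leq_mul2r ltnS ri orbT.
have exy := ue ni ui.
have disj g h g' : e g h -> e g' h -> near w g g'.
  by move=> /eq gh /eq gh'; rewrite /w -addnn; apply: near_trans gh _; rewrite nearC.
move/not_andP => [noS|noT].
  pose Si := [fset v in S | near (r.+1 * w) v x].
  pose So := [fset v in S | ~~ near (r.+1 * w + w) v x].
  have SiE v : (v \in Si) = (v \in S) && near (r.+1 * w) v x by rewrite !inE.
  have SoE v : (v \in So) = (v \in S) && ~~ near (r.+1 * w + w) v x by rewrite !inE.
  have SE : S = Si `|` So.
    apply/fsetP => v; rewrite in_fsetU SiE SoE; case vS: (v \in S) => //=.
    case n1: (near (r.+1 * w) v x) => //=; apply/esym/negP => n2; apply: noS.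
    by exists v => //; rewrite /ann /annulus n1 n2.
  have dS : [disjoint Si & So].
    apply/fdisjointP => v; rewrite SiE SoE => /andP[_ n1]; rewrite negb_and negbK.
    by rewrite (near_le _ n1) ?orbT // leq_addr.
  have far g g' h : g \in Si -> g' \in So -> e g h -> e g' h -> False.
    rewrite SiE SoE => /andP[_ n1] /andP[_ /negP n2] gh gh'; apply: n2.
    by rewrite addnC; apply: near_trans n1; apply: disj gh' gh.
  have dN : [disjoint NL Si & NL So].
    apply/fdisjointP => h /inNL[g gS /andP[gh _]]; apply/inNL => -[g' gS' /andP[gh' _]].
    exact: far gS gS' gh gh'.
  have hitS T : T = Si \/ T = So -> hits n T `<=` hits n S.
    move=> TE; apply/fsubsetP => h /inhits[/inN[g gT gh] [g' gT' m]].
    apply/inhits; split.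
      by apply/inN; exists g => //; rewrite SE inE; case: TE gT => -> ->; rewrite ?orbT.
    exists g' => //; rewrite SE inE; apply/negP => /orP gS'.
    have [j jn uj] := m; have gh' := ue jn uj.
    case: TE gT gT' => -> gT gT'; case: gS' => gS'; try by rewrite gS' in gT'.
      exact: far gT gS' gh gh'.
    exact: far gS' gT gh' gh.
  have cS : #|` S| = #|` Si| + #|` So|.
    by rewrite {1}SE cardfsU; move: dS; rewrite -fsetI_eq0 => /eqP->; rewrite cardfs0 subn0.
  have cN : #|` NL Si| + #|` NL So| <= #|` NL S|.
    rewrite {1}SE /NL nbhU cardfsU; move: dN; rewrite -fsetI_eq0 /NL => /eqP->.
    by rewrite cardfs0 subn0.
  have Si0 : 0 < #|` Si|.
    have /inN[g gS gy] := yN; rewrite cardfs_gt0; apply/fset0Pn; exists g.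
    rewrite SiE gS; apply: near_le (disj _ _ _ gy exy); exact: leq_pmull.
  (* If nothing lies beyond the annulus, [S] is a small set. Otherwise both parts are strictly
     smaller than [S] and hit no new points. *)
  have [So0|So0] := posnP #|` So|.
    apply: smallL (x) _ _ => v; rewrite SE inE (cardfs0_eq So0) inE orbF SiE => /andP[_].
    by apply: near_le; apply: leq_trans (radius_le q (ltnW ni)); apply: leq_trans rad; lia.
  have Hi := IHc #|` Si| ltac:(lia) Si (leqnn _)
    (leq_trans (fsubset_leq_card (hitS _ (or_introl erefl))) Sk).
  have Ho := IHc #|` So| ltac:(lia) So (leqnn _)
    (leq_trans (fsubset_leq_card (hitS _ (or_intror erefl))) Sk).
  lia.
pose B := ball (r.+1 * w) x.
have annS v : ann r x v -> v \in S by move=> Av; apply: contrapT => /negP vS; apply: noT; exists v.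
pose hole := B `\` S; pose S' := S `|` hole.
have holeE v : (v \in hole) = (v \notin S) && near (r.+1 * w) v x by rewrite inE in_ball.
have inhole g v : g \in hole -> near w v g -> v \notin S -> v \in hole.
  rewrite holeE => /andP[_ n1] n2 vS; rewrite holeE vS /=; apply: contrapT => /negP n3.
  move/negP: vS; apply; apply: annS; rewrite /ann /annulus n3 andbT addnC.
  exact: near_trans n2 n1.
have xh : x \in hole by rewrite holeE xS near_refl.
have hitS : hits n S' `<=` hits n S `\ y.
  apply/fsubsetP => h /inhits[/inN[g gS' gh] [g' gS m]].
  move: gS; rewrite in_fsetU negb_or => /andP[gS gh'].
  have [j jn uj] := m; have g'h := ue jn uj.
  rewrite in_fsetD1; apply/andP; split.
    apply/eqP => hy; move/negP: gh'; apply.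
    by move: m; rewrite hy => m; rewrite (uniL m mxy).
  apply/inhits; split; last by exists g'.
  apply/inN; move: gS'; rewrite in_fsetU => /orP[?|gho]; first by exists g.
  by case/negP: gh'; apply: inhole gho _ gS; apply: disj g'h gh.
have yhit : y \in hits n S by apply/inhits; split => //; exists x.
have lt : #|` hits n S'| < k.
  apply: leq_trans Sk; rewrite (cardfsD1 y (hits n S)) yhit add1n ltnS.
  exact: fsubset_leq_card.
have HS' := IHk _ lt S' (leqnn _).
(* Filling the hole gains at most as many neighbours as it adds vertices. Those new even for [e]
   form [Y1], matched into the hole by [smallM]; the others, [Y2], were denied to [S] because their
   partners lie in the hole, and these partners are not among the vertices [NM Y1]. *)
pose Y1 := N S' `\` N S.
pose Y2 := NL S' `\` (NL S `|` Y1).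
have Y1P h : h \in Y1 -> exists2 g, g \in hole & e g h.
  rewrite inE => /andP[/inN nS /inN[g gS' gh]]; exists g => //.
  move: gS'; rewrite in_fsetU => /orP[gS|//]; by case: nS; exists g.
have Y1N : NM Y1 `<=` hole.
  apply/fsubsetP => g /inNM[h hY /andP[gh _]]; have [g0 g0h eg0] := Y1P _ hY.
  apply: inhole g0h _ _; first exact: disj gh eg0.
  apply/negP => gS; move: hY; rewrite inE => /andP[/inN[]]; by exists g.
have Y2P h : h \in Y2 -> exists2 g, g \in hole `\` NM Y1 & matched n g h.
  rewrite inE in_fsetU negb_or => /andP[/andP[/inNL nL nY]] hL.
  have /inNL[g0 g0S' /andP[g0h /asboolP g0u]] := hL.
  have hS : h \in N S.
    by move: nY; rewrite inE negb_and negbK (fsubsetP (NLN S') _ hL) orbF.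
  have [g mg] : exists g, matched n g h.
    apply: contrapT => nm; apply: nL; have /inN[g gS gh] := hS; exists g => //.
    by rewrite /okL gh; apply/asboolP => g' mg'; case: nm; exists g'.
  have gg0 := g0u _ mg; exists g => //; rewrite inE; apply/andP; split.
    apply/inNM => -[h' hY' /andP[_ /asboolP u']]; have E := u' _ mg.
    by move: hY'; rewrite -E; apply/negP.
  move: g0S'; rewrite in_fsetU -gg0 => /orP[gS|//]; case: nL; exists g => //.
  by rewrite /okL {1}gg0 g0h; apply/asboolP => g' mg'; apply: uniL mg.
have cY2 : #|` Y2| <= #|` hole `\` NM Y1|.
  have [f hf] : exists f, forall h, h \in Y2 -> f h \in hole `\` NM Y1 /\ matched n (f h) h.
    suff /choice[f hf] : forall h, exists g, h \in Y2 -> g \in hole `\` NM Y1 /\ matched n g h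
      by exists f.
    move=> h; case: (boolP (h \in Y2)) => [/Y2P[g g1 g2]|_]; first by exists g.
    by exists h.
  rewrite -[X in X <= _]muln1; apply: (leq_card_inj2 (b := fun h _ => f h)).
    by move=> h r' hY _; have [] := hf _ hY.
  move=> h r0 h' r0' hY; rewrite ltnS leqn0 => /eqP-> hY'.
  rewrite ltnS leqn0 => /eqP-> E; split=> //.
  have [_ m1] := hf _ hY; have [_ m2] := hf _ hY'.
  by rewrite -E in m2; apply: uniM m1 m2.
have cY1 : #|` Y1| <= #|` NM Y1|.
  apply: smallM (x) _ _ => h /Y1P[g]; rewrite holeE => /andP[_ n1] /eq n2.
  rewrite nearC in n2; apply: near_le (near_trans n2 n1).
  apply: leq_trans (radius_le q (ltnW ni)); apply: leq_trans rad.
  by rewrite addnC leq_add2l /w -addnn leq_addr.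
have sub : NL S' `<=` NL S `|` (Y1 `|` Y2).
  apply/fsubsetP => h hL; rewrite !in_fsetU; case hS: (h \in NL S) => //=.
  case hY: (h \in Y1) => //=; by rewrite inE in_fsetU hS hY hL.
have c1 := fsubset_leq_card sub.
have [c2 _] := leq_card_fsetU (NL S) (Y1 `|` Y2).
have [c3 _] := leq_card_fsetU Y1 Y2.
have c4 := cardfsDS Y1N; have c5 := fsubset_leq_card Y1N.
have c6 : #|` S'| = #|` S| + #|` hole|.
  rewrite cardfsU; have -> : S `&` hole = fset0; last by rewrite cardfs0 subn0.
  apply/eqP; rewrite fsetI_eq0; apply/fdisjointP => v vS; by rewrite holeE vS.
lia.
Qed.

End PlanarHall.

Local Close Scope fset_scope.
Import Order.TTheory GRing.Theory Num.Theory.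
Import numFieldNormedType.Exports.
Local Open Scope classical_set_scope.
Local Open Scope ring_scope.

(** * The lattice and its image under the swap of coordinates *)

Lemma norm_int (R : realType) (i : int) (k : nat) : (absz i <= k)%N -> `|i%:~R| <= k%:R :> R.
Proof.
move=> ik; rewrite -intr_norm -[k%:R]/((Posz k)%:~R) ler_int; lia.
Qed.

Section Shear.
Variables F1 F2 F3 : int -> int.

(** In the coordinates [n = i - j] and [j], each step changes one coordinate by a function of the
    other, up to a final sign, so the map is bijective whatever the three functions are. This leaves
    them free for rounding. *)
Definition shear (v : Z2) : Z2 :=
  let n := v.1 - v.2 in
  let j1 := v.2 + F1 n in
  let n2 := n + F2 j1 in
  let j' := F3 n2 - j1 in
  (n2 + j', j').

Definition unshear (v : Z2) : Z2 :=
  let n2 := v.1 - v.2 in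
  let j1 := F3 n2 - v.2 in
  let n := n2 - F2 j1 in
  let j := j1 - F1 n in
  (n + j, j).

Lemma shearK : cancel shear unshear.
Proof.
by move=> [i j]; rewrite /shear /unshear /= addrK subKr !addrK subrK.
Qed.

Lemma unshearK : cancel unshear shear.
Proof.
by move=> [i j]; rewrite /shear /unshear /= addrK !subrK subKr subrK.
Qed.

End Shear.

Section Lattice.
Variable R : realType.
Local Notation P := (R * R)%type.
Variables a b : R.
Hypotheses (a0 : 0 < a) (b0 : 0 < b).

Definition swp (p : P) : P := (p.2, p.1).
Definition lattice_pt (v : Z2) : P := (a * (v.1 + v.2)%:~R, b * (v.1 - v.2)%:~R).
Local Notation pos := lattice_pt.
Definition swapped_pt v := swp (pos v).
Local Notation spos := swapped_pt.
Definition box (r : R) (p : P) : Prop := `|p.1| < r /\ `|p.2| < r.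

Lemma swpK : involutive swp. Proof. by case. Qed.
Lemma swpD p q : swp (p + q) = swp p + swp q. Proof. by []. Qed.
Lemma swpN p : swp (- p) = - swp p. Proof. by []. Qed.

Lemma posD u v : pos (u + v) = pos u + pos v.
Proof. by congr pair; rewrite /= !(rmorphD, rmorphN) /=; ring. Qed.
Lemma posN v : pos (- v) = - pos v.
Proof. by congr pair; rewrite /= !(rmorphD, rmorphN) /=; ring. Qed.
Lemma posB u v : pos (u - v) = pos u - pos v.
Proof. by rewrite posD posN. Qed.
Lemma pos0 : pos 0 = 0.
Proof. by congr pair; rewrite /= ?addr0 ?subr0 mulr0. Qed.
Lemma sposD u v : spos (u + v) = spos u + spos v.
Proof. by rewrite /spos posD. Qed.
Lemma sposN v : spos (- v) = - spos v.
Proof. by rewrite /spos posN. Qed.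
Lemma sposB u v : spos (u - v) = spos u - spos v.
Proof. by rewrite sposD sposN. Qed.
Lemma spos0 : spos 0 = 0.
Proof. by rewrite /spos pos0. Qed.

Lemma box_swp r p : box r (swp p) <-> box r p.
Proof. by split => -[]. Qed.
Lemma boxN r p : box r (- p) <-> box r p.
Proof. by rewrite /box /= !normrN. Qed.
Lemma boxD r s p q : box r p -> box s q -> box (r + s) (p + q).
Proof.
by move=> [p1 p2] [q1 q2]; split; apply: le_lt_trans (ler_normD _ _) _; rewrite ltrD.
Qed.
Lemma box_le r s p : r <= s -> box r p -> box s p.
Proof. by move=> rs [? ?]; split; apply: lt_le_trans rs. Qed.

Lemma floor_bound (c x : R) : 0 < c ->
  c * (Num.floor (x / c))%:~R <= x < c * (Num.floor (x / c))%:~R + c.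
Proof.
move=> c0; have /andP[h1 h2] := real_floor_itv (num_real (x / c)).
rewrite intrD in h2.
move: h1 h2; rewrite ler_pdivlMr // ltr_pdivrMr // => h1 h2.
by rewrite mulrC h1 /=; move: h2; rewrite mulrDl mul1r mulrC.
Qed.

(** In [reindex], each coordinate is affected by one rounding of step [2 * a] and one of step
    [b]. *)
Definition round_radius : R := 2 * a + b.
Local Notation rho := round_radius.

(* Three shears: along the rows of the lattice, along the direction (1, 1), and
   along the columns of the swapped lattice; each one only moves points a bounded
   distance, by rounding. *)
Definition reindex (v : Z2) : Z2 :=
  shear (fun n => Num.floor ((a - b) * n%:~R / (2 * a)))
    (fun j => Num.floor (2 * a * j%:~R / b))
    (fun n => Num.floor ((b - a) * n%:~R / (2 * a))) v.

Definition unreindex (v : Z2) : Z2 :=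
  unshear (fun n => Num.floor ((a - b) * n%:~R / (2 * a)))
    (fun j => Num.floor (2 * a * j%:~R / b))
    (fun n => Num.floor ((b - a) * n%:~R / (2 * a))) v.

(** Up to rounding, the point (a (n + 2 j), b n) is first (2 a j1 + b n, b n), then (b n2, b n2 - 2
    a j1), and finally the swapped lattice point (b n2, a (n2 + 2 j')). *)
Lemma reindex_box v : box rho (pos v - spos (reindex v)).
Proof.
case: v => i j; rewrite /reindex /shear /spos /pos /swp /box /rho /=.
set f2 := Num.floor _; set f3 := Num.floor _; set f1 := Num.floor _.
have a20 : 0 < 2 * a by rewrite mulr_gt0.
have := floor_bound ((a - b) * (i - j)%:~R) a20.
have := floor_bound (2 * a * (j + f1)%:~R) b0.
have := floor_bound ((b - a) * (i - j + f2)%:~R) a20.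
rewrite -/f1 -/f2 -/f3 !ltr_norml.
rewrite !(rmorphD, rmorphN) /= => h1 h2 h3.
by split; lra.
Qed.

Lemma round_box z : exists v, box rho (z - pos v).
Proof.
have a20 : 0 < 2 * a by rewrite mulr_gt0.
pose n := Num.floor (z.2 / b); have := floor_bound z.2 b0; rewrite -/n => h1.
pose j := Num.floor ((z.1 - a * n%:~R) / (2 * a)).
have := floor_bound (z.1 - a * n%:~R) a20; rewrite -/j => h2.
exists (n + j, j); rewrite /box /pos /rho /= !ltr_norml !(rmorphD, rmorphN) /=.
by split; lra.
Qed.

(** Leaves room for a pair of [bijection_box] followed by a unit step, each within [2 * rho], so
    that the graph contains the grid. *)
Definition edge_radius : R := 8 * rho.
Local Notation bigr := edge_radius.

(** A perfect matching of bounded displacement on every coset; the bound must not depend on [z],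
    hence the preliminary rounding of [z] to a lattice point. *)
Lemma bijection_box (z : P) : exists f f' : Z2 -> Z2, [/\ cancel f f', cancel f' f &
  forall v, box (2 * rho) (z + pos v - spos (f v))].
Proof.
have [v0 hv0] := round_box z.
exists (fun v => reindex (v + v0)), (fun v => unreindex v - v0); split.
- by move=> v; rewrite /reindex /unreindex shearK addrK.
- by move=> v; rewrite subrK /reindex /unreindex unshearK.
move=> v; have := boxD hv0 (reindex_box (v + v0)).
rewrite posD; set s := spos _.
have -> : z - pos v0 + (pos v + pos v0 - s) = z + pos v - s.
  by rewrite addrACA; ring.
by apply: box_le; lra.
Qed.

Lemma near1_box g h : near 1 g h -> box (2 * rho) (pos g - pos h).
Proof.
rewrite -posB /near; move: g h => [i j] [i' j'] /= H.
have := @norm_int R ((i - i') + (j - j')) 2 ltac:(lia).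
have := @norm_int R ((i - i') - (j - j')) 2 ltac:(lia).
rewrite /box /pos /rho /= !normrM (gtr0_norm a0) (gtr0_norm b0) => h1 h2.
have aa := a0; have bb := b0.
split.
  by apply: (@le_lt_trans _ _ (a * 2)); [rewrite ler_pM2l|lra].
by apply: (@le_lt_trans _ _ (b * 2)); [rewrite ler_pM2l|lra].
Qed.

Lemma box_near r : exists q : nat, forall v, box r (pos v) -> near q v 0.
Proof.
pose q1 := Num.bound `|r / a|; pose q2 := Num.bound `|r / b|.
exists (q1 + q2)%N => -[i j].
rewrite /box /pos /near /= !normrM (gtr0_norm a0) (gtr0_norm b0) => -[h1 h2].
have {h1} : `|(i + j)%:~R| < q1%:R :> R.
  apply: lt_trans (le_lt_trans (ler_norm _) (archi_boundP (normr_ge0 (r / a)))).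
  by rewrite ltr_pdivlMr // mulrC.
have {h2} : `|(i - j)%:~R| < q2%:R :> R.
  apply: lt_trans (le_lt_trans (ler_norm _) (archi_boundP (normr_ge0 (r / b)))).
  by rewrite ltr_pdivlMr // mulrC.
rewrite -!intr_norm -![_%:R]/((Posz _)%:~R) !ltr_int; lia.
Qed.

End Lattice.

Lemma fin_eps (R : realType) (T : eqType) (s : seq T) (Q : T -> R -> Prop) :
  (forall x e e', Q x e -> e' <= e -> Q x e') ->
  (forall x, x \in s -> exists2 e, 0 < e & Q x e) ->
  exists2 e, 0 < e & forall x, x \in s -> Q x e.
Proof.
move=> mono; elim: s => [_|x s IH H]; first by exists 1.
have [e e0 He] := IH (fun y ys => H y (mem_behead (s := x :: s) ys)).
have [e' e'0 He'] := H x (mem_head _ _).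
exists (Num.min e e'); first by rewrite lt_min e0.
move=> y; rewrite inE => /orP[/eqP->|/He Qy]; first by apply: mono He' _; rewrite ge_min lexx orbT.
by apply: mono Qy _; rewrite ge_min lexx.
Qed.

Lemma interval_avoid (R : realType) (A : set R) (l r : R) : countable A -> l < r ->
  exists x, [/\ l < x, x < r & ~ A x].
Proof.
move=> cA lr; apply: contrapT => H.
have sub : `]l, r[ `<=` A.
  move=> x /=; rewrite in_itv /= => /andP[lx xr]; apply: contrapT => nA; apply: H.
  by exists x.
have := countable_lebesgue_measure0 (sub_countable (subset_card_le sub) cA).
rewrite lebesgue_measure_itv /= lte_fin lr -EFinB => -[] /eqP.
by rewrite subr_eq0 => /eqP E; rewrite E ltxx in lr.
Qed.

Lemma countableU (T : Type) (A B : set T) :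
  countable A -> countable B -> countable (A `|` B).
Proof.
move=> cA cB; rewrite -[A `|` B]bigcup2E; apply: bigcup_countable => // -[|[|i]] _ //=.
Qed.

(** * The action of D4, grid-like sets and generic points *)

Notation K8 := (bool * bool * bool)%type.

Section Plane.
Variable R : realType.
Local Notation P := (R * R)%type.
Variables a b : R.
Local Notation pos := (lattice_pt a b).
Local Notation spos := (swapped_pt a b).

Definition nx (p : P) : P := (- p.1, p.2).
Definition ny (p : P) : P := (p.1, - p.2).

Definition act (k : K8) (p : P) : P :=
  (if k.1.1 then nx else id) ((if k.1.2 then ny else id) ((if k.2 then @swp R else id) p)).

Definition offset (gh : Z2 * Z2) : P := pos gh.1 - spos gh.2.
Local Notation vv := offset.

Definition nxi (gh : Z2 * Z2) : Z2 * Z2 :=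
  ((- gh.1.2, - gh.1.1), (gh.2.2, gh.2.1)).
Definition swi (gh : Z2 * Z2) : Z2 * Z2 := (- gh.2, - gh.1).
Definition nyi gh := swi (nxi (swi gh)).
(* Symmetries permute the vectors [g - s(h)]; this is the induced action on the pairs [(g, h)],
   where a swap exchanges the two lattices. *)
Definition acti (k : K8) (gh : Z2 * Z2) : Z2 * Z2 :=
  (if k.1.1 then nxi else id) ((if k.1.2 then nyi else id) ((if k.2 then swi else id) gh)).

Lemma nxK : involutive nx. Proof. by case=> x y; rewrite /nx /= opprK. Qed.
Lemma nyE p : ny p = swp (nx (swp p)). Proof. by case: p. Qed.
Lemma nxD p q : nx (p + q) = nx p + nx q.
Proof. by congr pair; rewrite /= opprD. Qed.

Lemma actE k p : act k p =
  (if k.1.1 then - (if k.2 then p.2 else p.1) else (if k.2 then p.2 else p.1),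
   if k.1.2 then - (if k.2 then p.1 else p.2) else (if k.2 then p.1 else p.2)).
Proof. by case: k p => [[[] []] []] []. Qed.

Lemma actD k p q : act k (p + q) = act k p + act k q.
Proof. by rewrite !actE; case: k => [[[] []] []]; congr pair; rewrite /= ?opprD. Qed.
Lemma actN k p : act k (- p) = - act k p.
Proof. by rewrite !actE; case: k => [[[] []] []]. Qed.
Lemma actB k p q : act k (p - q) = act k p - act k q.
Proof. by rewrite actD actN. Qed.

Lemma box_act k r p : box r (act k p) <-> box r p.
Proof.
by rewrite actE /box; case: k => [[[] []] []] /=; rewrite ?normrN; split => -[].
Qed.

Definition kinv (k : K8) : K8 := if k.2 then (k.1.2, k.1.1, true) else k.
Lemma actK k : cancel (act k) (act (kinv k)).
Proof. by move=> [x y]; case: k => [[[] []] []]; rewrite !actE /= ?opprK. Qed.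
Lemma actKV k : cancel (act (kinv k)) (act k).
Proof. by move=> [x y]; case: k => [[[] []] []]; rewrite !actE /= ?opprK. Qed.

Lemma act_comp k k' : exists k'', forall p, act k (act k' p) = act k'' p.
Proof.
exists (k.1.1 (+) (if k.2 then k'.1.2 else k'.1.1),
        k.1.2 (+) (if k.2 then k'.1.1 else k'.1.2), k.2 (+) k'.2).
by case: k k' => [[[] []] []] [[[] []] []] [x y]; rewrite !actE /= ?opprK.
Qed.

Lemma vv_nx gh : nx (vv gh) = vv (nxi gh).
Proof.
case: gh => [[i j] [k l]]; congr pair; rewrite /= ?rmorphD ?rmorphN /= ?rmorphN; ring.
Qed.
Lemma vv_sw gh : swp (vv gh) = vv (swi gh).
Proof.
case: gh => [g h]; rewrite /vv /swi /= swpD swpN sposN posN opprK.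
by rewrite addrC /spos swpK.
Qed.
Lemma vv_act k gh : act k (vv gh) = vv (acti k gh).
Proof.
have e x : ny (vv x) = vv (nyi x) by rewrite nyE vv_sw vv_nx vv_sw.
by case: k => [[[] []] []]; rewrite /act /acti /= ?vv_sw ?e ?vv_nx.
Qed.
Lemma vvD g h g' h' : vv (g + g', h + h') = vv (g, h) + vv (g', h').
Proof. by rewrite /vv /= posD sposD opprD addrACA. Qed.
Lemma vvN g h : vv (- g, - h) = - vv (g, h).
Proof. by rewrite /vv /= posN sposN opprD. Qed.
Lemma vv0 : vv 0 = 0. Proof. by rewrite /vv /= pos0 spos0 subr0. Qed.

Definition nearp k (gh : Z2 * Z2) := near k gh.1 0 && near k gh.2 0.
Lemma nearp_acti k m gh : nearp m gh -> nearp m (acti k gh).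
Proof.
have n1 x : nearp m x -> nearp m (nxi x).
  by case: x => [[? ?] [? ?]]; rewrite /nearp /near /=; lia.
have n2 x : nearp m x -> nearp m (swi x).
  by case: x => [[? ?] [? ?]]; rewrite /nearp /near /=; lia.
have n3 x : nearp m x -> nearp m (nyi x) by move=> H; exact/n2/n1/n2.
move=> H; rewrite /acti; have : nearp m ((if k.2 then swi else id) gh).
  by case: k.2 => //; exact: n2.
move: (_ gh) => x hx; have : nearp m ((if k.1.2 then nyi else id) x).
  by case: k.1.2 => //; exact: n3.
by move: (_ x) => y hy; case: k.1.1 => //; exact: n1.
Qed.
Lemma acti0 k gh : acti k gh = 0 -> gh = 0.
Proof.
have n1 x : nxi x = 0 -> x = 0.
  case: x => [[i j] [k' l]] -[] /eqP; rewrite oppr_eq0 => /eqP-> /eqP.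
  by rewrite oppr_eq0 => /eqP-> -> ->.
have n2 x : swi x = 0 -> x = 0.
  by case: x => [[i j] [k' l]] -[E1 E2 E3 E4]; congr ((_, _), (_, _)); lia.
have n3 x : nyi x = 0 -> x = 0 by move=> /n2/n1/n2.
move=> H0; have h1 x : (if k.1.1 then nxi else id) x = 0 -> x = 0 by case: k.1.1 => //; exact: n1.
have h2 x : (if k.1.2 then nyi else id) x = 0 -> x = 0 by case: k.1.2 => //; exact: n3.
have h3 x : (if k.2 then swi else id) x = 0 -> x = 0 by case: k.2 => //; exact: n2.
exact/h3/h2/h1.
Qed.

Lemma boxC r (p q : P) : box r (p - q) <-> box r (q - p).
Proof. by rewrite -opprB boxN. Qed.

(** Openness in terms of boxes; the link with the topology of the plane is made only in
    [nbhs_box]. *)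
Definition opn (X : set P) := forall p, X p -> exists2 e, 0 < e & forall q, box e (q - p) -> X q.
Definition loc_const (X : set P) p := exists2 e, 0 < e & forall q, box e (q - p) -> (X q <-> X p).
(** The boundary lies on countably many horizontal and vertical lines. One set [C] serves both
    coordinates, which makes the notion stable under the swap. *)
Definition grid_const (X : set P) := exists2 C : set R, countable C &
  forall p, ~ C p.1 -> ~ C p.2 -> loc_const X p.

Lemma opn_box e d : opn [set p | box e (p - d)].
Proof.
move=> p [/= p1 p2]; exists (Num.min (e - `|p.1 - d.1|) (e - `|p.2 - d.2|)).
  by rewrite lt_min !subr_gt0 p1.
move=> q [/=]; rewrite !lt_min !ltrBrDr => /andP[q1 _] /andP[_ q2]; split => /=.
  by apply: le_lt_trans q1; apply: le_trans (ler_normD _ _); rewrite addrA subrK.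
by apply: le_lt_trans q2; apply: le_trans (ler_normD _ _); rewrite addrA subrK.
Qed.

Lemma opnU X Y : opn X -> opn Y -> opn (X `|` Y).
Proof.
move=> oX oY p [/oX|/oY] [e e0 H]; exists e => // q /H; [by left|by right].
Qed.

Lemma opn_bigU I (X : I -> set P) : (forall i, opn (X i)) -> opn [set p | exists i, X i p].
Proof. by move=> oX p [i /oX[e e0 H]]; exists e => // q /H ?; exists i. Qed.

Lemma opn_act X k : opn X -> opn [set p | X (act k p)].
Proof.
move=> oX p /= /oX [e e0 H]; exists e => // q bq; apply: H.
by rewrite -actB box_act.
Qed.

Lemma grid_constU (X Y : set P) : grid_const X -> grid_const Y -> grid_const (X `|` Y).
Proof.
move=> [C cC HX] [D cD HY]; exists (C `|` D).
  by apply: countableU.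
move=> p n1 n2; have [e e0 He] := HX p (fun h => n1 (or_introl h)) (fun h => n2 (or_introl h)).
have [e' e'0 He'] := HY p (fun h => n1 (or_intror h)) (fun h => n2 (or_intror h)).
exists (Num.min e e'); first by rewrite lt_min e0.
move=> q bq; have b1 : box e (q - p) by apply: box_le bq; rewrite ge_min lexx.
have b2 : box e' (q - p) by apply: box_le bq; rewrite ge_min lexx orbT.
by rewrite /setU /= (He q b1) (He' q b2).
Qed.

Lemma grid_const_act X k : grid_const X -> grid_const [set p | X (act k p)].
Proof.
move=> [C cC HX]; exists (C `|` [set - x | x in C]).
  by apply: countableU => //; apply: sub_countable cC; exact: card_image_le.
move=> p n1 n2.
have n3 : ~ C (- p.1) by move=> h; apply: n1; right; exists (- p.1); rewrite ?opprK.
have n4 : ~ C (- p.2) by move=> h; apply: n2; right; exists (- p.2); rewrite ?opprK.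
have {}n1 : ~ C p.1 by move=> h; apply: n1; left.
have {}n2 : ~ C p.2 by move=> h; apply: n2; left.
have [||e e0 He] := HX (act k p); [by rewrite actE; case: k => [[[] []] []]..|].
by exists e => // q bq; apply: He; rewrite -actB box_act.
Qed.

Lemma grid_const_box e d : grid_const [set p : P | box e (p - d)].
Proof.
exists [set x | x \in [:: d.1 + e; d.1 - e; d.2 + e; d.2 - e]].
  apply: finite_set_countable; exact: finite_seq.
move=> p n1 n2.
have [bp|nbp] := pselect (box e (p - d)).
  have [e' e'0 He] := opn_box bp; exists e' => // q /He bq; split => //.
have out (x y : R) : x != y + e -> x != y - e -> ~~ (`|x - y| < e) -> e < `|x - y|.
  move=> h1 h2; rewrite -leNgt le_eqVlt => /orP[/eqP E|//]; exfalso.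
  have [xy|xy] := lerP 0 (x - y).
    by move: E; rewrite ger0_norm // => E; case/eqP: h1; rewrite E; ring.
  by move: E; rewrite ltr0_norm // => E; case/eqP: h2; rewrite E; ring.
have far (x x' y : R) : `|x' - x| < `|x - y| - e -> ~~ (`|x' - y| < e).
  rewrite -leNgt => h; have := ler_normD (x - x') (x' - y); rewrite addrA subrK.
  by rewrite (distrC x x'); lra.
have [h|h] := boolP (`|p.1 - d.1| < e); last first.
  have h' : e < `|p.1 - d.1|.
    by apply: out => //; apply/eqP => E; apply: n1; rewrite /= E !inE eqxx ?orbT.
  exists (`|p.1 - d.1| - e); first by rewrite subr_gt0.
  move=> q [/= q1 _]; split => // -[/=]; by move/negP: (far _ _ _ q1).
have h2 : ~~ (`|p.2 - d.2| < e) by apply/negP => h2; apply: nbp.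
have h' : e < `|p.2 - d.2|.
  by apply: out => //; apply/eqP => E; apply: n2; rewrite /= E !inE eqxx ?orbT.
exists (`|p.2 - d.2| - e); first by rewrite subr_gt0.
move=> q [/= _ q2]; split => // -[/= _]; by move/negP: (far _ _ _ q2).
Qed.

Lemma countable_translates (C : set R) (f : Z2 * Z2 -> R) : countable C ->
  countable [set x | exists gh, C (x + f gh)].
Proof.
move=> cC.
have -> : [set x | exists gh, C (x + f gh)] =
    \bigcup_(gh in [set: Z2 * Z2]) ((fun c => c - f gh) @` C).
  apply/seteqP; split => [x [gh Cx]|x [gh _ [c Cc <-]]]; last by exists gh; rewrite subrK.
  by exists gh => //; exists (x + f gh) => //; rewrite addrK.
apply: bigcup_countable => // gh _; apply: sub_countable cC; exact: card_image_le.
Qed.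

Lemma countable_values (f : Z2 * Z2 -> R) : countable [set x | exists gh, x = f gh].
Proof.
have -> : [set x | exists gh, x = f gh] = f @` setT.
  by apply/seteqP; split => [x [gh ->]|x [gh _ <-]]; [exists gh|exists gh].
by apply: sub_countable (countableP [set: Z2 * Z2]); exact: card_image_le.
Qed.

(** A nontrivial symmetry can map a point into its own coset only if a coordinate is half that of an
    offset, or if the sum or difference of the coordinates is a coordinate of an offset. So [x] has
    to avoid a countable set, and then [y] another one, depending on [x]. *)
Lemma generic_point (C : set R) (W : set P) w : countable C -> opn W -> W w ->
  exists z, [/\ W z, forall gh, ~ C (z + vv gh).1 /\ ~ C (z + vv gh).2 &
    forall k gh, k != (false, false, false) -> act k z + vv gh <> z].
Proof.
move=> cC oW /oW[e e0 He].
pose A1 := [set x | exists gh, C (x + (vv gh).1)] `|` [set x | exists gh, x = (vv gh).1 / 2].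
have cA1 : countable A1.
  by apply: countableU; [exact: (countable_translates _ cC)|exact: countable_values].
have [x [x1 x2 nx]] : exists x, [/\ w.1 - e < x, x < w.1 + e & ~ A1 x].
  by apply: interval_avoid => //; lra.
pose A2 := [set y | exists gh, C (y + (vv gh).2)] `|` [set y | exists gh, y = (vv gh).2 / 2]
   `|` ([set y | exists gh, y = x - (vv gh).1] `|` [set y | exists gh, y = - x + (vv gh).1]).
have cA2 : countable A2.
  by apply: countableU; apply: countableU;
    [exact: (countable_translates _ cC)|exact: countable_values..].
have [y [y1 y2 ny]] : exists y, [/\ w.2 - e < y, y < w.2 + e & ~ A2 y].
  by apply: interval_avoid => //; lra.
exists (x, y); split.
- by apply: He; rewrite /box /= !ltr_norml; split; lra.
- move=> gh; split => /= H; first by apply: nx; left; exists gh.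
  by apply: ny; left; left; exists gh.
move=> k gh k0.
have N1 : x <> (vv gh).1 / 2 by move=> E; apply: nx; right; exists gh.
have N2 : y <> (vv gh).2 / 2 by move=> E; apply: ny; left; right; exists gh.
have N3 : y <> x - (vv gh).1 by move=> E; apply: ny; right; left; exists gh.
have N4 : y <> - x + (vv gh).1 by move=> E; apply: ny; right; right; exists gh.
move: (vv gh) N1 N2 N3 N4 => v N1 N2 N3 N4; rewrite actE => -[/=].
case: k k0 => [[[] []] []] //= _ E1 E2.
- by apply: N4; lra.
- by apply: N1; lra.
- by apply: N4; lra.
- by apply: N1; lra.
- by apply: N3; lra.
- by apply: N2; lra.
- by apply: N3; lra.
Qed.

End Plane.

(** * Matchings between the two lattices *)

Section Saturation.
Implicit Types (r u e : Z2 -> Z2 -> Prop) (S T : {fset Z2}).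

(** Hall's inequality at [S] for a relation whose neighbourhoods are not presented as finite sets;
    this form is stable under relabelling. *)
Definition sat r S := exists2 T : {fset Z2}, (#|` S| <= #|` T|)%N &
  forall h, h \in T -> exists2 g, g \in S & r g h.

Lemma sat_sub r r' S : (forall g h, g \in S -> r g h -> r' g h) -> sat r S -> sat r' S.
Proof.
move=> rr' [T ST H]; exists T => // h /H[g gS gh]; exists g => //; exact: rr'.
Qed.

Lemma sat_relabel r r' (f f' : Z2 -> Z2) S : injective f -> injective f' ->
  (forall g h, r (f g) h -> r' g (f' h)) -> sat r [fset f g | g in S]%fset -> sat r' S.
Proof.
move=> inj inj' rr' [T ST H]; exists [fset f' h | h in T]%fset.
  by rewrite card_imfset //= (leq_trans _ ST) // card_imfset.
move=> _ /imfsetP[h /= hT ->]; have [_ /imfsetP[g /= gS ->] gh] := H _ hT.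
by exists g => //; apply: rr'.
Qed.

Lemma sat_hall (r : Z2 -> Z2 -> Prop) (n : Z2 -> {fset Z2}) :
  (forall g h, h \in n g <-> r g h) -> (forall S, sat r S) <-> hall n.
Proof.
move=> nr; split => H S.
  have [T ST HT] := H S; apply: leq_trans ST _; apply: fsubset_leq_card.
  by apply/fsubsetP => h /HT[g gS /nr gh]; apply/nbhP; exists g.
exists (nbh n S); first exact: H.
by move=> h /nbhP[g gS /nr gh]; exists g.
Qed.

(* Covered vertices are served by their partners, which no uncovered vertex uses. *)
Lemma sat_both e u :
  (forall g h, u g h -> e g h) ->
  (forall g h h', u g h -> u g h' -> h = h') ->
  (forall g g' h, u g h -> u g' h -> g = g') ->
  (forall S, sat (fun g h => e g h /\ forall g', u g' h -> g' = g) S) ->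
  forall S, sat (fun g h => [/\ e g h, forall g', u g' h -> g' = g &
                              forall h', u g h' -> h' = h]) S.
Proof.
move=> ue uM uL H S.
pose Sr := [fset g in S | `[< forall h, ~ u g h >]]%fset.
pose Sx := [fset g in S | ~~ `[< forall h, ~ u g h >]]%fset.
have [Tr STr HTr] := H Sr.
have [p hp] : exists p, forall g, g \in Sx -> u g (p g).
  suff /choice[p hp] : forall g, exists h, g \in Sx -> u g h by exists p.
  move=> g; case: (boolP (g \in Sx)) => [|_]; last by exists g.
  by rewrite !inE => /andP[_ /asboolPn /existsNP[h /contrapT gh]]; exists h.
pose Tx := [fset p g | g in Sx]%fset.
have cTx : #|` Tx| = #|` Sx|.
  apply: card_in_imfset => g g' gx gx' E; apply: (uL _ _ (p g)); first exact: hp.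
  by rewrite E; apply: hp.
have dT : (Tr `&` Tx = fset0)%fset.
  apply/eqP; rewrite fsetI_eq0; apply/fdisjointP => h /HTr[g gr [_ hu]].
  apply/negP => /imfsetP[g' /= gx' E]; have := hu g'; rewrite E => /(_ (hp _ gx')) gg'.
  by move: gr; rewrite -gg' !inE => /andP[_ /asboolP nu]; exact: nu (hp _ gx').
exists (Tr `|` Tx)%fset.
  rewrite cardfsU dT cardfs0 subn0 cTx.
  apply: leq_trans (leq_add STr (leqnn _)).
  have -> : S = (Sr `|` Sx)%fset.
    by apply/fsetP => g; rewrite !inE; case: (g \in S) => //=; case: asboolP.
  by have [] := leq_card_fsetU Sr Sx.
move=> h; rewrite inE => /orP[/HTr[g gr [gh hu]]|/imfsetP[g /= gx ->]].
  move: gr; rewrite !inE => /andP[gS /asboolP nu]; exists g => //; split => //.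
  by move=> h' /nu.
have up := hp _ gx; exists g; first by move: gx; rewrite !inE => /andP[].
by split; [apply: ue|move=> g' ug'; apply: uL up|move=> h' uh'; apply: uM up].
Qed.

End Saturation.

Section Graph.
Variable R : realType.
Local Notation P := (R * R)%type.
Variables a b : R.
Hypotheses (a0 : 0 < a) (b0 : 0 < b).
Local Notation vv := (offset a b).
Local Notation bigr := (edge_radius a b).
Local Notation rho := (round_radius a b).
Implicit Types (U : set P) (z : P).

(* The edges of bounded displacement that take no [h] (resp. [g]) away from its partner. *)
Definition okl U z g h := box bigr (z + vv (g, h)) /\ forall g', U (z + vv (g', h)) -> g' = g.
Definition okm U z h g := box bigr (z + vv (g, h)) /\ forall h', U (z + vv (g, h')) -> h' = h.

Definition d4 U := (forall p, U p -> U (nx p)) /\ (forall p, U p -> U (swp p)).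

Lemma d4_nx U p : d4 U -> U (nx p) <-> U p.
Proof. by move=> [H _]; split => /H //; rewrite nxK. Qed.
Lemma d4_swp U p : d4 U -> U (swp p) <-> U p.
Proof. by move=> [_ H]; split => /H //; rewrite swpK. Qed.

Lemma d4_act U k p : d4 U -> U (act k p) <-> U p.
Proof.
move=> dU; have ey q : U (ny q) <-> U q by rewrite nyE d4_swp // d4_nx // d4_swp.
by case: k => [[[] []] []]; rewrite /act /= ?d4_nx // ?ey // ?d4_swp.
Qed.

(** The swap exchanges the two sides of the graph, so for invariant [U] the condition on [okl] over
    all cosets contains the one on [okm]. *)
Lemma sat_flip U z S : d4 U -> sat (okm U (swp z)) [fset - g | g in S]%fset -> sat (okl U z) S.
Proof.
move=> dU; apply: (@sat_relabel _ _ _ -%R) => [||g h [bx hu]]; [exact: oppr_inj..|].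
have E g' : swp z + vv (h, - g') = swp (z + vv (g', - h)).
  by rewrite swpD vv_sw /swi /= opprK.
split; first by move: bx; rewrite E box_swp.
by move=> g'; rewrite -d4_swp // -E => /hu /oppr_inj.
Qed.

Lemma sat_flipm U z T : d4 U -> sat (okl U (swp z)) [fset - h | h in T]%fset -> sat (okm U z) T.
Proof.
move=> dU; apply: (@sat_relabel _ _ _ -%R) => [||h g [bx hu]]; [exact: oppr_inj..|].
have E h' : swp z + vv (- h', g) = swp (z + vv (- g, h')).
  by rewrite swpD vv_sw /swi /= opprK.
split; first by move: bx; rewrite E box_swp.
by move=> h'; rewrite -d4_swp // -E => /hu /oppr_inj.
Qed.

(** [tra] and [trb] are the components of [nxi]: the same reflection acts differently on the indices
    of the two lattices. *)
Definition tra (g : Z2) : Z2 := (- g.2, - g.1).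
Definition trb (g : Z2) : Z2 := (g.2, g.1).
Lemma traK : involutive tra. Proof. by case=> i j; rewrite /tra /= !opprK. Qed.
Lemma trbK : involutive trb. Proof. by case. Qed.

Lemma nx_vv z g h : nx z + vv (tra g, h) = nx (z + vv (g, trb h)).
Proof. by rewrite nxD vv_nx /nxi /= -!surjective_pairing. Qed.

Lemma sat_nx U z S : d4 U -> sat (okl U (nx z)) [fset tra g | g in S]%fset -> sat (okl U z) S.
Proof.
move=> dU; apply: (@sat_relabel _ _ _ trb) => [||g h [bx hu]];
  [exact: inv_inj traK|exact: inv_inj trbK|].
split; first by move: bx; rewrite nx_vv; rewrite /box /= normrN.
by move=> g' ug; apply: (inv_inj traK); apply: hu; rewrite nx_vv d4_nx.
Qed.

Lemma sat_nxm U z T : d4 U -> sat (okm U (nx z)) [fset trb h | h in T]%fset -> sat (okm U z) T.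
Proof.
move=> dU; apply: (@sat_relabel _ _ _ tra) => [||h g [bx hu]];
  [exact: inv_inj trbK|exact: inv_inj traK|].
have E h' : nx z + vv (g, trb h') = nx (z + vv (tra g, h')) by rewrite -{1}[g]traK nx_vv trbK.
split; first by move: bx; rewrite E /box /= normrN.
by move=> h' uh; apply: (inv_inj trbK); apply: hu; rewrite E d4_nx.
Qed.

Lemma vv_near r : exists q : nat,
  (forall g, box r (vv (g, 0)) -> near q g 0) /\ (forall h, box r (vv (0, h)) -> near q h 0).
Proof.
have [q hq] := box_near a0 b0 r; exists q; split => g; rewrite /vv /= ?spos0 ?pos0 ?subr0.
  exact: hq.
by rewrite sub0r boxN /swapped_pt box_swp; exact: hq.
Qed.

Lemma near_shift q (g h : Z2) : near q (g - h) 0 = near q g h.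
Proof. by rewrite /near /= !subr0. Qed.

Lemma vv_subl z g g' h : vv (g - g', 0) = (z + vv (g, h)) - (z + vv (g', h)).
Proof. by rewrite opprD addrACA subrr add0r -vvN -vvD subrr. Qed.
Lemma vv_subr z g h h' : vv (0, h - h') = (z + vv (g, h)) - (z + vv (g, h')).
Proof. by rewrite opprD addrACA subrr add0r -vvN -vvD subrr. Qed.

(** This is [exchange] at the vertex 0, in the graph that respects partners on both sides. The
    resulting [h0] is free, since its partner could only be 0, which is uncovered. The condition
    [g = 0 <-> h = h0] records the forced pair. *)
Lemma exchange_graph U z :
  (forall p, U p -> box bigr p) ->
  (forall p g, U p -> U (p + vv (g, 0)) -> g = 0) ->
  (forall p h, U p -> U (p + vv (0, h)) -> h = 0) ->
  (forall S, sat (okl U z) S) -> (forall S, sat (okm U z) S) ->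
  (forall h, ~ U (z + vv (0, h))) ->
  exists h0, [/\ box bigr (z + vv (0, h0)), forall g, ~ U (z + vv (g, h0)),
    (forall S, sat (fun g h => okl U z g h /\ (g = 0 <-> h = h0)) S) &
    (forall S, sat (fun h g => okm U z h g /\ (g = 0 <-> h = h0)) S)].
Proof.
move=> Ubox Ul Um HL HM nU.
pose e g h := box bigr (z + vv (g, h)); pose u g h := U (z + vv (g, h)).
have ue g h : u g h -> e g h by exact: Ubox.
have uM g h h' : u g h -> u g h' -> h = h'.
  move=> u1 u2; apply/esym/eqP; rewrite -subr_eq0; apply/eqP; apply: Um u1 _.
  by rewrite (vv_subr z g) addrC subrK.
have uL g g' h : u g h -> u g' h -> g = g'.
  move=> u1 u2; apply/esym/eqP; rewrite -subr_eq0; apply/eqP; apply: Ul u1 _.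
  by rewrite (vv_subl z _ _ h) addrC subrK.
have AL := sat_both ue uM uL HL.
have AM := sat_both (e := fun h g => e g h) (u := fun h g => u g h) (fun h g => ue g h)
  (fun h g g' => uL g g' h) (fun h h' g => uM g h h') HM.
(* The bijection serves here only to locate neighbourhoods in balls, hence to make them finite. *)
have [f [f' [fK f'K fb]]] := bijection_box a0 b0 z.
have [q [ql qm]] := vv_near (bigr + 2 * rho).
have ef g h : e g h -> near q (f g) h.
  move=> egh; rewrite -near_shift; apply: qm; rewrite (vv_subr z g) boxC.
  apply: boxD; first exact: egh.
  by rewrite boxN /vv /= addrA; apply: fb.
have ef' g h : e g h -> near q (f' h) g.
  move=> egh; rewrite -near_shift; apply: ql; rewrite (vv_subl z _ _ h) boxC.
  apply: boxD; first exact: egh.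
  by rewrite boxN /vv /= addrA; have := fb (f' h); rewrite f'K.
pose okA g h := [/\ e g h, forall g', u g' h -> g' = g & forall h', u g h' -> h' = h].
pose n g := [fset h in ball q (f g) | `[< okA g h >]]%fset.
pose m h := [fset g in ball q (f' h) | `[< okA g h >]]%fset.
have nE g h : h \in n g <-> okA g h.
  rewrite !inE /= in_ball nearC; split; first by case/andP => _ /asboolP.
  by move=> A; rewrite (ef g h) ?asboolT //; case: A.
have mE g h : g \in m h <-> okA g h.
  rewrite !inE /= in_ball nearC; split; first by case/andP => _ /asboolP.
  by move=> A; rewrite (ef' g h) ?asboolT //; case: A.
have dual g h : (h \in n g) = (g \in m h) by apply/idP/idP => [/nE/mE|/mE/nE].
have hn : hall n by apply: (iffLR (sat_hall nE)).
have hm : hall m.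
  apply: (iffLR (sat_hall (r := fun h g => okA g h) (fun h g => mE g h))) => T.
  by apply: sat_sub (AM T) => h g _ [? ? ?]; split.
have [h0 [h0n hn' hm']] := exchange dual hn hm 0.
have A0 : okA 0 h0 by apply/nE.
exists h0; split.
- by case: A0.
- move=> g ug; have [_ H _] := A0; move: (ug); rewrite (H _ ug); exact: nU.
- move=> S; exists (nbh (force n 0 h0) S); first exact: hn'.
  move=> h /nbhP[g gS]; rewrite /force; case: eqP gS => [->|g0] gS.
    by rewrite inE => /eqP->; exists 0 => //; case: A0.
  rewrite !inE => /andP[hh0 hg]; exists g => //.
  have [? ? ?] : okA g h by apply/nE; rewrite !inE.
  by split => //; split => // E; move: hh0; rewrite E eqxx.
- move=> T; exists (nbh (force m h0 0) T); first exact: hm'.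
  move=> g /nbhP[h hT]; rewrite /force; case: eqP => [E|hh0].
    rewrite inE => /eqP->; exists h => //; rewrite E; by case: A0.
  rewrite !inE => /andP[g0 hg]; exists h => //.
  have [? ? ?] : okA g h by apply/mE; rewrite !inE.
  by split => //; split => // E; move: g0; rewrite E eqxx.
Qed.

End Graph.

(** * The planar argument on a coset *)

Section Planar.
Variable R : realType.
Local Notation P := (R * R)%type.
Variables a b : R.
Hypotheses (a0 : 0 < a) (b0 : 0 < b).
Local Notation vv := (offset a b).
Local Notation bigr := (edge_radius a b).
Local Notation rho := (round_radius a b).
Local Notation okl := (okl a b).
Local Notation okm := (okm a b).

Lemma rho_gt0 : 0 < rho.
Proof. by have aa := a0; have bb := b0; rewrite /round_radius; lra. Qed.

Lemma near_box k v : near k v 0 -> box (4 * k%:R * rho + 1) (lattice_pt a b v).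
Proof.
case: v => i j; rewrite /near /= !subr0 => H.
have aa := a0; have bb := b0.
have := @norm_int R (i + j) k.*2 ltac:(lia).
have := @norm_int R (i - j) k.*2 ltac:(lia).
rewrite /box /lattice_pt /round_radius /= !normrM (gtr0_norm a0) (gtr0_norm b0).
rewrite -muln2 natrM => h1 h2.
have k0 : 0 <= k%:R :> R by [].
have ka : 0 <= k%:R * a by rewrite mulr_ge0 // ltW.
have kb : 0 <= k%:R * b by rewrite mulr_ge0 // ltW.
by split; [have := ler_wpM2l (ltW aa) h2|have := ler_wpM2l (ltW bb) h1]; lra.
Qed.

Variable q : nat.
Hypothesis q0 : (0 < q)%N.
Hypothesis hq : (forall g, box (2 * bigr) (vv (g, 0)) -> near q g 0) /\
  (forall h, box (2 * bigr) (vv (0, h)) -> near q h 0).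

Definition separated D (X : set P) := forall d g h, X d -> X (d + vv (g, h)) -> near D g 0 ->
  g = 0 /\ h = 0.

Definition stage_union (l : seq (set P)) : set P :=
  [set p | exists2 i, (i < size l)%N & nth set0 l i p].

Definition uniq_shift (U : set P) :=
  (forall p g, U p -> U (p + vv (g, 0)) -> g = 0) /\
  (forall p h, U p -> U (p + vv (0, h)) -> h = 0).

Definition stages (l : seq (set P)) := forall i, (i < size l)%N ->
  separated (radius q i).*2 (nth set0 l i).

(** [K] is chosen before [l], so that it is available when the last stage of [l] is still to be
    constructed. *)
Lemma planar_sat n : exists K, forall l, size l = n -> stages l ->
  (forall p, stage_union l p -> box bigr p) -> d4 (stage_union l) -> uniq_shift (stage_union l) ->
  (forall z S c, (forall v, v \in S -> near K v c) -> sat (okl (stage_union l) z) S) ->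
  forall z S, sat (okl (stage_union l) z) S.
Proof.
have [K1 [_ hK1]] := vv_near a0 b0 (4 * (radius q n)%:R * rho + 1 + 4 * rho).
exists (radius q n + K1)%N => l sl st Ubox dU [Ul Um] small z.
have r0 := rho_gt0.
have [f [f' [fK f'K fb]]] := bijection_box a0 b0 z.
have fI := can_inj fK; have f'I := can_inj f'K.
set U := stage_union l in Ubox dU Ul Um small *.
(* Reindexing the swapped lattice by [f] puts both sides on one grid, where edges are short and unit
   steps are edges. *)
pose e : rel Z2 := fun g v => `[< box bigr (z + vv (g, f v)) >].
pose us i : rel Z2 := fun g v => `[< nth set0 l i (z + vv (g, f v)) >].
have eP g v : e g v <-> box bigr (z + vv (g, f v)) by split => [/asboolP|H]; last exact/asboolP.
have usP i g v : us i g v <-> nth set0 l i (z + vv (g, f v)).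
  by split => [/asboolP|H]; last exact/asboolP.
have fb' v : box (2 * rho) (z + vv (v, f v)) by rewrite /offset /= addrA; exact: fb.
have eq g v : e g v -> near q g v.
  move=> /eP b1; rewrite -near_shift; apply: (proj1 hq); rewrite (vv_subl _ _ z _ _ (f v)).
  by apply: box_le (boxD b1 (iffRL (boxN _ _) (fb' v))); rewrite /edge_radius; lra.
have e1 g v : near 1 g v -> e g v.
  move=> gv; apply/eP.
  have -> : z + vv (g, f v) = (z + vv (v, f v)) + (lattice_pt a b g - lattice_pt a b v).
    by rewrite /offset /=; ring.
  by apply: box_le (boxD (fb' v) (near1_box a0 b0 gv)); rewrite /edge_radius; lra.
have mP g v : matched us n g v <-> U (z + vv (g, f v)).
  by split => -[i ni H]; exists i; rewrite -?sl // ?sl //; apply/usP.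
have ue i g v : (i < n)%N -> us i g v -> e g v.
  by move=> ni /usP H; apply/eP/Ubox; exists i; rewrite ?sl.
have uL g v g' : matched us n g v -> matched us n g' v -> g = g'.
  move=> /mP u1 /mP u2; apply/esym/eqP; rewrite -subr_eq0; apply/eqP; apply: Ul u1 _.
  by rewrite (vv_subl _ _ z _ _ (f v)) addrC subrK.
have uM g v v' : matched us n g v -> matched us n g v' -> v = v'.
  move=> /mP u1 /mP u2; apply/esym/fI/eqP; rewrite -subr_eq0; apply/eqP; apply: Um u1 _.
  by rewrite (vv_subr _ _ z g) addrC subrK.
have sep i g v g' v' : (i < n)%N -> us i g v -> us i g' v' ->
    near (radius q i).*2 g g' -> g = g' /\ v = v'.
  move=> ni /usP u1 /usP u2 n1; have := st i; rewrite sl => /(_ ni).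
  move=> /(_ _ (g' - g) (f v' - f v) u1); case.
  - by rewrite -addrA -vvD [g + _]addrC subrK [f v + _]addrC subrK.
  - by rewrite near_shift nearC.
  - by move=> /eqP; rewrite subr_eq0 => /eqP-> /eqP; rewrite subr_eq0 => /eqP/fI->.
have LP g v : okL n e us g v <-> okl U z g (f v).
  split=> [/andP[/eP b1 /asboolP u1]|[b1 u1]]; last first.
    by apply/andP; split; [exact/eP|apply/asboolP => g' /mP/u1].
  by split => // g' ug'; apply: u1; apply/mP.
have MP g v : okM n e us v g <-> okm U z (f v) g.
  split=> [/andP[/eP b1 /asboolP u1]|[b1 u1]]; last first.
    by apply/andP; split; [exact/eP|apply/asboolP => h' /mP/u1/fI].
  split => // h' ug'; rewrite -[h']f'K; congr f; apply: u1; apply/mP.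
  by rewrite f'K.
have locL g h : okL n e us g h -> near q g h by move=> /andP[/eq].
have locM g h : okM n e us g h -> near q g h by move=> /andP[/eq]; rewrite nearC.
have H : hall (nb q (okL n e us)).
  apply: (planar_hall q0 eq e1 ue sep uL uM).
    move=> c S Sc; have [v|T ST HT] := small z S c.
      by move=> /Sc; apply: near_le; rewrite leq_addr.
    apply: leq_trans ST _.
    have <- : #|` [fset f' h | h in T]%fset| = #|` T| by rewrite card_imfset.
    apply: fsubset_leq_card.
    apply/fsubsetP => _ /imfsetP[h /= hT ->]; have [g gS gh] := HT _ hT.
    by apply/nbhP; exists g => //; rewrite in_nb //; apply/LP; rewrite f'K.
  (* The other side is seen on the swapped coset. As [f] is not a translation, the spread of the
     points [f v] is estimated through their positions, which is what [K1] is for. *)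
  move=> c S Sc; have [T ST HT] : sat (okm U z) [fset f v | v in S]%fset.
    apply: (sat_flipm dU); apply: (small _ _ (- f c)).
    move=> _ /imfsetP[_ /= /imfsetP[v /= /Sc vc ->] ->].
    apply: (@near_le K1); first by rewrite leq_addl.
    rewrite -near_shift; apply: hK1.
    have -> : vv (0, - f v - - f c) =
        lattice_pt a b (v - c) + ((z + vv (c, f c)) - (z + vv (v, f v))).
      by rewrite /offset /= pos0 posB !sposB !sposN; ring.
    have {}vc : near (radius q n) (v - c) 0 by rewrite near_shift.
    apply: box_le (boxD (near_box vc) (boxD (fb' c) (iffRL (boxN _ _) (fb' v)))).
    by lra.
  have <- : #|` [fset f v | v in S]%fset| = #|` S| by rewrite card_imfset.
  apply: leq_trans ST _; apply: fsubset_leq_card.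
  apply/fsubsetP => g /HT[_ /imfsetP[v /= vS ->] gv].
  by apply/nbhP; exists v => //; rewrite in_nb //; apply/MP.
move=> S; exists [fset f v | v in nbh (nb q (okL n e us)) S]%fset.
  by rewrite card_imfset //=; exact: H.
move=> _ /imfsetP[v /= /nbhP[g gS gv] ->]; exists g => //; apply/LP.
by move: gv; rewrite in_nb.
Qed.

End Planar.

(** * Orbits under D4 *)

Section Orbits.
Variable R : realType.
Local Notation P := (R * R)%type.
Variables a b : R.
Local Notation vv := (offset a b).
Implicit Types U X : set P.

Definition orbit (b0 : set P) : set P := [set p | exists k, b0 (act k p)].

Lemma d4_orbit b0 : d4 (orbit b0).
Proof.
split=> p [k bk].
  have [k' hk'] := act_comp R k (true, false, false); exists k'.
  by rewrite -hk' /act /= nxK.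
have [k' hk'] := act_comp R k (false, false, true); exists k'.
by rewrite -hk' /act /= swpK.
Qed.

Lemma d4U U X : d4 U -> d4 X -> d4 (U `|` X).
Proof.
move=> [U1 U2] [X1 X2]; split=> p [h|h].
- by left; apply: U1. - by right; apply: X1. - by left; apply: U2. - by right; apply: X2.
Qed.

Lemma opn_orbit b0 : opn b0 -> opn (orbit b0).
Proof. by move=> ob; apply: opn_bigU => k; apply: opn_act. Qed.

Lemma grid_const_orbit b0 : grid_const b0 -> grid_const (orbit b0).
Proof.
move=> lb; have H (s : seq K8) : grid_const [set p | exists2 k, k \in s & b0 (act k p)].
  elim: s => [|k s IH].
    by exists set0 => // p _ _; exists 1 => // q _; split => -[].
  have -> : [set p | exists2 k0, k0 \in k :: s & b0 (act k0 p)] =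
      [set p | b0 (act k p)] `|` [set p | exists2 k, k \in s & b0 (act k p)].
    apply/seteqP; split => [p [k']|p [?|[k' ks ?]]].
    - by rewrite inE => /orP[/eqP->|ks] ?; [left|right; exists k'].
    - by exists k => //; rewrite inE eqxx.
    - by exists k' => //; rewrite inE ks orbT.
  by apply: grid_constU => //; apply: grid_const_act.
have -> : orbit b0 = [set p | exists2 k, k \in enum {: K8} & b0 (act k p)].
  apply/seteqP; split => [p [k ?]|p [k _ ?]]; last by exists k.
  by exists k => //; rewrite mem_enum.
exact: H.
Qed.

Lemma uniq_shiftL U : d4 U -> (forall p g, U p -> U (p + vv (g, 0)) -> g = 0) ->
  uniq_shift a b U.
Proof.
move=> dU H; split => // p h up uh; apply/eqP; rewrite -oppr_eq0; apply/eqP.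
apply: (H (swp p)); first by rewrite d4_swp.
have -> : vv (- h, 0) = swp (vv (0, h)) by rewrite vv_sw /swi /= oppr0.
by rewrite -swpD d4_swp.
Qed.

Lemma act_id (p : P) : act (false, false, false) p = p.
Proof. by []. Qed.

Lemma acti_l k (g : Z2) : exists g', acti k (g, 0) = if k.2 then (0, g') else (g', 0).
Proof.
by case: k => [[[] []] []]; case: g => i j; rewrite /acti /= /swi /nxi /=; eexists.
Qed.

Lemma acti_r k (h : Z2) : exists h', acti k (0, h) = if k.2 then (h', 0) else (0, h').
Proof.
by case: k => [[[] []] []]; case: h => i j; rewrite /acti /= /swi /nxi /=; eexists.
Qed.

Lemma acti_diag k (g : Z2) : exists g', acti k (g, 0) = (g', 0) \/ acti k (g, 0) = (0, g').
Proof. by have [g' ->] := acti_l k g; exists g'; case: k.2; [right|left]. Qed.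

End Orbits.

Ltac vvring := rewrite /offset /= ?(posB, sposB, posD, sposD, posN, sposN, pos0, spos0); ring.

(** * Adding a stage when the two lattices meet only in 0 *)

Section Step.
Variable R : realType.
Local Notation P := (R * R)%type.
Variables a b : R.
Hypotheses (a0 : 0 < a) (b0 : 0 < b).
Local Notation vv := (offset a b).
Local Notation bigr := (edge_radius a b).
Local Notation rho := (round_radius a b).
Local Notation okl := (okl a b).
Local Notation okm := (okm a b).
Implicit Types (U X : set P) (z : P).

Lemma vv_bound z k : exists k', forall z', box 1 (z' - z) -> forall g h,
  box bigr (z' + vv (g, h)) ->
  (near k g 0 -> near k' h 0) /\ (near k h 0 -> near k' g 0).
Proof.
pose rz := `|z.1| + `|z.2| + 2; pose rk := 4 * k%:R * rho + 1.
have [k' [hl hm]] := vv_near a0 b0 (bigr + (rz + rk)).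
have bz z' : box 1 (z' - z) -> box rz z'.
  move=> [/= z1 z2]; have := normr_ge0 z.1; have := normr_ge0 z.2 => n1 n2.
  have := ler_normD (z'.1 - z.1) z.1; have := ler_normD (z'.2 - z.2) z.2.
  by rewrite !subrK /rz /box => h1 h2; split; lra.
exists k' => z' /bz z'b g h bgh; split => n0.
  apply: hm; have -> : vv (0, h) = (z' + vv (g, h)) - (z' + lattice_pt a b g).
    by rewrite /offset /= pos0; ring.
  by apply: boxD bgh _; rewrite boxN; apply: boxD z'b _; apply: near_box.
apply: hl; have -> : vv (g, 0) = (z' + vv (g, h)) + (- z' + swapped_pt a b h).
  by rewrite /offset /= spos0; ring.
apply: boxD bgh _; apply: boxD; first by rewrite boxN.
by rewrite /swapped_pt box_swp; apply: near_box.
Qed.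

Variable q : nat.
Hypothesis q0 : (0 < q)%N.
Hypothesis hq : (forall g, box (2 * bigr) (vv (g, 0)) -> near q g 0) /\
  (forall h, box (2 * bigr) (vv (0, h)) -> near q h 0).
Hypothesis incomm : forall gh, vv gh = 0 -> gh = 0.

(** The stages are listed and not merely united, because the separation required of a stage grows
    with its index. *)
Record staged_tile (l : seq (set P)) : Prop := StagedTile {
  staged_stages : stages a b q l;
  staged_opn : opn (stage_union l);
  staged_box : forall p, stage_union l p -> box bigr p;
  staged_d4 : d4 (stage_union l);
  staged_uniq : uniq_shift a b (stage_union l);
  staged_grid_const : grid_const (stage_union l);
  staged_sat : forall z S, sat (okl (stage_union l) z) S }.

Lemma stage_union_rcons l X : stage_union (rcons l X) = stage_union l `|` X.
Proof.
apply/seteqP; split=> p.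
  move=> [i]; rewrite size_rcons ltnS leq_eqVlt nth_rcons => /orP[/eqP->|il].
    by rewrite ltnn eqxx => ?; right.
  by rewrite il => ?; left; exists i.
case=> [[i il ip]|Xp].
  by exists i; rewrite ?size_rcons ?nth_rcons ?il // ltnW.
by exists (size l); rewrite ?size_rcons // nth_rcons ltnn eqxx.
Qed.

Lemma stages_rcons l X : stages a b q l -> separated a b (radius q (size l)).*2 X ->
  stages a b q (rcons l X).
Proof.
move=> st sX i; rewrite size_rcons ltnS leq_eqVlt nth_rcons => /orP[/eqP->|il].
  by rewrite ltnn eqxx.
by rewrite il; apply: st.
Qed.

Lemma separated_le D D' X : (D' <= D)%N -> separated a b D X -> separated a b D' X.
Proof. by move=> le H d g h h1 h2 h3; apply: H h1 h2 _; apply: near_le h3. Qed.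

(** [QL p0] and [QM p0] express Hall's condition around every pair whose point is [p0]. Symmetries
    carry such pairs to such pairs, a swap exchanging [QL] and [QM], so only the central box of an
    orbit has to be examined. *)
Lemma sat_of_act U (Kb : nat) :
  let QL p0 := forall z g1 h1 S, z + vv (g1, h1) = p0 ->
    (forall v, v \in S -> near Kb v g1) -> sat (okl U z) S in
  let QM p0 := forall z g1 h1 T, z + vv (g1, h1) = p0 ->
    (forall v, v \in T -> near Kb v h1) -> sat (okm U z) T in
  d4 U -> forall k p, QL (act k p) /\ QM (act k p) -> QL p /\ QM p.
Proof.
move=> QL QM dU k p.
have nearA v g : near Kb (tra v) (tra g) = near Kb v g by rewrite /near /=; lia.
have nearB v g : near Kb (trb v) (trb g) = near Kb v g by rewrite /near /=; lia.
have nearN v g : near Kb (- v) (- g) = near Kb v g.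
  by case: v g => ? ? [? ?]; rewrite /near /=; lia.
have qnx p' : QL (nx p') /\ QM (nx p') -> QL p' /\ QM p'.
  move=> [HL HM]; split=> z g1 h1 S E Sn.
    apply: sat_nx => //; apply: (HL _ (tra g1) (trb h1)) => [|_ /imfsetP[v /= vS ->]].
      by rewrite nx_vv trbK E.
    by rewrite nearA; apply: Sn.
  apply: sat_nxm => //; apply: (HM _ (tra g1) (trb h1)) => [|_ /imfsetP[v /= vS ->]].
    by rewrite nx_vv trbK E.
  by rewrite nearB; apply: Sn.
have qsw p' : QL (swp p') /\ QM (swp p') -> QL p' /\ QM p'.
  have sw z g1 h1 : swp z + vv (- h1, - g1) = swp (z + vv (g1, h1)).
    by rewrite swpD vv_sw.
  move=> [HL HM]; split=> z g1 h1 S E Sn.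
    apply: sat_flip => //; apply: (HM _ (- h1) (- g1)) => [|_ /imfsetP[v /= vS ->]].
      by rewrite sw E.
    by rewrite nearN; apply: Sn.
  apply: sat_flipm => //; apply: (HL _ (- h1) (- g1)) => [|_ /imfsetP[v /= vS ->]].
    by rewrite sw E.
  by rewrite nearN; apply: Sn.
have qny p' : QL (ny p') /\ QM (ny p') -> QL p' /\ QM p'.
  by rewrite nyE => H; apply/qsw/qnx/qsw.
have s1 x : QL ((if k.1.1 then @nx R else id) x) /\ QM ((if k.1.1 then @nx R else id) x) ->
  QL x /\ QM x by case: k.1.1 => //; exact: qnx.
have s2 x : QL ((if k.1.2 then @ny R else id) x) /\ QM ((if k.1.2 then @ny R else id) x) ->
  QL x /\ QM x by case: k.1.2 => //; exact: qny.
have s3 x : QL ((if k.2 then @swp R else id) x) /\ QM ((if k.2 then @swp R else id) x) ->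
  QL x /\ QM x by case: k.2 => //; exact: qsw.
by move=> H; apply/s3/s2/s1.
Qed.

Section Extend.
Variables (l : seq (set P)) (z : P) (h0 : Z2).
Hypothesis il : staged_tile l.
Let U := stage_union l.
Hypothesis bd0 : box bigr (z + vv (0, h0)).
Hypothesis nUl : forall h, ~ U (z + vv (0, h)).
Hypothesis nUm : forall g, ~ U (z + vv (g, h0)).
Hypothesis BL : forall S, sat (fun g h => okl U z g h /\ (g = 0 <-> h = h0)) S.
Hypothesis BM : forall S, sat (fun h g => okm U z h g /\ (g = 0 <-> h = h0)) S.
Let d0 : P := z + vv (0, h0).

(** [Kb] bounds the sets examined around a new pair, [K2] the far ends of their edges; [D] keeps new
    pairs from interfering, and [K'] is the window of indices in which nearby cosets look like that
    of [z]. *)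
Variables (e : R) (Kb K2 D K' m0 : nat).
Hypotheses (e0 : 0 < e) (e1 : e <= 1) (hm0 : near m0 h0 0).
Hypothesis hK2 : forall z', box 1 (z' - z) -> forall g h, box bigr (z' + vv (g, h)) ->
  (near (Kb + m0) g 0 -> near K2 h 0) /\ (near (Kb + m0) h 0 -> near K2 g 0).
Hypothesis hD : ((radius q (size l)).*2 + (Kb + m0) + q + K2 <= D)%N.
Hypothesis hK' : (D + m0 + q <= K')%N.
Hypothesis pattern : forall z', box e (z' - z) -> forall g h, nearp K' (g, h) ->
  (U (z' + vv (g, h)) <-> U (z + vv (g, h))) /\
  (box bigr (z' + vv (g, h)) <-> box bigr (z + vv (g, h))).
Let X := orbit [set p : P | box e (p - d0)].
Hypothesis sX : separated a b D X.

Let Xbox p : X p -> box bigr p.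
Proof.
move=> [k bk]; rewrite -(box_act k); have bz : box e ((act k p - vv (0, h0)) - z).
  by have -> : act k p - vv (0, h0) - z = act k p - d0 by rewrite /d0; ring.
have near0 : nearp K' (0, h0).
  rewrite /nearp near_refl /=; apply: near_le hm0; lia.
by have [_] := pattern bz near0; rewrite subrK => ->.
Qed.

Let d4X : d4 X. Proof. exact: d4_orbit. Qed.
Let d4U' : d4 (U `|` X). Proof. by apply: d4U => //; exact: staged_d4. Qed.

Let U'box p : (U `|` X) p -> box bigr p.
Proof. by case=> [/(staged_box il)|/Xbox]. Qed.

(** Moved to the central box and compared with [z], an overlap puts a point of [U] on the line of
    [h0] or on that of 0 in the coset of [z], according to whether the symmetry swaps the
    lattices. *)
Let noUX p g : U p -> X (p + vv (g, 0)) -> False.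
Proof.
move=> Up Xp; have gq : near q (- g) 0.
  have : near q g 0.
    apply: (proj1 hq); have -> : vv (g, 0) = (p + vv (g, 0)) - p by ring.
    have -> : 2 * bigr = bigr + bigr by ring.
    by apply: boxD; [apply: Xbox|rewrite boxN; apply: staged_box Up].
  by case: g Xp => i j _; rewrite /near /=; lia.
have [k bk] := Xp; set y := act k _ in bk.
have bz : box e ((y - vv (0, h0)) - z).
  by have -> : y - vv (0, h0) - z = y - d0 by rewrite /d0; ring.
have Uk : U (y + vv (acti k (- g, 0))).
  have -> : y + vv (acti k (- g, 0)) = act k p.
    rewrite -vv_act -actD -addrA -vvD subrr addr0.
    by rewrite -[(0, 0)]/(0 : Z2 * Z2) vv0 addr0.
  by rewrite d4_act //; exact: staged_d4.
have near1 : nearp q (acti k (- g, 0)).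
  by apply: nearp_acti; rewrite /nearp gq near_refl.
have [g' [] E] := acti_diag k (- g); rewrite E in Uk near1.
  have nn : nearp K' (g', h0).
    move: near1; rewrite /nearp => /andP[n1 _]; rewrite (near_le _ n1) /=; last lia.
    by apply: near_le hm0; lia.
  have [] := pattern bz nn; rewrite (_ : y - vv (0, h0) + vv (g', h0) = y + vv (g', 0)).
    by move=> /iffLR /(_ Uk) /nUm.
  vvring.
have nn : nearp K' (0, h0 + g').
  move: near1; rewrite /nearp near_refl => /andP[_ n1] /=; apply: (@near_le (m0 + q)); first lia.
  by move: hm0 n1; rewrite /near /=; case: (h0) => ? ?; case: (g') => ? ? /=; lia.
have [] := pattern bz nn; rewrite (_ : y - vv (0, h0) + vv (0, h0 + g') = y + vv (0, g')).
  by move=> /iffLR /(_ Uk) /nUl.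
vvring.
Qed.

Let uniqU' : uniq_shift a b (U `|` X).
Proof.
apply: uniq_shiftL => // p g [Up|Xp] [Uq|Xq].
- by have [H _] := staged_uniq il; apply: H Up Uq.
- by case: (noUX Up Xq).
- case: (noUX (g := - g) Uq); rewrite -addrA -vvD subrr addr0.
  by rewrite -[(0, 0)]/(0 : Z2 * Z2) vv0 addr0.
have [|//] := sX Xp Xq; apply: (@near_le q); first lia.
apply: (proj1 hq); have -> : vv (g, 0) = (p + vv (g, 0)) - p by ring.
have -> : 2 * bigr = bigr + bigr by ring.
by apply: boxD; [apply: Xbox|rewrite boxN; apply: Xbox].
Qed.

(** After a shift of indices the coset agrees with that of [z] in the window, and by [sX] the only
    new pair there is the forced one, so [BL] applies. The other side, [baseM], is similar. *)
Let baseL z' g1 h1 S : box e (z' + vv (g1, h1) - d0) ->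
  (forall v, v \in S -> near Kb v g1) -> sat (okl (U `|` X) z') S.
Proof.
set p := z' + _ => bp Sn; pose z2 := p - vv (0, h0).
have bz : box e (z2 - z) by have -> : z2 - z = p - d0 by rewrite /z2 /d0; ring.
have Xp : X p by exists (false, false, false).
pose r1 g h := near Kb g 0 /\ (okl U z g h /\ (g = 0 <-> h = h0)).
apply: (@sat_relabel r1 _ (fun g => g - g1) (fun h => h + (h1 - h0))).
- exact: addIr. - exact: addIr.
- move=> g h [nG [[bGh uGh] iGh]]; set G := g - g1 in nG bGh uGh iGh.
  have tr g' : z' + vv (g', h + (h1 - h0)) = z2 + vv (g' - g1, h) by rewrite /z2 /p; vvring.
  have zz : box 1 (z - z) by rewrite subrr /box /= normr0.
  have hK : near K2 h 0.
    have [H _] := hK2 zz bGh; apply: H; apply: near_le nG; lia.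
  have pt G' : near (Kb + q) G' 0 -> nearp K' (G', h).
    by move=> n1; rewrite /nearp (near_le _ n1) ?(near_le _ hK) //; lia.
  have bG2 : box bigr (z2 + vv (G, h)).
    by apply/(proj2 (pattern bz (pt _ _))) => //; apply: near_le nG; lia.
  split; first by rewrite tr.
  move=> g'; rewrite tr => uG'.
  have nG' : near (q + Kb) (g' - g1) 0.
    apply: near_trans nG; rewrite -near_shift; apply: (proj1 hq).
    rewrite (vv_subl _ _ z2 _ _ h); have -> : 2 * bigr = bigr + bigr by ring.
    by apply: boxD; [apply: U'box|rewrite boxN].
  case: uG' => [uG'|xG'].
    have := uGh (g' - g1); rewrite addnC in nG'.
    have [H _] := pattern bz (pt _ nG'); move/H: uG' => uG' /(_ uG') /addIr; exact.
  have [||E1 E2] := sX (g := g' - g1) (h := h - h0) Xp.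
  - by have -> : p + vv (g' - g1, h - h0) = z2 + vv (g' - g1, h) by rewrite /z2; vvring.
  - by apply: near_le nG'; lia.
  have /iGh E3 : h = h0 by apply/eqP; rewrite -subr_eq0 E2.
  by apply: (@addIr _ (- g1)); rewrite E1; apply/esym.
apply: sat_sub (BL _) => g h /imfsetP[v /= /Sn vn ->] H; split => //.
by rewrite near_shift.
Qed.

Let baseM z' g1 h1 T : box e (z' + vv (g1, h1) - d0) ->
  (forall v, v \in T -> near Kb v h1) -> sat (okm (U `|` X) z') T.
Proof.
set p := z' + _ => bp Sn; pose z2 := p - vv (0, h0).
have bz : box e (z2 - z) by have -> : z2 - z = p - d0 by rewrite /z2 /d0; ring.
have Xp : X p by exists (false, false, false).
pose r1 h g := near (Kb + m0) h 0 /\ (okm U z h g /\ (g = 0 <-> h = h0)).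
apply: (@sat_relabel r1 _ (fun h => h - (h1 - h0)) (fun g => g + g1)).
- exact: addIr. - exact: addIr.
- move=> h g [nG [[bGh uGh] iGh]]; set H := h - (h1 - h0) in nG bGh uGh iGh.
  have tr h' : z' + vv (g + g1, h') = z2 + vv (g, h' - (h1 - h0)) by rewrite /z2 /p; vvring.
  have zz : box 1 (z - z) by rewrite subrr /box /= normr0.
  have hK : near K2 g 0 by have [_ F] := hK2 zz bGh; apply: F.
  have pt H' : near (Kb + m0 + q) H' 0 -> nearp K' (g, H').
    by move=> n1; rewrite /nearp (near_le _ n1) ?(near_le _ hK) //; lia.
  have bG2 : box bigr (z2 + vv (g, H)).
    by apply/(proj2 (pattern bz (pt _ _))) => //; apply: near_le nG; lia.
  split; first by rewrite tr.
  move=> h'; rewrite tr => uG'; set H' := h' - (h1 - h0) in uG'.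
  have nG' : near (q + (Kb + m0)) H' 0.
    apply: near_trans nG; rewrite -near_shift; apply: (proj2 hq).
    rewrite (vv_subr _ _ z2 g) boxC; have -> : 2 * bigr = bigr + bigr by ring.
    by apply: boxD; [|rewrite boxN]; [|apply: U'box] => //; apply: U'box.
  suff : H' = H by move/addIr.
  case: uG' => [uG'|xG'].
    rewrite addnC in nG'.
    by have [F _] := pattern bz (pt _ nG'); move/F: uG' => /uGh.
  have [||E1 E2] := sX (g := g) (h := H' - h0) Xp.
  - by have -> : p + vv (g, H' - h0) = z2 + vv (g, H') by rewrite /z2; vvring.
  - by apply: near_le hK; lia.
  have E3 : H' = h0 by apply/eqP; rewrite -subr_eq0 E2.
  by rewrite E3; apply/esym/iGh.
apply: sat_sub (BM _) => h g /imfsetP[v /= /Sn vn ->] H; split => //.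
have -> : v - (h1 - h0) = (v - h1) + h0 by ring.
rewrite -(near_shift) in vn; move: vn hm0; rewrite /near.
by case: (v - h1) (h0) => ? ? [? ?] /=; lia.
Qed.

Lemma staged_tile_rcons K :
  (forall l', size l' = (size l).+1 -> stages a b q l' ->
    (forall p, stage_union l' p -> box bigr p) -> d4 (stage_union l') ->
    uniq_shift a b (stage_union l') ->
    (forall z S c, (forall v, v \in S -> near K v c) -> sat (okl (stage_union l') z) S) ->
    forall z S, sat (okl (stage_union l') z) S) -> (K + K + q <= Kb)%N -> staged_tile (rcons l X).
Proof.
move=> small KKb.
have st : stages a b q (rcons l X).
  by apply: stages_rcons; [exact: staged_stages|apply: separated_le sX; lia].
have oX : opn X by apply: opn_orbit; apply: opn_box.
split; rewrite ?stage_union_rcons //.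
- by apply: opnU => //; exact: staged_opn.
- by apply: grid_constU; [exact: staged_grid_const|apply: grid_const_orbit; apply: grid_const_box].
have := small (rcons l X) (size_rcons _ _) st; rewrite stage_union_rcons => /(_ U'box d4U' uniqU').
apply => z' S c Sc.
(* If no edge at [S] ends at a newly covered vertex, the old condition persists. Otherwise [S] lies
   within [Kb] of the first index of a new pair. *)
have [[g [h [h1g [gS bgh Xg]]]]|no] := pselect (exists g h g1, [/\ g \in S,
    box bigr (z' + vv (g, h)) & X (z' + vv (g1, h))]); last first.
  have [T ST HT] := staged_sat il z' S; exists T => // h /HT[g gS [bgh ugh]].
  exists g => //; split => // g' [/ugh //|xg']; case: no.
  by exists g, h, g'.
have [k bk] := Xg.
have ng : near q g h1g.
  rewrite -near_shift; apply: (proj1 hq); rewrite (vv_subl _ _ z' _ _ h).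
  have -> : 2 * bigr = bigr + bigr by ring.
  by apply: boxD => //; rewrite boxN; apply: Xbox.
have [|H _] := @sat_of_act (U `|` X) Kb d4U' k (z' + vv (h1g, h)).
  split=> z1 g1 h1 S1 E Sn; first by apply: (@baseL z1 g1 h1 S1) => //; rewrite E.
  by apply: (@baseM z1 g1 h1 S1) => //; rewrite E.
apply: H erefl _ => v vS; apply: near_le KKb _.
apply: near_trans ng; apply: near_trans (Sc _ vS) _; rewrite nearC; exact: Sc.
Qed.

End Extend.

End Step.

Section Step.
Variable R : realType.
Local Notation P := (R * R)%type.
Variables a b : R.
Hypotheses (a0 : 0 < a) (b0 : 0 < b).
Local Notation vv := (offset a b).
Local Notation bigr := (edge_radius a b).
Local Notation rho := (round_radius a b).
Local Notation okl := (okl a b).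
Local Notation okm := (okm a b).
Implicit Types (U X : set P) (z : P).
Variable q : nat.
Hypothesis q0 : (0 < q)%N.
Hypothesis hq : (forall g, box (2 * bigr) (vv (g, 0)) -> near q g 0) /\
  (forall h, box (2 * bigr) (vv (0, h)) -> near q h 0).
Hypothesis incomm : forall gh, vv gh = 0 -> gh = 0.

Definition pairs K : seq (Z2 * Z2) := [seq (g, h) | g <- ball K 0, h <- ball K 0].

Lemma in_pairs K gh : (gh \in pairs K) = nearp K gh.
Proof.
case: gh => g h; apply/allpairsP/idP => [[[g' h'] /= [g1 h1 [-> ->]]]|].
  by rewrite /nearp /= -!in_ball g1.
by rewrite /nearp /= -!in_ball => /andP[? ?]; exists (g, h).
Qed.

Lemma separate (x y : P) : x <> y -> exists2 e, 0 < e &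
  forall x' y', box e (x' - x) -> box e (y' - y) -> x' <> y'.
Proof.
move=> xy; have [n1|] := boolP (x.1 != y.1).
  exists (`|x.1 - y.1| / 2); first by rewrite divr_gt0 // normr_gt0 subr_eq0.
  move=> x' y' [/= h1 _] [/= h2 _] E; rewrite E in h1.
  have := ler_normD (x.1 - y'.1) (y'.1 - y.1); rewrite addrA subrK => h.
  rewrite distrC in h1; have : `|x.1 - y.1| < `|x.1 - y.1| / 2 + `|x.1 - y.1| / 2.
    by apply: le_lt_trans h _; apply: ltrD.
  by rewrite -splitr ltxx.
rewrite negbK => /eqP E1; have n2 : x.2 != y.2.
  by apply/eqP => E2; apply: xy; case: x y E1 E2 => ? ? [? ?] /= -> ->.
exists (`|x.2 - y.2| / 2); first by rewrite divr_gt0 // normr_gt0 subr_eq0.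
move=> x' y' [/= _ h1] [/= _ h2] E; rewrite E in h1.
have := ler_normD (x.2 - y'.2) (y'.2 - y.2); rewrite addrA subrK => h.
rewrite distrC in h1; have : `|x.2 - y.2| < `|x.2 - y.2| / 2 + `|x.2 - y.2| / 2.
  by apply: le_lt_trans h _; apply: ltrD.
by rewrite -splitr ltxx.
Qed.

Lemma pattern_eps U z (C : set R) K :
  (forall p, ~ C p.1 -> ~ C p.2 -> loc_const U p) ->
  (forall gh, ~ C (z + vv gh).1 /\ ~ C (z + vv gh).2) ->
  exists2 e, 0 < e & forall gh, gh \in pairs K -> forall z', box e (z' - z) ->
    (U (z' + vv gh) <-> U (z + vv gh)).
Proof.
move=> HC zC; apply: fin_eps.
  by move=> gh e e' H ee z' /(box_le ee); exact: H.
move=> gh _; have [n1 n2] := zC gh; have [e e0 He] := HC _ n1 n2; exists e => // z' bz.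
by apply: He; have -> : z' + vv gh - (z + vv gh) = z' - z by ring.
Qed.

Lemma separation_eps (d0 : P) K :
  (forall k gh, k != (false, false, false) -> act k d0 + vv gh <> d0) ->
  exists2 e, 0 < e & forall kg, kg \in [seq (k, gh) | k <- enum {: K8}, gh <- pairs K] ->
    forall p p', box e (p - d0) -> box e (p' - d0) -> act kg.1 p + vv kg.2 = p' ->
    kg.1 = (false, false, false) /\ vv kg.2 = 0.
Proof.
move=> gen; apply: fin_eps.
  by move=> kg e e' H ee p p' /(box_le ee) b1 /(box_le ee) b2; exact: H.
move=> [k gh] _; have [triv|nt] := pselect (k = (false, false, false) /\ vv gh = 0).
  by exists 1.
have ne : act k d0 + vv gh <> d0.
  have [E|k0] := eqVneq k (false, false, false); last exact: (gen k gh k0).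
  by rewrite E act_id => H; apply: nt; rewrite -[vv gh](addKr d0) H addNr.
have [e e0 He] := separate ne; exists e => // p p' bp bp' E.
case: (He (act k p + vv gh) p') => //.
have -> : act k p + vv gh - (act k d0 + vv gh) = act k (p - d0) by rewrite actB; ring.
by rewrite box_act.
Qed.

(** Two such points come from the central box, related by a symmetry and an offset in a finite
    window. Genericity makes the symmetry trivial and the offset zero, and [incomm] then makes the
    indices zero. *)
Lemma separated_orbit (d0 : P) e D K4 :
  (forall h, box (2 * bigr + (4 * D%:R * rho + 1)) (vv (0, h)) -> near K4 h 0) ->
  (forall p, orbit [set p | box e (p - d0)] p -> box bigr p) ->
  (forall kg, kg \in [seq (k, gh) | k <- enum {: K8}, gh <- pairs (D + K4)] ->
    forall p p', box e (p - d0) -> box e (p' - d0) -> act kg.1 p + vv kg.2 = p' ->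
    kg.1 = (false, false, false) /\ vv kg.2 = 0) ->
  separated a b D (orbit [set p : P | box e (p - d0)]).
Proof.
move=> hK4 Xbox He d g h Xd Xd' ng.
have nh : near K4 h 0.
  apply: hK4; have -> : vv (0, h) = ((d + vv (g, h)) - d) - lattice_pt a b g by vvring.
  apply: boxD; last by rewrite boxN; apply: near_box.
  have -> : 2 * bigr = bigr + bigr by ring.
  by apply: boxD; [apply: Xbox|rewrite boxN; apply: Xbox].
have [k bk] := Xd; have [k' bk'] := Xd'.
have [k2 hk2] := act_comp R k' (kinv k).
have mem : (k2, acti k' (g, h)) \in [seq (k, gh) | k <- enum {: K8}, gh <- pairs (D + K4)].
  apply/allpairsP; exists (k2, acti k' (g, h)); rewrite mem_enum in_pairs; split => //.
  apply: nearp_acti; rewrite /nearp /=.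
  by rewrite (near_le _ ng) ?(near_le _ nh) ?leq_addl ?leq_addr.
suff E : act k2 (act k d) + vv (acti k' (g, h)) = act k' (d + vv (g, h)).
  by have [_ /incomm /acti0 [-> ->]] := He _ mem _ _ bk bk' E.
by rewrite -hk2 actK -vv_act -actD.
Qed.

Lemma staged_tile_extend l W w : staged_tile a b q l -> opn W -> W w ->
  exists X, staged_tile a b q (rcons l X) /\
    exists p h, stage_union (rcons l X) p /\ W (p + vv (0, h)).
Proof.
move=> il oW Ww; pose U := stage_union l.
have [[p [h [Up Wp]]]|noW] := pselect (exists p h, U p /\ W (p + vv (0, h))).
  have E : stage_union (rcons l set0) = U by rewrite stage_union_rcons setU0.
  (* If [W] is already met, an empty stage is added. *)
  exists set0; split; last by exists p, h; rewrite E.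
  case: il => st ? ? ? ? ? ?; split; rewrite ?E //.
  by apply: stages_rcons => // d g h' [].
have [K small] := planar_sat a0 b0 q0 hq (size l).+1.
have [C1 cC1 HC1] := staged_grid_const il.
have [C2 cC2 HC2] := @grid_const_box R bigr 0.
have [z [Wz zC zk]] := generic_point a b (countableU cC1 cC2) oW Ww.
have nUl h : ~ U (z + vv (0, h)).
  move=> Uh; apply: noW; exists (z + vv (0, h)), (- h); split => //.
  by have -> : z + vv (0, h) + vv (0, - h) = z by vvring.
have HL := staged_sat il z.
have HM T : sat (okm U z) T by apply: sat_flipm; [exact: staged_d4 il|exact: (staged_sat il)].
have [u1 u2] := staged_uniq il.
have [h0 [bd0 nUm BL BM]] := exchange_graph a0 b0 (staged_box il) u1 u2 HL HM nUl.
pose d0 := z + vv (0, h0).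
pose m0 := (absz h0.1 + absz h0.2)%N.
have hm0 : near m0 h0 0 by rewrite /near /= !subr0 leq_addr leq_addl.
(* Two points of a ball of radius [K], plus one step to a vertex sharing a neighbour. The later
   constants all precede the choice of the size [e] of the box. *)
pose Kb := (K + K + q)%N.
have [K2 hK2] := vv_bound a0 b0 z (Kb + m0).
pose D := ((radius q (size l)).*2 + (Kb + m0) + q + K2)%N.
have [K4 [_ hK4]] := vv_near a0 b0 (2 * bigr + (4 * D%:R * rho + 1)).
pose K' := (D + K4 + m0 + q)%N.
have gen k gh : k != (false, false, false) -> act k d0 + vv gh <> d0.
  move=> k0 E; apply: (zk k ((acti k (0, h0)) + gh - (0, h0)) k0).
  have E2 : vv (acti k (0, h0) + gh - (0, h0)) = act k (vv (0, h0)) + vv gh - vv (0, h0).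
    by rewrite vv_act; case: (acti k _) gh {E} => ? ? [? ?]; vvring.
  rewrite E2; have -> : act k z + (act k (vv (0, h0)) + vv gh - vv (0, h0)) =
     (act k d0 + vv gh) - vv (0, h0) by rewrite /d0 actD; ring.
  by rewrite E /d0 addrK.
have [e1 e10 He1] := pattern_eps K' (fun p h1 h2 => HC1 p (fun h => h1 (or_introl h))
  (fun h => h2 (or_introl h))) zC.
have [e2 e20 He2] := pattern_eps K' (fun p h1 h2 => HC2 p (fun h => h1 (or_intror h))
  (fun h => h2 (or_intror h))) zC.
have [e3 e30 He3] := separation_eps (D + K4) gen.
pose e := Num.min (Num.min e1 e2) (Num.min e3 1).
have e0 : 0 < e by rewrite !lt_min e10 e20 e30 ltr01.
have le1 : e <= e1 by rewrite !ge_min lexx.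
have le2 : e <= e2 by rewrite !ge_min lexx orbT.
have le3 : e <= e3 by rewrite !ge_min lexx !orbT.
have le4 : e <= 1 by rewrite !ge_min lexx !orbT.
have pattern z' : box e (z' - z) -> forall g h, nearp K' (g, h) ->
  (U (z' + vv (g, h)) <-> U (z + vv (g, h))) /\
  (box bigr (z' + vv (g, h)) <-> box bigr (z + vv (g, h))).
  move=> bz g h; rewrite -in_pairs => gh; split.
    by apply: He1 => //; apply: box_le bz.
  by have := He2 _ gh z' (box_le le2 bz); rewrite /= !subr0.
pose X := orbit [set p : P | box e (p - d0)].
have Xbox p : X p -> box bigr p.
  move=> [k bk]; rewrite -(box_act k); have bz : box e ((act k p - vv (0, h0)) - z).
    by have -> : act k p - vv (0, h0) - z = act k p - d0 by rewrite /d0; ring.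
  have near0 : nearp K' (0, h0).
    rewrite /nearp near_refl; apply: near_le hm0; rewrite /K' -addnA.
    exact: leq_trans (leq_addr q m0) (leq_addl _ _).
  by have [_] := pattern _ bz _ _ near0; rewrite subrK => ->.
have sX : separated a b D X.
  apply: separated_orbit hK4 Xbox _ => kg kgi p p' /(box_le le3) b1 /(box_le le3) b2.
  exact: He3.
exists X; split; last first.
  exists d0, (- h0); split; last first.
    by rewrite /d0; have -> : z + vv (0, h0) + vv (0, - h0) = z by vvring.
  rewrite stage_union_rcons; right; exists (false, false, false).
  by rewrite act_id /= subrr /box /= normr0.
have hD : ((radius q (size l)).*2 + (Kb + m0) + q + K2 <= D)%N by [].
have hK' : (D + m0 + q <= K')%N by rewrite /K' !leq_add2r leq_addr.
exact: (staged_tile_rcons a0 b0 q0 hq il bd0 nUl nUm BL BM e0 le4 hm0 hK2 hD hK' pattern sX small).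
Qed.

End Step.

(** * The case where the two lattices intersect *)

Section Commensurable.
Variable R : realType.
Local Notation P := (R * R)%type.
Variables a b : R.
Hypotheses (a0 : 0 < a) (b0 : 0 < b).
Local Notation vv := (offset a b).
Local Notation pos := (lattice_pt a b).
Local Notation spos := (swapped_pt a b).
Local Notation rho := (round_radius a b).
Implicit Types (U X : set P) (z : P).

Lemma pos_eq0 g : pos g = 0 -> g = 0.
Proof.
case: g => i j [] /eqP; rewrite mulf_eq0 gt_eqF //= intr_eq0 => /eqP h1.
move=> /eqP; rewrite mulf_eq0 gt_eqF //= intr_eq0 => /eqP h2.
by move: h1 h2 => /= h1 h2; congr pair; lia.
Qed.

Lemma vv_l0 g : vv (g, 0) = pos g.
Proof. by rewrite /offset /= spos0 subr0. Qed.
Lemma vv_r0 h : vv (0, h) = - spos h.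
Proof. by rewrite /offset /= pos0 sub0r. Qed.

Definition zmul (m : int) (g : Z2) : Z2 := (m * g.1, m * g.2).
Lemma pos_zmul m g : pos (zmul m g) = (m%:~R * (pos g).1, m%:~R * (pos g).2).
Proof. by congr pair; rewrite /= -?mulrDr -?mulrBr rmorphM /=; ring. Qed.
Lemma spos_zmul m g : spos (zmul m g) = (m%:~R * (spos g).1, m%:~R * (spos g).2).
Proof. by rewrite /swapped_pt pos_zmul. Qed.

Variable c : Z2 * Z2.
Hypotheses (c0 : c <> 0) (vc : vv c = 0).

(** Both lattices are invariant under [nx], so a common vector minus its reflection is a common
    horizontal one. If this vanishes, the common vector is vertical and its swap is horizontal. *)
Lemma period : exists t g h, [/\ 0 < t, pos g = (t, 0) & spos h = (t, 0)].
Proof.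
case: c c0 vc => g h gh0 /eqP; rewrite subr_eq0 => /eqP E; rewrite /= in E.
have En : pos (tra g) = spos (trb h).
  have := vv_nx a b (g, h); rewrite /offset /= E subrr /nxi /=.
  rewrite -[nx 0]/((- 0, 0) : P) oppr0 => /esym/eqP.
  by rewrite subr_eq0 /tra /trb => /eqP.
have nxg : pos (tra g) = nx (pos g).
  have := vv_nx a b (g, 0); rewrite vv_l0 /nxi /= => ->.
  by rewrite -[(0, 0)]/(0 : Z2) vv_l0.
have sw x y : pos x = spos y -> spos x = pos y by move=> F; rewrite /swapped_pt F /swapped_pt swpK.
have norm x y : pos x = spos y -> (pos x).2 = 0 -> (pos x).1 != 0 ->
    exists t g h, [/\ 0 < t, pos g = (t, 0) & spos h = (t, 0)].
  move=> F h2; have Ex : pos x = ((pos x).1, 0) by rewrite {1}[pos x]surjective_pairing h2.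
  move: (pos x).1 Ex => u Ex; rewrite neq_lt => /orP[h1|h1].
    exists (- u), (- x), (- y); rewrite oppr_gt0 posN sposN -F Ex; split => //.
      by congr pair; rewrite oppr0.
    by congr pair; rewrite oppr0.
  by exists u, x, y; rewrite -F Ex.
have [g1|g1] := eqVneq (pos g).1 0; last first.
  apply: (norm (g - tra g) (h - trb h)).
  - by rewrite posB sposB En E.
  - by rewrite posB nxg; case: (pos g) => ? ? /=; rewrite subrr.
  - by move: g1; rewrite posB nxg; case: (pos g) => ? ? /=; rewrite opprK -mulr2n mulrn_eq0.
have g2 : (pos g).2 != 0.
  apply/eqP => g2; apply: gh0; have g0 : pos g = 0 by rewrite [LHS]surjective_pairing g1 g2.
  have hz : swp (pos h) = 0 by rewrite -g0 E.
  have h0 : pos h = 0 by rewrite -[pos h]swpK hz.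
  by rewrite (pos_eq0 g0) (pos_eq0 h0).
have Es := sw _ _ E.
apply: (norm h g) => //; rewrite -Es //.
Qed.

Definition equivg g g' := exists h, pos (g - g') = spos h.
Lemma equivg_sym g g' : equivg g g' -> equivg g' g.
Proof. by move=> [h E]; exists (- h); rewrite sposN -E -posN opprB. Qed.
Lemma equivg_trans g1 g2 g3 : equivg g1 g2 -> equivg g2 g3 -> equivg g1 g3.
Proof.
move=> [h E] [h' E']; exists (h + h'); rewrite sposD -E -E' -posD.
by congr lattice_pt; rewrite addrA subrK.
Qed.

Lemma reduce_mod_period : exists t, forall g, exists2 g', equivg g g' & box t (pos g').
Proof.
have [t [gt [ht [t0 E1 E2]]]] := period; exists t => g.
have F1 : pos ht = (0, t) by rewrite -[pos ht]swpK; have -> : swp (pos ht) = (t, 0) by exact: E2.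
have F2 : spos gt = (0, t) by rewrite /swapped_pt E1.
pose m := Num.floor ((pos g).1 / t); pose n := Num.floor ((pos g).2 / t).
exists (g - (zmul m gt + zmul n ht)).
  exists (zmul m ht + zmul n gt); rewrite opprB addrC subrK posD sposD !pos_zmul !spos_zmul.
  by rewrite E1 E2 F1 F2.
have := floor_bound (pos g).1 t0; have := floor_bound (pos g).2 t0; rewrite -/m -/n.
rewrite posB posD !pos_zmul E1 F1; move: (pos g) => p h1 h2.
by split; rewrite /= ltr_norml; lra.
Qed.

(** Indices are not determined by the offset here; choosing the first one bounded modulo the common
    period bounds the second as well. *)
Lemma offset_discrete r : exists K, forall gh, box r (vv gh) ->
  exists2 gh', nearp K gh' & vv gh' = vv gh.
Proof.
have [t ht] := reduce_mod_period; have [K [h1 h2]] := vv_near a0 b0 (r + t + t).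
exists K => -[g h] bv; have [g' [h' E] bg'] := ht g.
have E2 : vv (g', h - h') = vv (g, h).
  by move: E; rewrite posB /offset /= sposB => <-; ring.
exists (g', h - h') => //; rewrite /nearp /=; apply/andP; split.
  have r0 : 0 <= r by apply: ltW; apply: le_lt_trans (proj1 bv).
  have t0 : 0 <= t by apply: ltW; apply: le_lt_trans (proj1 bg').
  by apply: h1; rewrite vv_l0; apply: box_le bg'; lra.
apply: h2; have -> : vv (0, h - h') = vv (g', h - h') - pos g' by rewrite /offset /= pos0; ring.
rewrite E2 -addrA; apply: boxD => //.
have t0 : 0 <= t by apply: ltW; apply: le_lt_trans (proj1 bg').
by rewrite boxN; apply: box_le bg'; lra.
Qed.

Lemma representatives : exists t (rep : Z2 -> Z2), [/\ forall g, equivg g (rep g),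
  forall g, box t (pos (rep g)) & forall g g', equivg g g' -> rep g = rep g'].
Proof.
have [t ht] := reduce_mod_period.
pose S g : set Z2 := [set g' | equivg g g' /\ box t (pos g')].
exists t, (fun g => xget 0 (S g)).
have ex g : S g (xget 0 (S g)).
  by have [g' e1 e2] := ht g; apply: (xgetPex 0 (P := S g)); exists g'.
split=> [g|g|g g' gg']; [by case: (ex g)|by case: (ex g)|].
congr xget; apply/seteqP; split=> x [e1 e2]; split => //.
  by apply: equivg_trans e1; apply: equivg_sym.
exact: equivg_trans gg' e1.
Qed.

(** [coset_sat] takes the place of Hall's condition: the s(G)-translates of [U] contain every coset
    of G + s(G) that meets [U], so an unmet open set has only untouched cosets. *)
Record coset_tile r U : Prop := CosetTile {
  coset_opn : opn U;
  coset_box : forall p, U p -> box r p;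
  coset_d4 : d4 U;
  coset_uniq : forall p g, U p -> U (p + vv (g, 0)) -> g = 0;
  coset_sat : forall p gh, U p -> exists p' h, U p' /\ p + vv gh = p' + vv (0, h) }.

(** The vectors g + s(g) represent G + s(G) modulo s(G), being congruent to g; as the swap fixes
    them, they also represent it modulo G. A common transversal is what disjointness from both
    families of translates requires. *)
Lemma coset_tile_extend : exists r, forall U W w, coset_tile r U -> opn W -> W w ->
  exists X, coset_tile r (U `|` X) /\ exists p h, (U `|` X) p /\ W (p + vv (0, h)).
Proof.
have [t [rep [rep1 rep2 rep3]]] := representatives.
have r0 := rho_gt0 a0 b0.
(* [rho] bounds the centre of the box, moved by s(G) near the origin, 1 its half-side, and [t + t]
   the vector g + s(g). *)
exists (rho + 1 + (t + t)) => U W w iU oW Ww.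
have [[p [h [Up Wp]]]|noW] := pselect (exists p h, U p /\ W (p + vv (0, h))).
  by exists set0; rewrite setU0; split => //; exists p, h.
have noV p gh : U p -> ~ W (p + vv gh).
  by move=> /(coset_sat iU gh)[p' [h [Up' ->]]] Wp; apply: noW; exists p', h.
have [z [Wz _ zk]] := generic_point a b (C := set0) (@countable0 R) oW Ww.
have [v0 bz] := round_box a0 b0 (swp z).
pose z1 := z + vv (0, v0).
have {}bz : box rho z1.
  by rewrite -box_swp /z1 swpD vv_r0 swpN /swapped_pt swpK.
have gen k gh : k != (false, false, false) -> act k z1 + vv gh <> z1.
  move=> k0 E; apply: (zk k ((acti k (0, v0)) + gh - (0, v0)) k0).
  have E2 : vv (acti k (0, v0) + gh - (0, v0)) = act k (vv (0, v0)) + vv gh - vv (0, v0).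
    by rewrite vv_act; case: (acti k _) gh {E} => ? ? [? ?]; vvring.
  rewrite E2; have -> : act k z + (act k (vv (0, v0)) + vv gh - vv (0, v0)) =
     (act k z1 + vv gh) - vv (0, v0) by rewrite /z1 actD; ring.
  by rewrite E /z1 addrK.
have [K hK] := offset_discrete (2 * (rho + 1)).
have [e1 e10 He1] := separation_eps K gen.
have [e2 e20 He2] := oW _ Wz.
pose e := Num.min (Num.min e1 e2) 1.
have e0 : 0 < e by rewrite !lt_min e10 e20 ltr01.
have le1 : e <= e1 by rewrite !ge_min lexx.
have le2 : e <= e2 by rewrite !ge_min lexx orbT.
have le4 : e <= 1 by rewrite !ge_min lexx !orbT.
pose b1 : set P := [set p | box e (p - z1)].
have b1box y : b1 y -> box (rho + 1) y.
  move=> by1; have -> : y = z1 + (y - z1) by ring.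
  by apply: boxD bz _; apply: box_le by1.
have sep k gh y y' : b1 y -> b1 y' -> act k y + vv gh = y' ->
    k = (false, false, false) /\ vv gh = 0.
  move=> by1 by2 E; have [|gh' n1 E'] := hK gh.
    have -> : vv gh = y' - act k y by rewrite -E; ring.
    have -> : 2 * (rho + 1) = (rho + 1) + (rho + 1) by ring.
    by apply: boxD; [exact: b1box|rewrite boxN box_act; exact: b1box].
  have mem : (k, gh') \in [seq (k, gh) | k <- enum {: K8}, gh <- pairs K].
    by apply/allpairsP; exists (k, gh'); rewrite mem_enum in_pairs.
  rewrite -E'; apply: (He1 _ mem _ _ (box_le le1 by1) (box_le le1 by2)).
  by rewrite /= E'.
have b1U y p gh : b1 y -> U p -> y <> p + vv gh.
  move=> by1 Up E; apply: (noV p (gh - (0, v0)) Up); apply: He2.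
  have -> : p + vv (gh - (0, v0)) - z = y - z1.
    by rewrite E /z1; case: gh {E} => ? ?; vvring.
  exact: box_le by1.
pose wv g := vv (g, - g).
have wvE g : wv g = pos g + spos g by rewrite /wv /offset /= sposN opprK.
pose B : set P := [set p | exists g, rep g = g /\ b1 (p - wv g)].
pose X := orbit B.
have reprep g : rep (rep g) = rep g by apply/esym/rep3/rep1.
have XP k p : B (act k p) -> exists y g, [/\ rep g = g, b1 y & act k p = y + wv g].
  by move=> [g [rg bg]]; exists (act k p - wv g), g; rewrite subrK.
have Xbox p : X p -> box (rho + 1 + (t + t)) p.
  move=> [k /XP[y [g [rg by1 E]]]]; rewrite -(box_act k) E; apply: boxD (b1box _ by1) _.
  by rewrite wvE; apply: boxD; rewrite ?/(spos _) ?box_swp -rg.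
have dX : d4 X by exact: d4_orbit.
have dU := coset_d4 iU.
have UX p g : U p -> X (p + vv (g, 0)) -> False.
  move=> Up [k /XP[y [g1 [_ by1 E]]]].
  apply: (b1U y (act k p) (acti k (g, 0) - (g1, - g1)) by1); first by rewrite d4_act.
  have -> : vv (acti k (g, 0) - (g1, - g1)) = vv (acti k (g, 0)) - wv g1.
    by rewrite /wv; case: (acti _ _) => ? ?; vvring.
  by rewrite -vv_act addrA -actD E addrK.
have satX p gh : X p -> exists p' h, X p' /\ p + vv gh = p' + vv (0, h).
  move=> [k /XP[y [g1 [_ by1 E]]]].
  have [v3 E3] : exists v3, act k (p + vv gh) = y + vv v3.
    exists ((g1, - g1) + acti k gh); rewrite actD E vv_act /wv.
    by case: (acti _ _) => ? ?; vvring.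
  case: v3 E3 => g3 h3 E3.
  have fin g2 v : rep g2 = g2 -> vv (g3, h3) = wv g2 + act k (vv (0, v)) ->
      exists p' h, X p' /\ p + vv gh = p' + vv (0, h).
    move=> rg2 E4; exists (act (kinv k) (y + wv g2)), v; split.
      by exists k; rewrite actKV; exists g2; rewrite addrK.
    have E5 : y + vv (g3, h3) = (y + wv g2) + act k (vv (0, v)) by rewrite E4 addrA.
    by rewrite -[p + _](actK k) E3 E5 [LHS]actD actK.
  have sw x y' : pos x = spos y' -> spos x = pos y'.
    by move=> F; rewrite /swapped_pt F /swapped_pt swpK.
  have kk : (kinv k).2 = k.2 by rewrite /kinv; case k2 : k.2.
  (* If [act k] swaps the lattices, the final s(G)-correction becomes one in G, so the
     representative is determined by the part of the offset in s(G). *)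
  have [k2|k2] := boolP k.2.
    have [h4 /sw E4] := rep1 (- h3); have [v] := acti_l (kinv k) (g3 - rep (- h3) + h4).
    rewrite kk k2 => Ev; apply: (fin (rep (- h3)) v) => //.
    rewrite -Ev -vv_act actKV; move: E4; rewrite sposB sposN => E4.
    by rewrite /wv /offset /= posD posB sposN spos0 -E4; ring.
  have [h4 E4] := rep1 g3; have [v] := acti_r (kinv k) (h3 + rep g3 - h4).
  rewrite kk (negbTE k2) => Ev; apply: (fin (rep g3) v) => //.
  rewrite -Ev -vv_act actKV; move: E4; rewrite posB => /esym E4.
  by rewrite /wv /offset /= sposB sposD sposN pos0 E4; ring.
have z1b : b1 z1 by rewrite /b1 /= subrr /box /= normr0.
exists X; split; last first.
  have [g2 rg2] : exists g2, rep g2 = g2 by exists (rep 0).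
  have X0 : X (z1 + wv g2).
    by exists (false, false, false); rewrite act_id; exists g2; rewrite addrK.
  have [p [h [Xp E]]] := satX _ (- ((g2, - g2) + (0, v0))) X0.
  exists p, h; split; first by right.
  by rewrite -E (_ : _ + _ = z) // /z1 /wv; vvring.
split.
- apply: opnU; first exact: coset_opn iU.
  apply: opn_orbit; apply: opn_bigU => g p [rg bp]; have [e' e'0 He'] := opn_box bp.
  exists e' => // q bq; split => //; apply: He'.
  by have -> : q - wv g - (p - wv g) = q - p by ring.
- by move=> p [/(coset_box iU)|/Xbox].
- exact: d4U.
- move=> p g [Up|Xp] [Uq|Xq].
  + exact: (coset_uniq iU) Up Uq.
  + by case: (UX _ _ Up Xq).
  + case: (UX _ (- g) Uq); have -> // : p + vv (g, 0) + vv (- g, 0) = p by vvring.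
  have [k /XP[y [g1 [rg1 by1 E1]]]] := Xp; have [k' /XP[y' [g2 [rg2 by2 E2]]]] := Xq.
  have [k2 hk2] := act_comp R k' (kinv k).
  have Ep : act k' p = act k2 (y + wv g1) by rewrite -hk2 -E1 actK.
  have [|k2E vz] := sep k2 (acti k2 (g1, - g1) + acti k' (g, 0) - (g2, - g2)) y y' by1 by2.
    have -> : vv (acti k2 (g1, - g1) + acti k' (g, 0) - (g2, - g2)) =
        act k2 (wv g1) + act k' (vv (g, 0)) - wv g2.
      rewrite !vv_act /wv; case: (acti k2 _) (acti k' _) => ? ? [? ?]; vvring.
    have -> : y' = act k' (p + vv (g, 0)) - wv g2 by rewrite E2 addrK.
    by rewrite actD Ep actD; ring.
  rewrite k2E /= -[acti _ (g1, _)]/((g1, - g1) : Z2 * Z2) in vz.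
  have eqg : equivg g1 g2.
    have [g' [] Eg] := acti_diag k' g; rewrite Eg in vz.
      have F : pos (g1 + g' - g2) = spos (g2 - g1).
        by apply/eqP; rewrite -subr_eq0 -vz; apply/eqP; vvring.
      have F' : spos (g1 + g' - g2) = pos (g2 - g1) by rewrite /swapped_pt F /swapped_pt swpK.
      exists (- (g1 + g' - g2)); rewrite sposN F' -posN.
      by congr lattice_pt; ring.
    exists (g2 - g1 + g').
    by apply/eqP; rewrite -subr_eq0 -vz; apply/eqP; vvring.
  have g12 : g1 = g2 by rewrite -rg1 -rg2; exact: rep3.
  rewrite g12 addrAC subrr add0r in vz.
  apply: pos_eq0; rewrite -vv_l0 -[vv _](actK k') vv_act vz.
  by rewrite actE; case: (kinv k') => [[[] []] []]; congr pair; rewrite /= ?oppr0.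
- move=> p gh [/(coset_sat iU gh)|/(satX _ gh)] [p' [h [Hp' ->]]]; exists p', h.
    by split=> //; left.
  by split=> //; right.
Qed.

End Commensurable.

(** * Construction of the fundamental domain *)

Section Iterate.
Variable R : realType.
Local Notation P := (R * R)%type.
Variables a b : R.
Local Notation vv := (offset a b).

Definition meets (U W : set P) := exists p h, U p /\ W (p + vv (0, h)).

Record open_tile (r : R) (U : set P) : Prop := OpenTile {
  tile_opn : opn U;
  tile_box : forall p, U p -> box r p;
  tile_d4 : d4 U;
  tile_uniq : forall p g, U p -> U (p + vv (g, 0)) -> g = 0 }.

Lemma rational_box (W : set P) w : opn W -> W w -> exists x y (k : nat),
  forall p, box k.+1%:R^-1 (p - (ratr x, ratr y)) -> W p.
Proof.
move=> oW /oW[e e0 He].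
pose k := Num.bound (2 / e).
have k0 : 0 < k.+1%:R^-1 :> R by rewrite invr_gt0 ltr0n.
have ke : k.+1%:R^-1 + k.+1%:R^-1 <= e.
  have h : 2 / e < k.+1%:R.
    apply: lt_trans (archi_boundP _) _; first by rewrite divr_ge0 // ltW.
    by rewrite ltr_nat.
  suff : k.+1%:R^-1 <= e / 2 by move: (k.+1%:R^-1) => x; lra.
  by rewrite -invf_div lef_pV2 ?posrE ?ltr0n ?divr_gt0 // ltW.
have rat1 (u : R) : exists x : rat, `|ratr x - u| < k.+1%:R^-1.
  have [|x] := @rat_in_itvoo R (u - k.+1%:R^-1) (u + k.+1%:R^-1).
    by rewrite ltrBlDr -addrA ltrDl addr_gt0.
  rewrite in_itv /= => /andP[x1 x2]; exists x.
  by rewrite ltr_norml ltrBrDr ltrBlDr addrC x1 addrC x2.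
have [x hx] := rat1 w.1; have [y hy] := rat1 w.2.
exists x, y, k => p bp; apply: He; apply: box_le ke _.
have -> : p - w = (p - (ratr x, ratr y)) + ((ratr x, ratr y) - w) by rewrite addrA subrK.
by apply: boxD.
Qed.

(** The states form an arbitrary type because one case remembers the list of stages and the other
    only the set. Rational boxes are treated in the order of their codes, and the bound [r] is
    common to all steps. *)
Lemma dense_tile_of_extension (T : Type) (u : T -> set P) (I : T -> Prop) (t0 : T) (r : R) : I t0 ->
  (forall t, I t -> open_tile r (u t)) ->
  (forall t W w, I t -> opn W -> W w ->
     exists t', [/\ I t', u t `<=` u t' & meets (u t') W]) ->
  exists U, open_tile r U /\ forall W w, opn W -> W w -> meets U W.
Proof.
move=> I0 It step.
pose Wb (c : rat * rat * nat) : set P := [set p | box c.2.+1%:R^-1 (p - (ratr c.1.1, ratr c.1.2))].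
have oWb c : opn (Wb c) by exact: opn_box.
have Wbc c : Wb c (ratr c.1.1, ratr c.1.2).
  by rewrite /Wb /= subrr /box /= normr0 invr_gt0 ltr0n.
have [g hg] : exists g : T * option (rat * rat * nat) -> T, forall tc, I tc.1 ->
    [/\ I (g tc), u tc.1 `<=` u (g tc) & forall c, tc.2 = Some c -> meets (u (g tc)) (Wb c)].
  suff /choice[g hg] : forall tc : T * option (rat * rat * nat), exists t', I tc.1 ->
    [/\ I t', u tc.1 `<=` u t' & forall c, tc.2 = Some c -> meets (u t') (Wb c)] by exists g.
  move=> [t [c|]] /=; last by exists t => ?; split.
  have [It'|nI] := pselect (I t); last by exists t.
  have [t' [h1 h2 h3]] := step _ _ _ It' (oWb c) (Wbc c).
  by exists t' => _; split => // _ [<-].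
pose f := fix f (n : nat) : T := match n with O => t0 | S m => g (f m, choice.unpickle m) end.
have If n : I (f n) by elim: n => //= n IH; have [] := hg (f n, choice.unpickle n) IH.
have mono m n : (m <= n)%N -> u (f m) `<=` u (f n).
  elim: n => [|n IH]; first by rewrite leqn0 => /eqP->.
  rewrite leq_eqVlt ltnS => /orP[/eqP-> //|/IH h]; apply: subset_trans h _.
  by have [] := hg (f n, choice.unpickle n) (If n).
exists [set p | exists n, u (f n) p]; split.
  split.
  - by apply: opn_bigU => n; have [] := It _ (If n).
  - by move=> p [n Hp]; have [_ H _ _] := It _ (If n); exact: H.
  - by split=> p [n Hp]; exists n; have [_ _ [h1 h2] _] := It _ (If n); [apply: h1|apply: h2].
  - move=> p h [n Hp] [m Hm]; have [_ _ _ H] := It _ (If (maxn n m)); apply: (H p).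
      by apply: mono Hp; apply: leq_maxl.
    by apply: mono Hm; apply: leq_maxr.
move=> W w oW /(rational_box oW)[x [y [k sub]]].
have [m Em] : exists m, choice.unpickle m = Some (x, y, k).
  by exists (choice.pickle (x, y, k)); exact: choice.pickleK.
have [_ _ H] := hg (f m, choice.unpickle m) (If m).
have [p [h [Hp Wp]]] := H (x, y, k) Em.
by exists p, h; split; [exists m.+1|exact: sub].
Qed.

End Iterate.

Lemma dense_tile (R : realType) (a b : R) : 0 < a -> 0 < b ->
  exists r U, open_tile a b r U /\ forall W w, opn W -> W w -> meets a b U W.
Proof.
move=> a0 b0.
have [incomm|/existsNP[c /not_implyP[vc c0]]] := pselect (forall gh, offset a b gh = 0 -> gh = 0).
  have [q [hq1 hq2]] := vv_near a0 b0 (2 * edge_radius a b).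
  have hq : (forall g, box (2 * edge_radius a b) (offset a b (g, 0)) -> near q.+1 g 0) /\
      (forall h, box (2 * edge_radius a b) (offset a b (0, h)) -> near q.+1 h 0).
    by split=> x bx; apply: (@near_le q) => //; [apply: hq1|apply: hq2].
  exists (edge_radius a b); apply: (dense_tile_of_extension
    (u := @stage_union R) (I := staged_tile a b q.+1) (t0 := [::])).
  - have U0 p : ~ stage_union [::] p by move=> [].
    split=> //; try by move=> p /U0.
    + by split=> p /U0.
    + by split=> p h /U0.
    + by exists set0 => // p _ _; exists 1 => // y _; split => /U0.
    move=> z S; have [f [f' [fK _ fb]]] := bijection_box a0 b0 z.
    exists [fset f g | g in S]%fset; first by rewrite card_imfset //; exact: can_inj fK.
    move=> _ /imfsetP[g /= gS ->]; exists g => //; split => [|g' /U0 //].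
    rewrite /offset /= addrA; apply: box_le (fb g).
    by have r0 := rho_gt0 a0 b0; rewrite /edge_radius; lra.
  - move=> l il; split; [exact: staged_opn il|exact: staged_box il|exact: staged_d4 il|].
    by case: (staged_uniq il).
  move=> l W w il oW Ww; have [X [iX mX]] := staged_tile_extend a0 b0 (ltn0Sn q) hq incomm il oW Ww.
  by exists (rcons l X); split => //; rewrite stage_union_rcons; apply: subsetUl.
have [r step] := coset_tile_extend a0 b0 c0 vc.
exists r; apply: (dense_tile_of_extension (u := id) (I := coset_tile a b r) (t0 := set0)).
- by split=> // *; split.
- by move=> U [? ? ? ? ?].
move=> U W w iU oW Ww; have [X [iX mX]] := step _ _ _ iU oW Ww.
by exists (U `|` X); split => //; apply: subsetUl.
Qed.

(** * The closure of a dense tile is a fundamental domain *)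

Section Topology.
Variable R : realType.
Local Notation P := (R * R)%type.

Lemma nbhs_box (p : P) (A : set P) :
  nbhs p A <-> exists2 e, 0 < e & forall q, box e (q - p) -> A q.
Proof.
split.
  move=> /nbhs_ballP[e /= e0 He]; exists e => // q [q1 q2]; apply: He.
  by split; rewrite -ball_normE /= distrC.
move=> [e e0 He]; apply/nbhs_ballP; exists e => // q [].
by rewrite -!ball_normE /= => q1 q2; apply: He; split; rewrite /= distrC.
Qed.

Lemma padd_add (p q : P) : padd p q = p + q. Proof. by []. Qed.

Lemma opn_interior (A : set P) : opn (interior A).
Proof.
move=> p /nbhs_interior /nbhs_box[e e0 He]; exists e => //.
Qed.

Lemma opnI (A B : set P) : opn A -> opn B -> opn (A `&` B).
Proof.
move=> oA oB p [/oA[e e0 He] /oB[e' e'0 He']]; exists (Num.min e e').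
  by rewrite lt_min e0.
by move=> q bq; split; [apply: He|apply: He']; apply: box_le bq; rewrite ge_min lexx ?orbT.
Qed.

Lemma compact_bounded (A : set P) (N : R) : closed A ->
  (forall p, A p -> `|p.1| <= N /\ `|p.2| <= N) -> compact A.
Proof.
move=> cA bA; have cB : compact (`[- N, N] `*` `[- N, N] : set P).
  by apply: compact_setX; apply: segment_compact.
apply: (subclosed_compact cA cB) => p /bA [].
by rewrite !ler_norml => h1 h2; split; rewrite /= in_itv.
Qed.

Lemma closure_act (U : set P) k p : d4 U -> closure U p -> closure U (act k p).
Proof.
move=> dU cp B /nbhs_box[e e0 He].
have [|q [Uq bq]] := cp [set q | box e (q - p)].
  by apply/nbhs_box; exists e.
exists (act k q); split; first by rewrite d4_act.
by apply: He; rewrite -actB box_act.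
Qed.

Lemma closure_box (U : set P) r p : (forall p, U p -> box r p) -> closure U p ->
  `|p.1| <= r /\ `|p.2| <= r.
Proof.
move=> Ub cp.
have app e : 0 < e -> exists2 q, box r q & box e (q - p).
  move=> e0; have [|q [Uq bq]] := cp [set q | box e (q - p)].
    by apply/nbhs_box; exists e.
  by exists q; first exact: Ub.
split; apply/ler_addgt0Pr => e /app[q [q1 q2] [/= d1 d2]].
  have := ler_normD (p.1 - q.1) q.1; rewrite subrK distrC => h.
  by apply: le_trans h _; rewrite addrC lerD // ltW.
have := ler_normD (p.2 - q.2) q.2; rewrite subrK distrC => h.
by apply: le_trans h _; rewrite addrC lerD // ltW.
Qed.

Variables a b : R.
Hypotheses (a0 : 0 < a) (b0 : 0 < b).
Local Notation pos := (lattice_pt a b).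
Variables (r : R) (U : set P).
Hypothesis tU : open_tile a b r U.
Hypothesis dense : forall W w, opn W -> W w -> meets a b U W.

Lemma dense_pos W w : opn W -> W w -> exists p g, U p /\ W (p + pos g).
Proof.
move=> oW Ww.
have [||p [h [Up Wp]]] := @dense [set p | W (act (false, false, true) p)] (swp w).
- exact: opn_act.
- by rewrite /= /act /= swpK.
exists (swp p), (- h); split; first by have [_ _ [_ H] _] := tU; apply: H.
by move: Wp; rewrite /= /act /= swpD /offset /= pos0 sub0r swpN /swapped_pt swpK posN.
Qed.

(** Only finitely many translates come near [p]. If the closure of none of them contained [p], all
    would miss a common neighbourhood of [p], against density. *)
Lemma closure_cover p : exists g, closure U (p - pos g).
Proof.
apply: contrapT => /forallNP none.
pose rp := `|p.1| + `|p.2| + 1.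
have bp : box rp p by split; rewrite /rp; have := normr_ge0 p.1; have := normr_ge0 p.2; lra.
have [K [hK _]] := vv_near a0 b0 (rp + (r + 1)).
have [||e e0 He] := @fin_eps R _ (ball K 0)
  (fun g e => forall q, box e (q - (p - pos g)) -> ~ U q).
- by move=> g e e' H ee q /(box_le ee); exact: H.
- move=> g _; apply: contrapT => H; apply: (none g) => B /nbhs_box[e e0 He].
  apply: contrapT => /set0P/negP/negPn/eqP E; apply: H; exists e => // q /He Bq Uq.
  by have : (U `&` B) q by []; rewrite E.
pose e' := Num.min e 1.
have [||q [g [Uq bq]]] := @dense_pos [set q | box e' (q - p)] p.
- exact: opn_box.
- by rewrite /= subrr /box /= normr0 lt_min e0 ltr01.
have gK : g \in ball K 0.
  rewrite in_ball; apply: hK; rewrite /offset /= spos0 subr0.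
  have -> : pos g = p + ((q + pos g - p) - q) by ring.
  apply: boxD bp _; rewrite [r + 1]addrC; apply: boxD.
    by apply: box_le bq; rewrite ge_min lexx orbT.
  by rewrite boxN; have [_ H _ _] := tU; apply: H.
apply: (He g gK q _ Uq).
have -> : q - (p - pos g) = q + pos g - p by ring.
by apply: box_le bq; rewrite ge_min lexx.
Qed.

Definition corner (N : R) : set P :=
  [set p | p \in [:: (N, 0); (- N, 0); (0, N); (0, - N)]].

Lemma corner_countable N (v : P) : countable
  [set x | exists2 p, corner N p & x \in [:: p.1; p.2; p.1 + v.1; p.2 + v.2]].
Proof.
pose s := [:: N; - N; 0].
pose s' := s ++ [seq x + v.1 | x <- s] ++ [seq x + v.2 | x <- s].
apply: (@sub_countable _ _ _ [set` s']); last first.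
  by apply: finite_set_countable; exact: finite_seq.
apply: subset_card_le => x [p]; rewrite /corner /= !inE => /or4P[]/eqP->/=;
  by move=> /or4P[]/eqP->; rewrite !eqxx ?orbT.
Qed.

(** An open set in both interiors contains a point off the corners, hence near it points of [U]; a
    generic one of these lies in [U] and in the translated closure. As [U] is open, it then meets
    its own translate. *)
Lemma int_disjoint N (v : P) : (exists2 g, v = pos g & g <> 0) ->
  interior (closure U `|` corner N) `&` interior (translate (closure U `|` corner N) v) = set0.
Proof.
move=> [g vg g0]; set F := _ `|` _; apply/eqP/negPn/negP => /set0P[x Wx].
set W := _ `&` _ in Wx.
have oW : opn W by apply: opnI; exact: opn_interior.
have [y [[y1 y2] yC _]] := generic_point a b (corner_countable N v) oW Wx.
have nC (z : P) : (forall gh, ~ [set x | exists2 p, corner N p &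
    x \in [:: p.1; p.2; p.1 + v.1; p.2 + v.2]] (z + offset a b gh).1 /\
    ~ [set x | exists2 p, corner N p &
    x \in [:: p.1; p.2; p.1 + v.1; p.2 + v.2]] (z + offset a b gh).2) ->
    ~ corner N z /\ forall p, corner N p -> z <> p + v.
  move=> /(_ 0); rewrite vv0 addr0 => -[h1 _]; split=> [cz|p cp E].
    by apply: h1; exists z; rewrite // !inE eqxx.
  by apply: h1; exists p; rewrite // E !inE eqxx !orbT.
have [ny _] := nC _ yC.
have cy : closure U y by case: (interior_subset y1).
have [|u [Uu Wu]] := cy W.
  by apply/nbhs_box; apply: oW.
have [oU _ _ uU] := tU.
have [z [[Uz [_ z2]] zC _]] := generic_point a b (corner_countable N v) (opnI oU oW) (conj Uu Wu).
have [_ nz] := nC _ zC.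
have [p [cp|cp] Ep] := interior_subset z2; last by case: (nz _ cp); rewrite -Ep.
have [|q [Uq Uq']] := cp [set q | U (q + v)].
  apply/nbhs_box; have [e e0 He] := oU _ Uz; exists e => // q bq; apply: He.
  by rewrite -Ep padd_add; have -> : q + v - (p + v) = q - p by ring.
by apply: g0; apply: (uU q); rewrite // /offset /= spos0 subr0 -vg.
Qed.

Lemma closure_fundamental N : 0 < N -> r <= N ->
  fundamental_domain (range pos) (closure U `|` corner N).
Proof.
move=> N0 rN; have [_ Ub _ _] := tU.
split; [|split].
- apply: (@compact_bounded _ N).
    apply: closedU; first exact: closed_closure.
    apply: (iffLR accessible_finite_set_closed); last exact: finite_seq.
    exact/hausdorff_accessible/norm_hausdorff.
  move=> p [/(closure_box Ub)[p1 p2]|]; first by split; apply: le_trans rN.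
  by rewrite /corner /= !inE => /or4P[]/eqP-> /=;
    rewrite ?normrN ?normr0 ?gtr0_norm // (ltW N0).
- apply/seteqP; split=> // p _; have [g cg] := closure_cover p.
  exists (p - pos g); first by left.
  by exists (pos g); [exists g|rewrite padd_add subrK].
move=> _ [g _ <-] /eqP v0; apply: int_disjoint; exists g => // E.
by apply: v0; rewrite E pos0.
Qed.

End Topology.

(** * Isometry groups *)

Section Isometries.
Variable R : realType.
Local Notation P := (R * R)%type.
Implicit Types (p q : P) (f : P -> P).

Definition d2 p q : R := (p.1 - q.1) ^+ 2 + (p.2 - q.2) ^+ 2.

Lemma d2_ge0 p q : 0 <= d2 p q.
Proof. by rewrite addr_ge0 // sqr_ge0. Qed.

Lemma edistE p q : Defs.edist p q = Num.sqrt (d2 p q).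
Proof. by rewrite /Defs.edist /enorm /dotp /psub /= -!expr2. Qed.

Lemma isometryP f : Defs.isometry f <-> forall p q, d2 (f p) (f q) = d2 p q.
Proof.
split=> H p q; last by rewrite !edistE H.
by apply/eqP; rewrite -eqr_sqrt ?d2_ge0 // -!edistE H.
Qed.

Lemma d2_act k p q : d2 (act k p) (act k q) = d2 p q.
Proof. by rewrite !actE /d2; case: k => [[[] []] []] /=; ring. Qed.

Lemma act_isometry k : Defs.isometry (@act R k).
Proof. by apply/isometryP => p q; rewrite d2_act. Qed.

Lemma act0 k : act k (0 : P) = 0.
Proof. by rewrite actE; case: k => [[[] []] []]; congr pair; rewrite /= ?oppr0. Qed.

(** Differences of squared distances to the three given points are linear in the coordinates and
    determine them. *)
Lemma isometry_eq f (N M : R) k : N != 0 -> M != 0 -> Defs.isometry f -> f 0 = 0 ->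
  f (N, 0) = act k (N, 0) -> f (0, M) = act k (0, M) -> f = act k.
Proof.
move=> N0 M0 /isometryP iso f0 fN fM; apply/funext => p.
have h0 := iso p 0; have hN := iso p (N, 0); have hM := iso p (0, M).
rewrite f0 in h0; rewrite fN in hN; rewrite fM in hM.
rewrite -[f p](actKV k) -{1}(act0 k) d2_act in h0.
rewrite -[f p](actKV k) d2_act in hN; rewrite -[f p](actKV k) d2_act in hM.
rewrite -[LHS](actKV k); congr act.
move: (act (kinv k) (f p)) h0 hN hM => [x y]; case: p => [x' y']; rewrite /d2 /= => h0 hN hM.
congr pair.
  by apply: (mulfI N0); lra.
by apply: (mulfI M0); lra.
Qed.

End Isometries.

(** * The far points reduce the symmetry group to D4 *)

Section SymF.
Variable R : realType.
Local Notation P := (R * R)%type.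
Variables (C : set P) (r : R).
Hypothesis r0 : 0 < r.
Hypothesis Cbox : forall p, C p -> `|p.1| <= r /\ `|p.2| <= r.
Hypothesis Cact : forall k p, C p -> C (act k p).
(** Far enough for every distance within [C], or from [C] to a corner, to be less than [2 * N]. *)
Let N : R := 2 * r + 1.
Let F : set P := C `|` corner N.

Lemma corner_act k p : corner N p -> corner N (act k p).
Proof.
rewrite /corner /= !inE => /or4P[]/eqP->; rewrite actE; case: k => [[[] []] []] /=;
  by rewrite ?oppr0 ?opprK eqxx ?orbT.
Qed.

(* Opposite far points are the only pairs of points of [F] at the maximal distance [2 * N]. *)
Lemma far_pairs p q : F p -> F q -> d2 p q = 4 * N ^+ 2 -> corner N p /\ q = - p.
Proof.
have rr := r0; have bnd x : C x -> [/\ - r <= x.1, x.1 <= r, - r <= x.2 & x.2 <= r].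
  by move=> /Cbox []; rewrite !ler_norml => /andP[? ?] /andP[].
have sq (x : R) : - r <= x -> x <= r -> x ^+ 2 <= r ^+ 2 by move=> h1 h2; nra.
have far x y : C x -> corner N y -> d2 x y < 4 * N ^+ 2.
  move=> /bnd[h1 h2 h3 h4]; have s1 := sq _ h1 h2; have s2 := sq _ h3 h4.
  by rewrite /corner /= !inE => /or4P[]/eqP->; rewrite /d2 /N /=; nra.
have d2C x y : d2 x y = d2 y x by rewrite /d2; ring.
case=> [Cp|cp] [Cq|cq] E.
- have [h1 h2 h3 h4] := bnd _ Cp; have [h5 h6 h7 h8] := bnd _ Cq.
  exfalso; have : d2 p q < 4 * N ^+ 2; last by rewrite E ltxx.
  have s1 : (p.1 - q.1) ^+ 2 <= 4 * r ^+ 2 by nra.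
  have s2 : (p.2 - q.2) ^+ 2 <= 4 * r ^+ 2 by nra.
  by rewrite /d2 /N; nra.
- by have := far _ _ Cp cq; rewrite E ltxx.
- by have := far _ _ Cq cp; rewrite d2C E ltxx.
split=> //; have N0 : 0 < N by rewrite /N; lra.
move: cp cq E; rewrite /corner /= !inE => /or4P[]/eqP-> /or4P[]/eqP->;
  rewrite /d2 /= => E; try (by congr pair; rewrite /= ?oppr0 ?opprK); exfalso; nra.
Qed.

Lemma SymE : Sym F = [set act k | k in setT].
Proof.
have rr := r0; have N0 : 0 < N by rewrite /N; lra.
apply/seteqP; split=> [f [iso fF]|_ [k _ <-]]; last first.
  split; first exact: act_isometry.
  have sub k' p : F p -> F (act k' p) by case=> ?; [left; apply: Cact|right; apply: corner_act].
  apply/seteqP; split=> [_ [p Fp <-]|p Fp]; first exact: sub.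
  by exists (act (kinv k) p); [apply: sub|rewrite actKV].
have /isometryP iso2 := iso.
have fFp p : F p -> F (f p) by move=> Fp; rewrite -fF; exists p.
have cF p : corner N p -> F p by right.
have c1 : corner N (N, 0) by rewrite /corner /= !inE eqxx.
have c2 : corner N (- N, 0) by rewrite /corner /= !inE eqxx ?orbT.
have c3 : corner N (0, N) by rewrite /corner /= !inE eqxx ?orbT.
have c4 : corner N (0, - N) by rewrite /corner /= !inE eqxx ?orbT.
have [A1 A2] : corner N (f (N, 0)) /\ f (- N, 0) = - f (N, 0).
  by apply: far_pairs; [apply/fFp/cF|apply/fFp/cF|rewrite iso2 /d2 /=; ring].
have [B1 B2] : corner N (f (0, N)) /\ f (0, - N) = - f (0, N).
  by apply: far_pairs; [apply/fFp/cF|apply/fFp/cF|rewrite iso2 /d2 /=; ring].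
(* By the parallelogram law, a point at distance [N] from both ends of a segment of length [2 * N]
   is its midpoint. *)
have f0 : f 0 = 0.
  have h1 := iso2 0 (N, 0); have h2 := iso2 0 (- N, 0); rewrite A2 in h2.
  have h3 := iso2 (N, 0) (- N, 0); rewrite A2 in h3.
  move: (f 0) (f (N, 0)) h1 h2 h3 => [x y] [u v]; rewrite /d2 /= => h1 h2 h3.
  have s : x ^+ 2 + y ^+ 2 = 0 by nra.
  by congr pair; nra.
have AB := iso2 (N, 0) (0, N); rewrite {2}/d2 /= in AB.
suff [k [k1 k2]] : exists k, f (N, 0) = act k (N, 0) /\ f (0, N) = act k (0, N).
  by exists k => //; apply/esym; apply: isometry_eq k1 k2; rewrite ?gt_eqF.
move: A1 B1 AB; rewrite /corner /= !inE.
move=> /or4P[]/eqP-> /or4P[]/eqP->; rewrite /d2 /= => AB; try (exfalso; nra).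
- by exists (false, false, false).
- by exists (false, true, false); split; congr pair; rewrite /= ?oppr0.
- by exists (true, false, false); split; congr pair; rewrite /= ?oppr0.
- by exists (true, true, false); split; congr pair; rewrite /= ?oppr0.
- by exists (false, false, true); split.
- by exists (true, false, true); split; congr pair; rewrite /= ?oppr0.
- by exists (false, true, true); split; congr pair; rewrite /= ?oppr0.
- by exists (true, true, true); split; congr pair; rewrite /= ?oppr0.
Qed.

End SymF.

(** * The groups D4 and D2, and the point group of the lattice *)

Section Groups.
Variable R : realType.
Local Notation P := (R * R)%type.

Definition group8 : set (P -> P) := [set act k | k in setT].
Definition group4 : set (P -> P) := [set act k | k in [set k : K8 | k.2 = false]].

Lemma index2_group : index2 group8 group4.
Proof.
split; first by move=> _ [k _ <-]; exists k.
exists (act (false, false, true)); split; first by exists (false, false, true).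
split.
  (* The point (1, 2) has eight distinct images under D4, so it tells its elements apart. *)
  move=> [[[s1 s2] s3] /= ->] /(congr1 (fun f => f (1, 2))); rewrite !actE /=.
  by case: s1 s2 => [] [] [] /=; lra.
apply/seteqP; split.
  move=> _ [[[s1 s2] [] _ <-]]; last by left; exists (s1, s2, false).
  right; exists (act (s2, s1, false)); first by exists (s2, s1, false).
  by apply/funext => -[x y]; rewrite /= !actE /=; case: s1 s2 => [] [].
move=> _ [[[[s1 s2] s3] /= -> <-]|[_ [[[s1 s2] s3] /= -> <-] <-]].
  by exists (s1, s2, false).
exists (s2, s1, true) => //.
by apply/funext => -[x y]; rewrite /= !actE /=; case: s1 s2 => [] [].
Qed.

Definition rot90 : K8 := (true, false, true).
Definition flip_y : K8 := (false, true, false).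
(** Sign and swap code of the k-th power of the rotation, preceded by the flip if [e]. *)
Definition word (k : nat) (e : bool) : K8 :=
  if e then nth (false, false, false) [:: (false, true, false); (false, false, true);
    (true, false, false); (true, true, true)] k
  else nth (false, false, false) [:: (false, false, false); (true, false, true);
    (true, true, false); (false, true, true)] k.

Lemma wordE k e : (k < 4)%N ->
  iter k (comp (act rot90)) id \o (if e then act flip_y else id) = act (word k e) :> (P -> P).
Proof.
by case: k => [|[|[|[|//]]]] _; apply/funext => -[x y]; case: e => /=;
  rewrite !actE /= ?opprK.
Qed.

Lemma D4_group : isomorphic_D4 group8.
Proof.
exists (act rot90), (act flip_y); split; first by exists rot90.
split; first by exists flip_y.
split; first by apply/funext => -[x y] /=; rewrite !actE /= !opprK.
split; first by apply/funext => -[x y] /=; rewrite !actE /= !opprK.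
split; first by apply/funext => -[x y] /=; rewrite !actE /= ?opprK.
split=> [k e k' e'|].
  rewrite !wordE ?ltn_ord // => /(congr1 (fun f => f (1, 2))) h.
  move: (congr1 fst h) (congr1 snd h); rewrite !actE {h}.
  case: k k' => [[|[|[|[|//]]]] ik] [[|[|[|[|//]]]] ik'] /=; case: e e' => [] [] /= h1 h2;
    first [by split => //; apply/val_inj | exfalso; lra].
apply/seteqP; split=> [_ [k _ <-]|_ [k _ [e _ <-]]]; last by rewrite wordE ?ltn_ord //; eexists.
have [i [e [i4 <-]]] : exists i e, (i < 4)%N /\ word i e = k.
  case: k => [[[] []] []].
  - by exists 3, true. - by exists 2, false. - by exists 1, false. - by exists 2, true.
  - by exists 3, false. - by exists 0, true. - by exists 1, true. - by exists 0, false.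
by exists (Ordinal i4) => //; exists e => //; rewrite wordE.
Qed.

Variables a b : R.
Hypotheses (a0 : 0 < a) (b0 : 0 < b).
Hypotheses (nab : a ^+ 2 != b ^+ 2) (nab3 : a ^+ 2 != 3 * b ^+ 2) (nba3 : b ^+ 2 != 3 * a ^+ 2).
Local Notation pos := (lattice_pt a b).

Lemma pos_act (s1 s2 : bool) g : exists g', act (s1, s2, false) (pos g) = pos g'.
Proof.
have [g' E] := acti_l (s1, s2, false) g; exists g'.
by rewrite -!vv_l0 vv_act E.
Qed.

(** The images (a m, b n) and (a m', b n') of (2 a, 0) and (0, 2 b) keep lengths and orthogonality,
    so m is at most 2 in absolute value. Here m = 0 forces a square lattice, m = 1 or -1 a hexagonal
    one, and m = 2 or -2 gives sign changes only. *)
Lemma isometry_lattice f : Defs.isometry f -> f 0 = 0 ->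
  (forall g, exists g', f (pos g) = pos g') -> group4 f.
Proof.
move=> iso f0 fG; have /isometryP iso2 := iso.
have [g1 E1] := fG (1, 1); have [g2 E2] := fG (1, -1).
have F1 : pos (1, 1) = (2 * a, 0) by congr pair; rewrite /= ?subrr ?mulr0 // mulrC.
have F2 : pos (1, -1) = (0, 2 * b) by congr pair; rewrite /= ?subrr ?mulr0 // mulrC.
rewrite F1 in E1; rewrite F2 in E2.
have h1 := iso2 (2 * a, 0) 0; have h2 := iso2 (0, 2 * b) 0; have h3 := iso2 (2 * a, 0) (0, 2 * b).
rewrite E1 f0 in h1; rewrite E2 f0 in h2; rewrite E1 E2 in h3.
have int_sqr (c d : R) (x y z : int) : 0 < c -> 0 < d ->
    (x * x * (y * y))%:~R * (c * d) = z%:~R * (c * d) :> R -> x * x * (y * y) = z.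
  by move=> c0 d0 /(mulIf (lt0r_neq0 (mulr_gt0 c0 d0))) /eqP; rewrite eqr_int => /eqP.
have a20 : 0 < a ^+ 2 by rewrite exprn_gt0.
have b20 : 0 < b ^+ 2 by rewrite exprn_gt0.
move: h1 h2 h3 E1 E2; rewrite /d2 /lattice_pt /= !subr0.
(* The two coefficients of a lattice vector have the same parity; without this, m = 0 would allow n
   n' m' combinations such as a product n m' with factors 1 and 4. *)
have par : exists k, g1.1 - g1.2 = g1.1 + g1.2 - 2 * k by exists g1.2; ring.
have par' : exists k, g2.1 - g2.2 = g2.1 + g2.2 - 2 * k by exists g2.2; ring.
move: (g1.1 + g1.2) (g1.1 - g1.2) (g2.1 + g2.2) (g2.1 - g2.2) par par' => m n m' n'.
move=> [k par] [k' par'] h1 h2 h3 E1 E2.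
have x1 : a ^+ 2 * m%:~R ^+ 2 + b ^+ 2 * n%:~R ^+ 2 = 4 * a ^+ 2 by rewrite -!exprMn h1; ring.
have x2 : a ^+ 2 * m'%:~R ^+ 2 + b ^+ 2 * n'%:~R ^+ 2 = 4 * b ^+ 2 by rewrite -!exprMn h2; ring.
have x3 : a ^+ 2 * m%:~R * m'%:~R + b ^+ 2 * n%:~R * n'%:~R = 0 by lra.
have nN (x y : R) : 0 < x -> x * y = 0 -> y = 0.
  by move=> x0 /eqP; rewrite mulf_eq0 gt_eqF //= => /eqP.
have int0 (x : int) : x%:~R ^+ 2 = 0 :> R -> x = 0.
  by move=> /eqP; rewrite sqrf_eq0 intr_eq0 => /eqP.
have mb : -2 <= m <= 2.
  have : (m * m)%:~R <= 4%:~R :> R.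
    rewrite intrM -expr2 -(ler_pM2l a20) [4%:~R]/4 [a ^+ 2 * 4]mulrC -x1 lerDl.
    by rewrite mulr_ge0 // ?sqr_ge0 // ltW.
  by rewrite ler_int => H; nia.
have [m0|[m1|m2]] : m = 0 \/ m * m = 1 \/ m * m = 4 by nia.
- exfalso; rewrite m0 !mulr0 !mul0r !add0r expr0n /= mulr0 add0r in x1 x3.
  have n0 : n != 0 by apply/eqP => n0; move: x1; rewrite n0 expr0n /= mulr0; lra.
  have n'0 : n' = 0.
    apply: int0; move: x3; rewrite -mulrA => /(nN _ _ b20) /eqP.
    rewrite mulf_eq0 intr_eq0 (negbTE n0) /=.
    by move=> /eqP->; rewrite expr0n.
  rewrite n'0 expr0n /= mulr0 addr0 in x2.
  have e16 : n * n * (m' * m') = 16.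
    apply: (@int_sqr (b ^+ 2) (a ^+ 2)) => //; rewrite !intrM.
    transitivity ((b ^+ 2 * n%:~R ^+ 2) * (a ^+ 2 * m'%:~R ^+ 2) : R); first ring.
    by rewrite x1 x2; ring.
  have n4 : n * n = 4.
    have nk : n = - 2 * k by rewrite par m0; ring.
    have mk : m' = 2 * k' by move: par'; rewrite n'0; lia.
    have kk : 16 * ((k * k) * (k' * k')) = 16 by rewrite -[RHS]e16 nk mk; ring.
    have {}kk : (k * k) * (k' * k') = 1 by lia.
    have k1 : 0 <= k * k by nia.
    have k1' : 0 <= k' * k' by nia.
    have k11 : k * k = 1.
      have /eqP := congr1 absz kk; rewrite abszM muln_eq1 => /andP[/eqP + _].
      by move: (k * k) k1 => x; lia.
    by rewrite nk; lia.
  case/negP: nab; apply/eqP; have : b ^+ 2 * (n * n)%:~R = 4 * a ^+ 2 by rewrite intrM -expr2.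
  by rewrite n4; lra.
- exfalso; have M1 : m%:~R ^+ 2 = 1 :> R by rewrite expr2 -intrM m1.
  have y1 : b ^+ 2 * n%:~R ^+ 2 = 3 * a ^+ 2 by move: x1; rewrite M1; lra.
  have y2 : a ^+ 2 * m'%:~R ^+ 2 = 3 * b ^+ 2 * n'%:~R ^+ 2.
    apply: (mulfI (lt0r_neq0 a20)).
    transitivity ((a ^+ 2 * m%:~R * m'%:~R) ^+ 2 : R).
      transitivity (a ^+ 2 * (a ^+ 2 * (m%:~R ^+ 2 * m'%:~R ^+ 2)) : R); last ring.
      by rewrite M1 mul1r.
    have -> : a ^+ 2 * m%:~R * m'%:~R = - (b ^+ 2 * n%:~R * n'%:~R) by lra.
    transitivity ((b ^+ 2 * n%:~R ^+ 2) * (b ^+ 2 * n'%:~R ^+ 2) : R); first ring.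
    by rewrite y1; ring.
  have y3 : n'%:~R ^+ 2 = 1 :> R.
    by apply: (mulfI (lt0r_neq0 b20)); rewrite mulr1; move: x2; rewrite y2; lra.
  have e9 : n * n * (m' * m') = 9.
    apply: (@int_sqr (b ^+ 2) (a ^+ 2)) => //; rewrite !intrM.
    transitivity ((b ^+ 2 * n%:~R ^+ 2) * (a ^+ 2 * m'%:~R ^+ 2) : R); first ring.
    by rewrite y1 y2 y3; ring.
  have e3 : (absz n * absz m' = 3)%N.
    apply/eqP; rewrite -(@eqn_exp2r _ _ 2) // -[(3 ^ 2)%N]/(absz 9) -e9 !abszM.
    by rewrite expnMn -!mulnn.
  have [n1|[n9 m'1]] : n * n = 1 \/ n * n = 9 /\ m' * m' = 1.
    have /primeP[_ /(_ (absz n))] : prime 3 by [].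
    rewrite -e3 dvdn_mulr // => /(_ isT) /orP[/eqP h|].
      by left; have [->|->] : n = 1 \/ n = -1 by lia.
    rewrite e3 => /eqP h; rewrite h in e3; right.
    have [->|->] : n = 3 \/ n = -3 by lia.
      by have [->|->] : m' = 1 \/ m' = -1 by lia.
    by have [->|->] : m' = 1 \/ m' = -1 by lia.
  - case/negP: nba3; apply/eqP; have N1 : n%:~R ^+ 2 = 1 :> R by rewrite expr2 -intrM n1.
    by rewrite -y1 N1 mulr1.
  - case/negP: nab3; apply/eqP; have N1 : m'%:~R ^+ 2 = 1 :> R by rewrite expr2 -intrM m'1.
    by move: y2; rewrite y3 N1 !mulr1.
have M4 : m%:~R ^+ 2 = 4 :> R by rewrite expr2 -intrM m2.
have n0 : n = 0.
  by apply: int0; apply: nN b20 _; move: x1; rewrite M4; lra.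
rewrite n0 mulr0 mul0r addr0 in x3.
have m'0 : m' = 0.
  apply: int0; apply: (nN (a ^+ 2 * 4)); first by rewrite mulr_gt0.
  transitivity ((a ^+ 2 * m%:~R * m'%:~R) * (m%:~R * m'%:~R) : R); last by rewrite x3 mul0r.
  by rewrite -M4; ring.
have n'2 : n' = 2 \/ n' = -2.
  have : (n' * n')%:~R = 4%:~R :> R.
    apply: (mulfI (lt0r_neq0 b20)); rewrite intrM -expr2; move: x2.
    by rewrite m'0 expr0n /= mulr0 add0r => ->; rewrite mulrC.
  by move=> /eqP; rewrite eqr_int => /eqP H; nia.
have m22 : m = 2 \/ m = -2 by nia.
rewrite n0 m'0 !mulr0 in E1 E2.
have fin s1 s2 : f (2 * a, 0) = act (s1, s2, false) (2 * a, 0) ->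
    f (0, 2 * b) = act (s1, s2, false) (0, 2 * b) -> group4 f.
  move=> G1 G2; exists (s1, s2, false) => //; apply/esym.
  by apply: isometry_eq G1 G2; rewrite // mulf_neq0 ?gt_eqF.
case: m22 => Em; case: n'2 => En; rewrite Em in E1; rewrite En in E2.
- by apply: (fin false false); rewrite ?E1 ?E2 !actE /=; congr pair; lra.
- by apply: (fin false true); rewrite ?E1 ?E2 !actE /=; congr pair; lra.
- by apply: (fin true false); rewrite ?E1 ?E2 !actE /=; congr pair; lra.
- by apply: (fin true true); rewrite ?E1 ?E2 !actE /=; congr pair; lra.
Qed.

Lemma point_groupE : point_group (range pos) = group4.
Proof.
apply/seteqP; split=> [f [iso [f0 fG]]|_ [[[s1 s2] s3] /= -> <-]].
  apply: isometry_lattice => // g.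
  have [g' _ <-] : range pos (f (pos g)) by rewrite -fG; exists (pos g) => //; exists g.
  by exists g'.
split; [exact: act_isometry|split; first exact: act0].
apply/seteqP; split=> [_ [_ [g _ <-] <-]|_ [g _ <-]].
  by have [g' ->] := pos_act s1 s2 g; exists g'.
have [g' E] := pos_act s1 s2 g; exists (pos g'); first by exists g'.
by rewrite -E; apply: (actK (s1, s2, false)).
Qed.

End Groups.

(** * Transport along a linear isometry *)

Section Conjugation.
Variable R : realType.
Local Notation P := (R * R)%type.
Variables psi psi' : P -> P.
Hypotheses (psiK : cancel psi psi') (psi'K : cancel psi' psi).
Hypothesis psi_iso : forall p q, d2 (psi p) (psi q) = d2 p q.
Hypothesis psiD : forall p q, psi (p + q) = psi p + psi q.
Implicit Types (f g : P -> P) (X F G : set P).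

Lemma psi0 : psi 0 = 0.
Proof. by apply: (addIr (psi 0)); rewrite -psiD !add0r. Qed.
Lemma psiB p q : psi (p - q) = psi p - psi q.
Proof. by apply: (addIr (psi q)); rewrite -psiD !subrK. Qed.
Lemma psi'_iso p q : d2 (psi' p) (psi' q) = d2 p q.
Proof. by rewrite -psi_iso !psi'K. Qed.

Definition conjugate f : P -> P := psi \o f \o psi'.
Definition unconjugate f : P -> P := psi' \o f \o psi.

Lemma conjK f : unconjugate (conjugate f) = f.
Proof. by apply/funext => p; rewrite /unconjugate /conjugate /= !psiK. Qed.
Lemma unconjK f : conjugate (unconjugate f) = f.
Proof. by apply/funext => p; rewrite /unconjugate /conjugate /= !psi'K. Qed.
Lemma conjM f g : conjugate (f \o g) = conjugate f \o conjugate g.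
Proof. by apply/funext => p; rewrite /conjugate /= psiK. Qed.
Lemma conj1 : conjugate id = id.
Proof. by apply/funext => p; rewrite /conjugate /= psi'K. Qed.
Lemma conj_inj : injective conjugate.
Proof. exact: can_inj conjK. Qed.

Lemma conj_isometry f : Defs.isometry f -> Defs.isometry (conjugate f).
Proof. by move=> /isometryP H; apply/isometryP => p q; rewrite psi_iso H psi'_iso. Qed.
Lemma unconj_isometry f : Defs.isometry f -> Defs.isometry (unconjugate f).
Proof. by move=> /isometryP H; apply/isometryP => p q; rewrite psi'_iso H psi_iso. Qed.

Lemma conj_image f X : f @` X = X -> conjugate f @` (psi @` X) = psi @` X.
Proof.
move=> fX; apply/seteqP; split=> [_ [_ [p Xp <-] <-]|_ [p + <-]].
  by rewrite /conjugate /= psiK; exists (f p) => //; rewrite -fX; exists p.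
rewrite -{1}fX => -[q Xq <-]; exists (psi q); first by exists q.
by rewrite /conjugate /= psiK.
Qed.
Lemma unconj_image f X : f @` (psi @` X) = psi @` X -> unconjugate f @` X = X.
Proof.
move=> fX; apply/seteqP; split=> [_ [p Xp <-]|p Xp].
  have : (psi @` X) (f (psi p)) by rewrite -fX; exists (psi p) => //; exists p.
  by move=> [q Xq E]; rewrite /unconjugate /= -E psiK.
have : (f @` (psi @` X)) (psi p) by rewrite fX; exists p.
by move=> [_ [q Xq <-] E]; exists q => //; rewrite /unconjugate /= E psiK.
Qed.

Lemma Sym_conj X : Sym (psi @` X) = conjugate @` Sym X.
Proof.
apply/seteqP; split=> [f [iso fX]|_ [f [iso fX] <-]].
  exists (unconjugate f); last exact: unconjK.
  by split; [exact: unconj_isometry|exact: unconj_image].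
by split; [exact: conj_isometry|exact: conj_image].
Qed.

Lemma point_group_conj G : point_group (psi @` G) = conjugate @` point_group G.
Proof.
have psi'0 : psi' 0 = 0 by rewrite -{1}psi0 psiK.
apply/seteqP; split=> [f [iso [f0 fX]]|_ [f [iso [f0 fX]] <-]].
  exists (unconjugate f); last exact: unconjK.
  split; [exact: unconj_isometry|split; last exact: unconj_image].
  by rewrite /unconjugate /= -[origin _]/(0 : P) psi0 [f 0]f0 psi'0.
split; [exact: conj_isometry|split; last exact: conj_image].
by rewrite /conjugate /= -[origin _]/(0 : P) psi'0 [f 0]f0 psi0.
Qed.

Lemma index2_conj (K H : set (P -> P)) : index2 K H -> index2 (conjugate @` K) (conjugate @` H).
Proof.
move=> [sHK [g [Kg [nHg KE]]]]; split.
  by move=> _ [f Hf <-]; exists f => //; apply: sHK.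
exists (conjugate g); split; first by exists g.
split; first by move=> [f Hf /conj_inj E]; apply: nHg; rewrite -E.
apply/seteqP; split=> [_ [f + <-]|_ [[f Hf <-]|[_ [f Hf <-] <-]]].
- rewrite KE => -[Hf|[h Hh <-]]; first by left; exists f.
  by right; exists (conjugate h); [exists h|rewrite conjM].
- by exists f => //; apply: sHK.
by exists (g \o f); [rewrite KE; right; exists f|rewrite conjM].
Qed.

Lemma D4_conj (K : set (P -> P)) : isomorphic_D4 K -> isomorphic_D4 (conjugate @` K).
Proof.
move=> [r [s [Kr [Ks [r4 [s2 [srs [inj KE]]]]]]]].
have it f n : iter n (comp (conjugate f)) id = conjugate (iter n (comp f) id).
  by elim: n => [|n IH]; rewrite ?conj1 // !iterS IH conjM.
have wE (k : 'I_4) (e : bool) : iter k (comp (conjugate r)) id \o (if e then conjugate s else id) =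
    conjugate (iter k (comp r) id \o (if e then s else id)).
  by rewrite it conjM; case: e; rewrite ?conj1.
exists (conjugate r), (conjugate s); split; first by exists r.
split; first by exists s.
split; first by rewrite it r4 conj1.
split; first by rewrite -conjM s2 conj1.
split; first by rewrite it -!conjM srs.
split=> [k e k' e'|]; first by rewrite !wE => /conj_inj /inj.
apply/seteqP; split=> [_ [f + <-]|_ [k _ [e _ <-]]].
  by rewrite KE => -[k _ [e _ <-]]; exists k => //; exists e.
rewrite wE; exists (iter k (comp r) id \o (if e then s else id)) => //.
by rewrite KE; exists k => //; exists e.
Qed.

Hypothesis psi_box : forall e p, box e p -> box (2 * e) (psi p).

Lemma psi_continuous : continuous psi.
Proof.
move=> p A /nbhs_box[e e0 He]; apply/nbhs_box; exists (e / 2); first by rewrite divr_gt0.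
move=> q bq; apply: He; rewrite -psiB.
by have := psi_box bq; rewrite mulrC divfK.
Qed.

Lemma interior_conj F p : interior (psi @` F) p -> interior F (psi' p).
Proof.
move=> /nbhs_box[e e0 He]; apply/nbhs_box; exists (e / 2); first by rewrite divr_gt0.
move=> q bq; have [|q' Fq' E] := He (psi q).
  rewrite -[p]psi'K -psiB; have := psi_box bq; by rewrite mulrC divfK.
by rewrite -(can_inj psiK E).
Qed.

Lemma fundamental_conj G F : fundamental_domain G F ->
  fundamental_domain (psi @` G) (psi @` F).
Proof.
move=> [cF [FG dF]]; split; [|split].
- by apply: continuous_compact => //; apply: continuous_subspaceT; exact: psi_continuous.
- apply/seteqP; split=> // p _; have : [set: P] (psi' p) by [].
  rewrite -FG => -[f Ff [v Gv E]]; exists (psi f); first by exists f.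
  by exists (psi v); [exists v|rewrite padd_add -psiD -(padd_add f v) E psi'K].
move=> _ [v Gv <-] v0; apply/eqP/negPn/negP => /set0P[x [x1 x2]].
have v0' : v != origin _.
  by apply: contra v0 => /eqP ->; rewrite -[origin _]/(0 : P) psi0.
have [] : set0 (psi' x); rewrite -(dF _ Gv v0'); split; apply: interior_conj => //.
have -> // : psi @` translate F v = translate (psi @` F) (psi v).
apply/seteqP; split=> [_ [_ [p Fp <-] <-]|_ [_ [p Fp <-] <-]].
  by exists (psi p); [exists p|rewrite !padd_add psiD].
by exists (padd p v); [exists p|rewrite !padd_add psiD].
Qed.

End Conjugation.

(** * Standard position and the general case *)

Section Standard.
Variable R : realType.
Variables a b : R.
Hypotheses (a0 : 0 < a) (b0 : 0 < b).
Hypotheses (nab : a ^+ 2 != b ^+ 2) (nab3 : a ^+ 2 != 3 * b ^+ 2) (nba3 : b ^+ 2 != 3 * a ^+ 2).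

Lemma standard_position : exists F, [/\ fundamental_domain (range (lattice_pt a b)) F,
  index2 (Sym F) (point_group (range (lattice_pt a b))) & isomorphic_D4 (Sym F)].
Proof.
have [r [U [tU dense]]] := dense_tile a0 b0.
pose r' := `|r| + 1; have r0 : 0 < r' by rewrite ltr_pwDr.
have rr : r <= r' by apply: le_trans (ler_norm r) _; rewrite lerDl.
have [_ Ub dU _] := tU.
exists (closure U `|` corner (2 * r' + 1)); rewrite (SymE r0) ?point_groupE //.
- split; last exact: D4_group; last exact: index2_group.
  by apply: (closure_fundamental a0 b0 tU dense); lra.
- by move=> p /(closure_box Ub)[p1 p2]; split; apply: le_trans rr.
- by move=> k p; apply: closure_act.
Qed.

End Standard.

Theorem theorem2p1 (R : realType) (G : set (pt R)) :
  lattice G -> rhombic G ->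
  exists F : set (pt R),
    fundamental_domain G F /\
    point_group G `<=` Sym F /\
    index2 (Sym F) (point_group G) /\
    isomorphic_D4 (Sym F).
Proof.
move=> _ [u [v [[ind GE] [nuv [n0 [n1 n2]]]]]].
(* The diagonals of the rhombus, orthogonal because [u] and [v] have equal length, give the axes;
   [a] and [b] are half their lengths. *)
pose p := u + v; pose q := u - v.
pose sp := dotp p p; pose sq := dotp q q.
have uv : dotp u u = dotp v v.
  have ge0 x : 0 <= dotp x x :> R by rewrite /dotp -!expr2 addr_ge0 // sqr_ge0.
  by apply/eqP; rewrite -eqr_sqrt //; apply/eqP.
have pq0 : dotp p q = 0.
  by move: uv; rewrite /dotp /= => uv; rewrite /p /q /=; lra.
have posn (x : pt R) : x <> 0 -> 0 < dotp x x.
  case: x => x y xy; rewrite /dotp /= -!expr2 lt_neqAle addr_ge0 ?sqr_ge0 // andbT eq_sym.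
  rewrite paddr_eq0 ?sqr_ge0 // !sqrf_eq0; apply/negP => /andP[/eqP E1 /eqP E2].
  by apply: xy; rewrite E1 E2.
have sp0 : 0 < sp.
  apply: posn => E; have [] := ind 1 1; last by move/eqP; rewrite oner_eq0.
  by rewrite -[origin _]/(0 : pt R) -E; congr pair; rewrite /= !mul1r.
have sq0 : 0 < sq.
  apply: posn => E; have [] := ind 1 (-1); last by move/eqP; rewrite oner_eq0.
  by rewrite -[origin _]/(0 : pt R) -E; congr pair; rewrite /= mul1r mulN1r.
pose a := Num.sqrt sp / 2; pose b := Num.sqrt sq / 2.
have rp0 : 0 < Num.sqrt sp by rewrite sqrtr_gt0.
have rq0 : 0 < Num.sqrt sq by rewrite sqrtr_gt0.
have a0 : 0 < a by rewrite divr_gt0.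
have b0 : 0 < b by rewrite divr_gt0.
have rp2 : Num.sqrt sp ^+ 2 = sp by rewrite sqr_sqrtr // ltW.
have rq2 : Num.sqrt sq ^+ 2 = sq by rewrite sqr_sqrtr // ltW.
have a2 : a ^+ 2 = sp / 4 by rewrite /a expr_div_n rp2; congr (_ / _); ring.
have b2 : b ^+ 2 = sq / 4 by rewrite /b expr_div_n rq2; congr (_ / _); ring.
(* Thus the product of [u] and [v] is [a ^+ 2 - b ^+ 2] and the squared length is [a ^+ 2 + b ^+ 2],
   which turns the three excluded angles into [nab], [nab3] and [nba3]. *)
have e1 : dotp u v = (sp - sq) / 4 by rewrite /sp /sq /dotp /p /q /=; lra.
have e2 : dotp u u = (sp + sq) / 4 by move: uv; rewrite /sp /sq /dotp /p /q /=; lra.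
have nab : a ^+ 2 != b ^+ 2 by apply: contra n0 => /eqP; rewrite e1 a2 b2 => E; apply/eqP; lra.
have nab3 : a ^+ 2 != 3 * b ^+ 2.
  by apply: contra n1 => /eqP; rewrite e1 e2 a2 b2 => E; apply/eqP; lra.
have nba3 : b ^+ 2 != 3 * a ^+ 2.
  by apply: contra n2 => /eqP; rewrite e1 e2 a2 b2 => E; apply/eqP; lra.
have [F [F1 F2 F3]] := standard_position a0 b0 nab nab3 nba3.
pose c := p.1 / Num.sqrt sp; pose s := p.2 / Num.sqrt sp.
pose c' := q.1 / Num.sqrt sq; pose s' := q.2 / Num.sqrt sq.
have cs : c ^+ 2 + s ^+ 2 = 1.
  by rewrite /c /s !expr_div_n rp2 -mulrDl !expr2 -/(dotp p p) -/sp divff // gt_eqF.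
have cs' : c' ^+ 2 + s' ^+ 2 = 1.
  by rewrite /c' /s' !expr_div_n rq2 -mulrDl !expr2 -/(dotp q q) -/sq divff // gt_eqF.
have orth : c * c' + s * s' = 0.
  rewrite /c /c' /s /s'.
  transitivity (dotp p q * ((Num.sqrt sp)^-1 * (Num.sqrt sq)^-1)); last by rewrite pq0 mul0r.
  by rewrite /dotp; ring.
(* [D] is the determinant of [psi]; its sign depends on the orientation of the basis. *)
have [D [Dc Ds D2]] : exists D, [/\ c' = - s * D, s' = c * D & D ^+ 2 = 1].
  exists (c * s' - s * c'); split.
  - transitivity (c' * (c ^+ 2 + s ^+ 2)); first by rewrite cs mulr1.
    have -> : c' * (c ^+ 2 + s ^+ 2) = c * (c * c' + s * s') - s * (c * s' - s * c') by ring.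
    by rewrite orth; ring.
  - transitivity (s' * (c ^+ 2 + s ^+ 2)); first by rewrite cs mulr1.
    have -> : s' * (c ^+ 2 + s ^+ 2) = s * (c * c' + s * s') + c * (c * s' - s * c') by ring.
    by rewrite orth; ring.
  transitivity ((c ^+ 2 + s ^+ 2) * (c' ^+ 2 + s' ^+ 2) - (c * c' + s * s') ^+ 2); first ring.
  by rewrite cs cs' orth; ring.
pose psi (x : pt R) : pt R := (x.1 * c + x.2 * c', x.1 * s + x.2 * s').
pose psi' (x : pt R) : pt R := (x.1 * c + x.2 * s, x.1 * c' + x.2 * s').
have psiK : cancel psi psi'.
  move=> [x y]; rewrite /psi /psi' /=; congr pair.
    transitivity (x * (c ^+ 2 + s ^+ 2) + y * (c * c' + s * s')); first ring.
    by rewrite cs orth; ring.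
  transitivity (x * (c * c' + s * s') + y * (c' ^+ 2 + s' ^+ 2)); first ring.
  by rewrite cs' orth; ring.
have psi'K : cancel psi' psi.
  move=> [x y]; rewrite /psi /psi' /=; congr pair; rewrite Dc Ds.
    transitivity (x * (c ^+ 2 + s ^+ 2 * D ^+ 2) + y * (c * s) * (1 - D ^+ 2)); first ring.
    by rewrite D2 mulr1 cs; ring.
  transitivity (x * (c * s) * (1 - D ^+ 2) + y * (s ^+ 2 + c ^+ 2 * D ^+ 2)); first ring.
  by rewrite D2 mulr1 addrC [s ^+ 2 + _]addrC cs; ring.
have psi_iso x y : d2 (psi x) (psi y) = d2 x y.
  rewrite /d2 /psi /=.
  transitivity ((x.1 - y.1) ^+ 2 * (c ^+ 2 + s ^+ 2) + (x.2 - y.2) ^+ 2 * (c' ^+ 2 + s' ^+ 2)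
    + 2 * (x.1 - y.1) * (x.2 - y.2) * (c * c' + s * s')); first ring.
  by rewrite cs cs' orth; ring.
have psiD x y : psi (x + y) = psi x + psi y by congr pair; rewrite /=; ring.
have le1 (x y : R) : x ^+ 2 + y ^+ 2 = 1 -> `|x| <= 1 /\ `|y| <= 1.
  move=> h; have hx := sqr_ge0 x; have hy := sqr_ge0 y.
  by rewrite !ler_norml; split; apply/andP; split; nra.
have [lc ls] := le1 _ _ cs; have [lc' ls'] := le1 _ _ cs'.
have bnd (x y k l e : R) : `|x| < e -> `|y| < e -> `|k| <= 1 -> `|l| <= 1 ->
    `|x * k + y * l| < 2 * e.
  move=> hx hy hk hl; apply: le_lt_trans (ler_normD _ _) _; rewrite !normrM.
  have -> : 2 * e = e + e by ring.
  by apply: ltrD; [apply: le_lt_trans hx|apply: le_lt_trans hy]; rewrite ler_piMr.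
have psi_box e x : box e x -> box (2 * e) (psi x) by move=> [x1 x2]; split; apply: bnd.
have E : G = psi @` range (lattice_pt a b).
  have rpn : Num.sqrt sp != 0 by rewrite gt_eqF.
  have rqn : Num.sqrt sq != 0 by rewrite gt_eqF.
  have psipos i j : psi (lattice_pt a b (i, j)) = padd (pscale i%:~R u) (pscale j%:~R v).
    rewrite /psi /lattice_pt /padd /pscale /= /a /b /c /c' /s /s' rmorphD rmorphB /=.
    by congr pair; rewrite /p /q /=; field; rewrite rpn rqn.
  rewrite GE; apply/seteqP; split=> [_ [i [j ->]]|_ [_ [[i j] _ <-] <-]].
    by exists (lattice_pt a b (i, j)); [exists (i, j)|rewrite psipos].
  by exists i, j; rewrite psipos.
exists (psi @` F); rewrite {}E.
rewrite (Sym_conj psiK psi'K psi_iso) (point_group_conj psiK psi'K psi_iso psiD).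
have F4 := index2_conj psiK F2.
split; first exact: fundamental_conj.
split; first by case: F4.
by split=> //; apply: D4_conj.
Qed.
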